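(* Let $M^2$ be a compact surface and let $(g(t),\varphi(t))$ be a solution on $M^2$, starting at $t=0$, of the rescaled List's extended Ricci flow (with $n=2$) $$\frac{\partial}{\partial t}g_{ij}=-2\left(S_{ij}-\frac{r}{2}g_{ij}\right),\qquad \varphi_t=\Delta\varphi,$$ where $r=r(t)$ is a function depending only on $t$, with $S(t)\ge0$ for all $t$. Let $b$ be a constant and let $\lambda=\lambda^{-\Delta+bS}(t)$ be the eigenvalue of the operator $-\Delta+bS$ with normalized eigenfunction $u$, that is, $$(-\Delta+bS)u=\lambda^{-\Delta+bS}u,\qquad \int_Mu^2\,dv=1.$$ If $|\nabla\varphi|^2g_{ij}\ge2\varphi_i\varphi_j$ and $0<b\le\frac12$, then $$\frac{d}{dt}\left(\lambda^{-\Delta+bS}e^{\int_0^tr(s)\,ds}\right)\ge e^{\int_0^tr(s)\,ds}\int_M\left\{2b^2S^2u^2+(1-2b)\lambda Su^2+2bS|\nabla u|^2+b\alpha^2|\nabla\varphi|^4u^2+2b\alpha(\Delta\varphi)^2u^2\right\}dv\ \ge0.$$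
   Context: $M^2$ is a compact 2-dimensional manifold (without boundary); $g(t)$ is a smooth family of Riemannian metrics and $\varphi=\varphi(t)$ a smooth family of real functions on $M$; $\alpha>0$ is a fixed real constant. $\Delta$, $\nabla$, $dv$ are the Laplacian, gradient and volume element of $g(t)$; $R_{ij}$ is the Ricci tensor, $R$ the scalar curvature, $\varphi_i=\nabla_i\varphi$. Define $S_{ij}=R_{ij}-\alpha\varphi_i\varphi_j$ and $S=g^{ij}S_{ij}=R-\alpha|\nabla\varphi|^2$. Inequalities between symmetric two-tensors are in the sense of quadratic forms and are assumed for all $t$. The eigenvalue and its normalized eigenfunction $u$ are taken at each time $t$ with respect to $g(t)$, $\varphi(t)$ and are understood to depend differentiably on $t$. *)

(* Defs.v *)
From HB Require Import structures.
From mathcomp Require Import all_boot all_order all_algebra.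
From mathcomp Require Import all_classical all_reals all_analysis.
Import Order.TTheory GRing.Theory Num.Theory numFieldNormedType.Exports.

Set Implicit Arguments.
Unset Strict Implicit.
Unset Printing Implicit Defensive.

Local Open Scope classical_set_scope.
Local Open Scope ring_scope.

Section Smoothness.
Context {R : realType} {E : normedModType R}.

(* The increments h are those that keep x + h v in D: this is the ordinary
   directional derivative at interior points of D, and the one-sided time
   derivative at t = 0 when D = [0, T[ or D = [0, T[ x U. *)
Definition has_deriv_within (D : set E) (f : E -> R) (x v : E) (l : R) : Prop :=
  (fun h : R => h^-1 * (f (x + h *: v) - f x))
    @ within [set h : R | D (x + h *: v)] 0^' --> l.

Fixpoint Ck (k : nat) (D : set E) (f : E -> R) : Prop :=
  {within D, continuous f} /\
  if k is k'.+1 then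
    forall v : E, exists f' : E -> R,
      (forall x, D x -> has_deriv_within D f x v (f' x)) /\ Ck k' D f'
  else True.

Definition smooth (D : set E) (f : E -> R) : Prop := forall k, Ck k D f.

End Smoothness.

(* Riemannian geometry in a coordinate domain of R^2: G is the matrix of
   components g_ij of the metric, as a function of the coordinates. *)
Section LocalGeometry.
Context {R : realType}.
Local Notation V := 'rV[R]_2.

Definition pd (i : 'I_2) (f : V -> R) (x : V) : R := 'D_(delta_mx 0 i) f x.

Variable G : V -> 'M[R]_2.

Definition christoffel (k i j : 'I_2) (x : V) : R :=
  2^-1 * \sum_l invmx (G x) k l *
    (pd i (fun y => G y l j) x + pd j (fun y => G y l i) x
     - pd l (fun y => G y i j) x).

(* sign convention: the Ricci tensor of the round sphere is positive *)
Definition ricci (x : V) : 'M[R]_2 := \matrix_(i, j)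
  ((\sum_k pd k (christoffel k i j) x) - (\sum_k pd i (christoffel k k j) x)
   + (\sum_k \sum_l christoffel k k l x * christoffel l i j x)
   - \sum_k \sum_l christoffel k i l x * christoffel l k j x).

Definition gtrace (A : 'M[R]_2) (x : V) : R :=
  \sum_i \sum_j invmx (G x) i j * A i j.

Definition dtensor (f : V -> R) (x : V) : 'M[R]_2 :=
  \matrix_(i, j) (pd i f x * pd j f x).

Definition grad2 (f : V -> R) (x : V) : R := gtrace (dtensor f x) x.

Definition laplacian (f : V -> R) (x : V) : R :=
  gtrace (\matrix_(i, j) (pd i (pd j f) x
                          - \sum_k christoffel k i j x * pd k f x)) x.

Definition S_tensor (alpha : R) (phi : V -> R) (x : V) : 'M[R]_2 :=
  ricci x - alpha *: dtensor phi x.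

Definition S_scalar (alpha : R) (phi : V -> R) (x : V) : R :=
  gtrace (S_tensor alpha phi x) x.

End LocalGeometry.

Definition qform {R : realType} (A : 'M[R]_2) (v : 'rV[R]_2) : R :=
  (v *m A *m v^T) 0 0.

Definition le_tensor {R : realType} (A B : 'M[R]_2) : Prop :=
  forall v : 'rV[R]_2, qform A v <= qform B v.

(* A smooth atlas of dimension 2 on M.  [cinv c] is only meaningful on the
   image of the chart c.  [chart_at p] selects a chart around p; it is used to
   evaluate at p a scalar that is defined by a coordinate formula. *)
Record atlas2 (R : realType) (M : ptopologicalType) := Atlas2 {
  chart : Type;
  dom : chart -> set M;
  cmap : chart -> M -> 'rV[R]_2;
  cinv : chart -> 'rV[R]_2 -> M;
  chart_at : M -> chart;
  dom_chart_at : forall p, dom (chart_at p) p;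
  dom_open : forall c, open (dom c);
  img_open : forall c, open (cmap c @` dom c);
  cmapK : forall c p, dom c p -> cinv c (cmap c p) = p;
  cmap_cont : forall c, {within dom c, continuous (cmap c)};
  cinv_cont : forall c, {within cmap c @` dom c, continuous (cinv c)};
  transition_smooth : forall c d k,
    smooth (cmap c @` (dom c `&` dom d))
           (fun x : 'rV[R]_2 => cmap d (cinv c x) 0 k) }.

Notation borel M := (g_sigma_algebraType (@open M)).

Definition times {R : realType} (T : \bar R) : set R :=
  [set t : R | 0 <= t /\ (t%:E < T)%E].

Definition exp_int {R : realType} (r : R -> R) (t : R) : R :=
  expR (\int[lebesgue_measure]_(s in `[0, t]) r s).

Section Surface.
Context {R : realType} {M : ptopologicalType} (A : atlas2 R M).
Local Notation V := 'rV[R]_2.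

Definition img (c : chart A) : set V := cmap c @` dom c.

Definition local (c : chart A) (f : M -> R) : V -> R := f \o cinv c.

(* components of a two-tensor in each chart, as functions of the coordinates *)
Definition metric_components : Type := chart A -> V -> 'M[R]_2.

Definition transition_jacobian (c d : chart A) (x : V) : 'M[R]_2 :=
  \matrix_(i, k) pd i (fun y => cmap d (cinv c y) 0 k) x.

Record is_metric (g : metric_components) : Prop := IsMetric {
  metric_sym : forall c x, img c x -> (g c x)^T = g c x;
  metric_pos : forall c x v, img c x -> v != 0 -> 0 < qform (g c x) v;
  metric_change : forall c d x, (cmap c @` (dom c `&` dom d)) x ->
    let J := transition_jacobian c d x in
    g c x = J *m g d (cmap d (cinv c x)) *m J^T }.

Definition metric_family (J : set R) (g : R -> metric_components) : Prop :=
  (forall t, J t -> is_metric (g t)) /\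
  forall c i j, smooth (J `*` img c) (fun p : R * V => g p.1 c p.2 i j).

Definition Ck_family (k : nat) (J : set R) (f : R -> M -> R) : Prop :=
  forall c, Ck k (J `*` img c) (fun p : R * V => f p.1 (cinv c p.2)).

Definition smooth_family (J : set R) (f : R -> M -> R) : Prop :=
  forall k, Ck_family k J f.

Definition smooth_on_M (f : M -> R) : Prop :=
  forall c, smooth (img c) (local c f).

Definition M_grad2 (g : metric_components) (f : M -> R) (p : M) : R :=
  let c := chart_at A p in grad2 (g c) (local c f) (cmap c p).

Definition M_laplacian (g : metric_components) (f : M -> R) (p : M) : R :=
  let c := chart_at A p in laplacian (g c) (local c f) (cmap c p).

Definition M_S (g : metric_components) (alpha : R) (phi : M -> R) (p : M) : R :=
  let c := chart_at A p in S_scalar (g c) alpha (local c phi) (cmap c p).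

Definition plane_point (p : R * R) : V :=
  \row_i (if i == 0 then p.1 else p.2).

(* mu is the volume element of g: in every chart dv = sqrt(det g_ij) dx1 dx2 *)
Definition is_volume (g : metric_components)
    (mu : {measure set (borel M) -> \bar R}) : Prop :=
  forall (c : chart A) (B : set (borel M)), measurable B -> B `<=` dom c ->
    mu B = (\int[lebesgue_measure \x lebesgue_measure]_(p in
              [set p : R * R | (cmap c @` B) (plane_point p)])
              (Num.sqrt (\det (g c (plane_point p))))%:E)%E.

Record rescaled_list_flow (alpha : R) (J : set R) (g : R -> metric_components)
    (phi : R -> M -> R) (r : R -> R) : Prop := RescaledListFlow {
  flow_metric : metric_family J g;
  flow_phi : smooth_family J phi;
  flow_eq_g : forall t c x i j, J t -> img c x ->
    has_deriv_within J (fun s => g s c x i j) t 1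
      (- 2 * (S_tensor (g t c) alpha (local c (phi t)) x i j
              - r t / 2 * g t c x i j));
  flow_eq_phi : forall t c x, J t -> img c x ->
    has_deriv_within J (fun s => local c (phi s) x) t 1
      (laplacian (g t c) (local c (phi t)) x) }.

Record eigenpair (g : metric_components) (mu : {measure set (borel M) -> \bar R})
    (alpha b : R) (phi : M -> R) (lambda : R) (u : M -> R) : Prop := Eigenpair {
  eigen_smooth : smooth_on_M u;
  eigen_eq : forall c x, img c x ->
    - laplacian (g c) (local c u) x
    + b * S_scalar (g c) alpha (local c phi) x * local c u x
    = lambda * local c u x;
  eigen_normalized : (\int[mu]_p ((u p) ^+ 2)%:E = 1)%E }.

End Surface.

(* Main.v *)
Require Import Defs.
From HB Require Import structures.
From mathcomp Require Import all_boot all_order all_algebra.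
From mathcomp Require Import all_classical all_reals all_analysis.
From mathcomp Require Import measurable_realfun ring lra.
Import Order.TTheory GRing.Theory Num.Theory numFieldNormedType.Exports.

Set Implicit Arguments.
Unset Strict Implicit.
Unset Printing Implicit Defensive.

Local Open Scope classical_set_scope.
Local Open Scope ring_scope.

(** In dimension 2 the inequality between |grad phi|^2 g and 2 dphi (x) dphi,
    evaluated on the gradient of phi, reads 2 |grad phi|^4 <= |grad phi|^4.
    Hence phi(t) is locally constant, all terms in phi vanish, and S is the
    scalar curvature.  On a surface Ric = (S / 2) g, so that the flow is the
    conformal flow g_t = (r - S) g.

    The derivative of the eigenvalue can then be computed exactly.  A time t is
    fixed, and all integrals are taken with respect to dv(t).  For another time
    s put g(s) = e^W g(t) with rho = e^W.  In the metric g(t) one has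
      Delta W = S(t) - rho S(s)  and  Delta u(s) = rho (b S(s) - lambda(s)) u(s),
    from the conformal change of curvature ([gauss_conformal]) and of the
    Laplacian ([laplacian_conformal]).  Green's formula ([green]) is applied to
    the pairs (u(s), u(t)), (u(t), u(s)), (u(t) u(s), W), (W u(s), u(t)) and
    (W u(t), u(s)).  In the combination [defectE] the derivatives of W disappear,
    and what remains is the vanishing of the integral of
      u(t) u(s) (lambda(s) rho - lambda(t))
      + b W (u(t) u(s) (b S(t) - lambda(t) + rho (b S(s) - lambda(s)))
             + 2 <grad u(t), grad u(s)>).
    Divided by s - t, this converges uniformly as s tends to t, since rho - 1
    and W are both (r - S)(s - t) + o(s - t).  The limit ([defect0_null])
    together with the normalisation of u and with Green's formula for the pair
    (u(t), u(t)) gives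
      lambda' + r lambda = integral of
        2 b^2 S^2 u^2 + (1 - 2 b) lambda S u^2 + 2 b S |grad u|^2,
    which is [eigenvalue_variation].  After multiplication by the exponential of
    the integral of r this is the claimed inequality, with equality.  The right
    hand side is nonnegative because S >= 0, b <= 1/2, and lambda >= 0
    ([eigenvalue_ge0]).

    Comparing two times by Green's formula, instead of differentiating under the
    integral sign, uses the eigenfunctions only through the continuity of u and
    of its gradient in space-time.

    The geometry is developed in coordinates.  Curvature and Laplacian are
    rational functions of the 2-jet of the metric, so that Ric = K g and the
    conformal formulas are identities between rational functions.  Green's
    formula comes from the divergence form of the Laplacian ([divergence_flux]),
    Fubini and the fundamental theorem of calculus on boxes ([box_divergence]),
    and a partition of unity made of C1 bump functions.  The scalar curvature
    and the Laplacians of W and of u(s) do not depend on the chart because the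
    flow and the eigenvalue equation determine them. *)

(** * Continuously differentiable functions of two variables *)

Section Cont.
Context {R : realType} {T : topologicalType}.
Implicit Types (f g : T -> R) (x : T).
Lemma cont_cst (a : R) x : {for x, continuous (fun _ : T => a)}.
Proof. exact: cst_continuous. Qed.
Lemma cont_add f g x : {for x, continuous f} -> {for x, continuous g} ->
  {for x, continuous (fun y => f y + g y)}.
Proof. by move=> hf hg; exact: (cvgD hf hg). Qed.
Lemma cont_opp f x : {for x, continuous f} -> {for x, continuous (fun y => - f y)}.
Proof. by move=> hf; exact: (cvgN hf). Qed.
Lemma cont_mul f g x : {for x, continuous f} -> {for x, continuous g} ->
  {for x, continuous (fun y => f y * g y)}.
Proof. by move=> hf hg; exact: (cvgM hf hg). Qed.
Lemma cont_inv f x : f x != 0 -> {for x, continuous f} ->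
  {for x, continuous (fun y => (f y)^-1)}.
Proof. by move=> f0 hf; exact: (cvgV f0 hf). Qed.
Lemma cont_dist f x : {for x, continuous f} ->
  forall e, 0 < e -> \forall y \near x, `|f y - f x| < e.
Proof. by move=> /cvgrPdistC_lt. Qed.
Lemma cont_of_dist f x : (forall e, 0 < e -> \forall y \near x, `|f y - f x| < e) ->
  {for x, continuous f}.
Proof. by move=> H; apply/cvgrPdistC_lt. Qed.
Lemma cont_sum n (F : 'I_n -> T -> R) x : (forall i, {for x, continuous (F i)}) ->
  {for x, continuous (fun y => \sum_i F i y)}.
Proof.
elim: n F => [|n IH] F H.
  have -> : (fun y => \sum_i F i y) = (fun=> 0) by apply/funext => y; rewrite big_ord0.
  exact: cont_cst.
have -> : (fun y => \sum_i F i y) = (fun y => F ord0 y + \sum_i F (lift ord0 i) y).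
  by apply/funext => y; rewrite big_ord_recl.
by apply: cont_add => //; exact: IH.
Qed.
End Cont.

Section Line.
Context {R : realType}.
Local Notation V := 'rV[R]_2.

Definition ee (i : 'I_2) : V := delta_mx 0 i.

Lemma norm_coord_le (x : V) i : `|x 0 i| <= `|x|.
Proof.
rewrite [leRHS]/Num.norm/= mx_normrE.
exact: (le_bigmax _ (fun j : 'I_1 * 'I_2 => `|x j.1 j.2|) (0, i)).
Qed.

Lemma norm_le_coord (x : V) (r : R) : 0 <= r -> (forall i, `|x 0 i| <= r) -> `|x| <= r.
Proof.
move=> r0 H; rewrite [leLHS]/Num.norm/= mx_normrE.
by apply: bigmax_le => //= -[i j] _; rewrite /= ord1.
Qed.

Lemma rV2E (x : V) : x = x 0 0 *: ee 0 + x 0 1 *: ee 1.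
Proof.
apply/rowP => j; rewrite !mxE /=.
case: j => -[|[|//]] hj; rewrite /= ?mulr1 ?mulr0 ?addr0 ?add0r; congr (x _ _); exact: val_inj.
Qed.

Lemma ee_coord i j : ee i 0 j = (i == j)%:R.
Proof. by rewrite /ee mxE eqxx /= eq_sym. Qed.

Lemma norm_ee_le (s : R) i : `|s *: ee i| <= `|s|.
Proof.
apply: norm_le_coord => // j; rewrite !mxE eqxx /=.
by case: (j == i); rewrite ?mulr1 ?mulr0 ?normr0.
Qed.

Lemma is_derive_line (f : V -> R) (y v : V) (s : R) :
  derivable f (y + s *: v) v ->
  is_derive s 1 (fun s => f (y + s *: v)) ('D_v f (y + s *: v)).
Proof.
have E : (fun h : R => h^-1 *: (((fun s => f (y + s *: v)) \o shift s) (h *: 1) - f (y + s *: v)))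
  = (fun h => h^-1 *: ((f \o shift (y + s *: v)) (h *: v) - f (y + s *: v))).
  apply/funext => h /=; congr (_ *: (f _ - _)).
  by rewrite -[h *: 1]/(h * 1) mulr1 scalerDl addrCA.
by move=> df; split; rewrite /derivable /derive E.
Qed.

Lemma mvt0 (g dg : R -> R) (s : R) :
  (forall c : R, `|c| <= `|s| -> is_derive c 1 g (dg c)) ->
  exists2 c, `|c| <= `|s| & g s - g 0 = s * dg c.
Proof.
move=> H.
have cont (a b : R) : (forall c, a <= c <= b -> `|c| <= `|s|) -> {within `[a, b], continuous g}.
  move=> Hc; apply: derivable_within_continuous => x; rewrite in_itv /= => /Hc /H hx.
  exact: ex_derive.
have [s0|s0] := leP 0 s.
- have Hc c : 0 <= c <= s -> `|c| <= `|s| by move=> /andP[? ?]; rewrite !ger0_norm.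
  have [||c] := @MVT_segment _ g dg 0 s s0.
    by move=> x; rewrite in_itv /= => /andP[/ltW ? /ltW ?]; apply/H/Hc/andP.
    exact: cont.
  by rewrite in_itv /= subr0 mulrC => hc E; exists c => //; apply: Hc.
- have Hc c : s <= c <= 0 -> `|c| <= `|s|.
    by move=> /andP[? ?]; rewrite (ltr0_norm s0) ler0_norm // lerN2.
  have [||c] := @MVT_segment _ g dg s 0 (ltW s0).
    by move=> x; rewrite in_itv /= => /andP[/ltW ? /ltW ?]; apply/H/Hc/andP.
    exact: cont.
  rewrite in_itv /= sub0r => hc E; exists c; first exact: Hc.
  by rewrite -opprB E mulrN opprK mulrC.
Qed.

Lemma mvt_line (f : V -> R) (y v : V) (s : R) :
  (forall c : R, `|c| <= `|s| -> derivable f (y + c *: v) v) ->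
  exists2 c, `|c| <= `|s| & f (y + s *: v) - f y = s * 'D_v f (y + c *: v).
Proof.
move=> H; have [c cs E] := @mvt0 (fun c => f (y + c *: v)) (fun c => 'D_v f (y + c *: v)) s
  (fun c hc => is_derive_line (H c hc)).
by exists c => //; rewrite -E scale0r addr0.
Qed.

End Line.
Arguments ee {R} i.

Section LinComb.
Context {R : realType}.
Local Notation V := 'rV[R]_2.
Variable a : 'I_2 -> R.
Definition lincomb (h : V) : R := \sum_i h 0 i * a i.
Lemma lincomb_linear : linear lincomb.
Proof.
move=> k u v; rewrite /lincomb scaler_sumr -big_split /=.
by apply: eq_bigr => i _; rewrite !mxE mulrDl -scalerAl.
Qed.
HB.instance Definition _ := GRing.isLinear.Build R V R _ lincomb lincomb_linear.
Lemma lincomb_cont : continuous lincomb.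
Proof.
move=> x; apply: cont_sum => i.
by apply: cont_mul; [exact: coord_continuous|exact: cont_cst].
Qed.
End LinComb.

Lemma near_norm (R : realType) (V : normedModType R) (x : V) (P : V -> Prop) :
  (\forall y \near x, P y) -> exists2 d : R, 0 < d & forall y, `|y - x| < d -> P y.
Proof.
move=> /nbhs_normP[d /= d0 B]; exists d => // y hy; apply: B.
by rewrite /ball_ /= distrC.
Qed.

Lemma norm_near (R : realType) (V : normedModType R) (x : V) (d : R) :
  0 < d -> \forall y \near x, `|y - x| < d.
Proof.
move=> d0; apply/nbhs_normP; exists d => //= y; by rewrite /ball_ /= distrC.
Qed.

(** An explicit candidate and an epsilon estimate spare all computation with the
    little-o notation. *)
Lemma diff_of_expansion (R : realType) (V W : normedModType R) (f : V -> W)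
    (L : {linear V -> W}) (x : V) : continuous L ->
  (forall e : R, 0 < e -> \forall h \near (0 : V), `|f (h + x) - (f x + L h)| <= e * `|h|) ->
  differentiable f x /\ 'd f x = L :> (V -> W).
Proof.
move=> cL H.
have key : f \o shift x = cst (f x) + L +o_ 0 id.
  by apply/eqaddoP => e e0; exact: H.
have dL := diff_unique cL key.
by split => //; apply/diff_locallyP; rewrite dL.
Qed.

Section C1Germs.
Context {R : realType}.
Local Notation V := 'rV[R]_2.

(** The condition is imposed on a whole neighbourhood, so that it depends only on
    the germ of f at x and still holds at the nearby points. *)
Definition C1 (f : V -> R) (x : V) : Prop :=
  \forall y \near x, forall i, derivable f y (ee i) /\ {for y, continuous (pd i f)}.

Lemma C1_near f x : C1 f x -> \forall y \near x, C1 f y.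
Proof. exact: near_join. Qed.

Lemma C1_derivable f x i : C1 f x -> derivable f x (ee i).
Proof. by move=> /nbhs_singleton/(_ i)[]. Qed.

Lemma C1_pd_cont f x i : C1 f x -> {for x, continuous (pd i f)}.
Proof. by move=> /nbhs_singleton/(_ i)[]. Qed.
Arguments C1_pd_cont {f x} i.

Lemma pd_eq_near (f g : V -> R) (x : V) i : (\forall y \near x, f y = g y) -> pd i f x = pd i g x.
Proof. exact: near_eq_derive. Qed.

Lemma pd_near_eq (f g : V -> R) (x : V) i :
  (\forall y \near x, f y = g y) -> (\forall y \near x, pd i f y = pd i g y).
Proof. by move=> /near_join; apply: filterS => y; exact: pd_eq_near. Qed.

Lemma near_eq_cont (T U : topologicalType) (f g : T -> U) (x : T) :
  (\forall y \near x, f y = g y) -> {for x, continuous f} -> {for x, continuous g}.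
Proof.
move=> fg; rewrite /prop_for /continuous_at -(nbhs_singleton fg) => h.
exact: (cvg_trans (near_eq_cvg fg) h).
Qed.

Lemma C1_eq_near (f g : V -> R) (x : V) : (\forall y \near x, f y = g y) -> C1 f x -> C1 g x.
Proof.
move=> /near_join fg /near_join Cf; apply: filterS2 fg Cf => y fg Cf i; split.
  by apply: (@near_eq_derivable R V R f g y _ fg); exact: C1_derivable i Cf.
by apply: near_eq_cont (C1_pd_cont _ Cf); exact: pd_near_eq.
Qed.

(** The increment is cut into one step along each axis.  By the mean value theorem
    each step is governed by a partial derivative at a nearby point, which is close
    to the one at x by continuity. *)
Lemma C1_expansion f x : C1 f x ->
  differentiable f x /\ 'd f x = lincomb (pd ^~ f ^~ x) :> (V -> R).
Proof.
move=> Cf; apply: diff_of_expansion; first exact: lincomb_cont.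
  move=> e e0.
  have e20 : 0 < e / 2 by rewrite divr_gt0.
  have est (a a' p q N : R) : `|a| <= N -> `|a'| <= N -> `|p| < e / 2 -> `|q| < e / 2 ->
      `|a * p + a' * q| <= e * N.
    move=> ha ha' hp hq; apply: le_trans (ler_normD _ _) _; rewrite !normrM.
    have -> : e * N = N * (e / 2) + N * (e / 2) by field.
    by apply: lerD; apply: ler_pM => //; exact: ltW.
  have c0 : \forall t \near x, `|pd 0 f t - pd 0 f x| < e / 2.
    exact: cont_dist (C1_pd_cont 0 Cf) _ e20.
  have c1 : \forall t \near x, `|pd 1 f t - pd 1 f x| < e / 2.
    exact: cont_dist (C1_pd_cont 1 Cf) _ e20.
  have [d d0 B'] : exists2 d, 0 < d & forall y, `|y - x| < d ->
      [/\ forall i, derivable f y (ee i), `|pd 0 f y - pd 0 f x| < e/2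
        & `|pd 1 f y - pd 1 f x| < e/2].
    apply: near_norm; apply: filterS3 (C1_near Cf) c0 c1 => y Cy h0 h1.
    by split; [move=> i; exact: C1_derivable|exact: h0|exact: h1].
  near=> h.
  have hd : `|h| < d by near: h; have := norm_near (0 : V) d0; apply: filterS => h; rewrite subr0.
  pose y := x + h 0 1 *: ee 1.
  have bd0 c : `|c| <= `|h 0 0| -> `|y + c *: ee 0 - x| < d.
    move=> hc; apply: le_lt_trans hd; rewrite /y -[x + _ + _]addrA addrAC subrr add0r.
    apply: norm_le_coord => // i; rewrite !mxE eqxx /=.
    case: i => -[|[|//]] hi /=; rewrite ?mulr1 ?mulr0 ?addr0 ?add0r.
      exact: le_trans hc (norm_coord_le _ _).
    exact: norm_coord_le.
  have bd1 c : `|c| <= `|h 0 1| -> `|x + c *: ee 1 - x| < d.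
    move=> hc; apply: le_lt_trans hd; rewrite addrAC subrr add0r.
    by rewrite (le_trans (norm_ee_le _ _))// (le_trans hc)// norm_coord_le.
  have [c c_le Ec] := @mvt_line _ f y (ee 0) (h 0 0) (fun c hc => (let: And3 a _ _ := B' _ (bd0 c hc) in a) 0).
  have [c' c'_le Ec'] := @mvt_line _ f x (ee 1) (h 0 1) (fun c hc => (let: And3 a _ _ := B' _ (bd1 c hc) in a) 1).
  have -> : f (h + x) - (f x + lincomb (pd ^~ f ^~ x) h) =
     h 0 0 * (pd 0 f (y + c *: ee 0) - pd 0 f x) + h 0 1 * (pd 1 f (x + c' *: ee 1) - pd 1 f x).
    rewrite !mulrBr -[h 0 0 * pd 0 f _]Ec -[h 0 1 * pd 1 f _]Ec' /lincomb big_ord_recl big_ord1.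
    have -> : lift ord0 ord0 = 1 :> 'I_2 by exact: val_inj.
    have -> : h + x = y + h 0 0 *: ee 0 by rewrite [in LHS](rV2E h) /y addrC addrAC addrA.
    rewrite -/y; ring.
  have [_ b0 _] := B' _ (bd0 _ c_le).
  have [_ _ b1] := B' _ (bd1 _ c'_le).
  exact: est (norm_coord_le h 0) (norm_coord_le h 1) b0 b1.
Unshelve. all: by end_near. Qed.

Lemma C1_diff f x : C1 f x -> differentiable f x.
Proof. by move=> /C1_expansion[]. Qed.

Lemma C1_cont f x : C1 f x -> {for x, continuous f}.
Proof. by move=> /C1_diff /differentiable_continuous. Qed.

Lemma C1P f x : (\forall y \near x, forall i, derivable f y (ee i) /\ {for y, continuous (pd i f)}) -> C1 f x.
Proof. by []. Qed.

End C1Germs.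
Arguments C1_pd_cont {R f x} i _.
(* Unification must not unfold this definition into statements about derivatives. *)
Global Opaque C1.

(** * Rules of differentiation, the chain rule and the symmetry of second derivatives *)

Lemma ord2P (k : 'I_2) : k = 0 \/ k = 1.
Proof. by case: k => -[|[|//]] hk; [left|right]; exact: val_inj. Qed.

Lemma near_all (T : topologicalType) (x : T) (P : T -> Prop) :
  (forall y, P y) -> \forall y \near x, P y.
Proof. by move=> h; exact: nearW. Qed.

Section PartialRules.
Context {R : realType}.
Local Notation V := 'rV[R]_2.
Implicit Types (f g : V -> R) (x v : V).

Lemma isd_mul f g x v a b : is_derive x v f a -> is_derive x v g b ->
  is_derive x v (fun y => f y * g y) (f x * b + g x * a).
Proof. exact: is_deriveM. Qed.

Lemma isd_add f g x v a b : is_derive x v f a -> is_derive x v g b ->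
  is_derive x v (fun y => f y + g y) (a + b).
Proof. exact: is_deriveD. Qed.

Lemma isd_opp f x v a : is_derive x v f a -> is_derive x v (fun y => - f y) (- a).
Proof. exact: is_deriveN. Qed.

Lemma isd_line f x v a : is_derive x v f a <->
  is_derive (0 : R) 1 (fun h : R => f (h *: v + x)) a.
Proof.
have E : (fun h : R => h^-1 *: ((f \o shift x) (h *: v) - f x)) =
  (fun h : R => h^-1 *: (((fun h : R => f (h *: v + x)) \o shift 0) (h *: 1) - f (0 *: v + x))).
  by apply/funext => h /=; rewrite addr0 scale0r add0r [_%:A]mulr1.
split=> -[da Da]; split.
- by rewrite /derivable -E.
- by rewrite /derive -E.
- by rewrite /derivable E.
- by rewrite /derive E.
Qed.

Lemma isd_comp1 f (p : R -> R) x v a b : is_derive x v f a ->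
  is_derive (f x) 1 p b -> is_derive x v (fun y => p (f y)) (b * a).
Proof.
move=> /isd_line fa pb; apply/isd_line.
by apply: (@is_derive1_comp _ p _ 0) fa; rewrite scale0r add0r.
Qed.

Lemma isd_inv f x v a : f x != 0 -> is_derive x v f a ->
  is_derive x v (fun y => (f y)^-1) (- (f x) ^- 2 * a).
Proof.
move=> f0 fa; apply: isd_comp1 fa _.
have := @is_deriveV R id (f x) 1 1 f0 (is_derive_id _ _).
by move=> h; apply: is_derive_eq h _; rewrite -[_ *: 1]/(_ * 1) mulr1.
Qed.

Lemma isd_pd f x i : C1 f x -> is_derive x (ee i) f (pd i f x).
Proof. by move=> h; rewrite /pd; apply/derivableP; exact: C1_derivable. Qed.

Lemma isd_val f x v d : is_derive x v f d -> 'D_v f x = d.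
Proof. by case. Qed.

Lemma isd_pdE f x i d : is_derive x (ee i) f d -> pd i f x = d.
Proof. by rewrite /pd; exact: isd_val. Qed.

Lemma isd_eq f x v a b : is_derive x v f a -> a = b -> is_derive x v f b.
Proof. by move=> h <-. Qed.

Lemma isd_line_pd f x i (s : R) : C1 f (x + s *: ee i) ->
  is_derive s 1 (fun s => f (x + s *: ee i)) (pd i f (x + s *: ee i)).
Proof. by move=> h; rewrite /pd; apply: is_derive_line; exact: C1_derivable. Qed.

(** The usual way to recognise a C1 germ is to exhibit its partial derivatives. *)
Lemma C1_intro f (df : 'I_2 -> V -> R) x :
  (\forall y \near x, forall i, is_derive y (ee i) f (df i y)) ->
  (\forall y \near x, forall i, {for y, continuous (df i)}) -> C1 f x.
Proof.
move=> /near_join H1 H2; apply: C1P; apply: filterS2 H1 H2 => y H1 H2 i; split.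
  by have /(_ i) h := nbhs_singleton H1; exact: (@ex_derive _ _ _ _ _ _ _ h).
apply: near_eq_cont (H2 i); apply: filterS H1 => z /(_ i) h.
exact/esym/isd_pdE.
Qed.

Lemma C1_cst (c : R) x : C1 (fun=> c) x.
Proof.
apply: (@C1_intro _ (fun _ _ => 0)); apply: near_all => y i.
  exact: is_derive_cst.
exact: cont_cst.
Qed.

Lemma C1_add f g x : C1 f x -> C1 g x -> C1 (fun y => f y + g y) x.
Proof.
move=> /C1_near Cf /C1_near Cg.
apply: (@C1_intro _ (fun i y => pd i f y + pd i g y));
  apply: filterS2 Cf Cg => y Cf Cg i.
  by apply: isd_add; exact: isd_pd.
by apply: cont_add; exact: C1_pd_cont.
Qed.

Lemma C1_opp f x : C1 f x -> C1 (fun y => - f y) x.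
Proof.
move=> /C1_near Cf.
apply: (@C1_intro _ (fun i y => - pd i f y)); apply: filterS Cf => y Cf i.
  by apply: isd_opp; exact: isd_pd.
by apply: cont_opp; exact: C1_pd_cont.
Qed.

Lemma C1_mul f g x : C1 f x -> C1 g x -> C1 (fun y => f y * g y) x.
Proof.
move=> /C1_near Cf /C1_near Cg.
apply: (@C1_intro _ (fun i y => f y * pd i g y + g y * pd i f y));
  apply: filterS2 Cf Cg => y Cf Cg i.
  by apply: isd_mul; exact: isd_pd.
by apply: cont_add; apply: cont_mul; by [exact: C1_pd_cont|exact: C1_cont].
Qed.

Lemma C1_comp1 f (p dp : R -> R) x : C1 f x ->
  (\forall y \near f x, is_derive y (1 : R) p (dp y) /\ {for y, continuous dp}) ->
  C1 (fun y => p (f y)) x.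
Proof.
move=> Cf Hp.
have Hp' : \forall y \near x, is_derive (f y) (1 : R) p (dp (f y)) /\ {for f y, continuous dp}.
  exact: (C1_cont Cf) Hp.
have {}Cf := C1_near Cf.
apply: (@C1_intro _ (fun i y => dp (f y) * pd i f y));
  apply: filterS2 Cf Hp' => y Cf [H1 H2] i.
  by apply: isd_comp1 => //; exact: isd_pd.
apply: cont_mul; last exact: C1_pd_cont.
by apply: (@continuous_comp _ _ _ f dp) => //; exact: C1_cont.
Qed.

Lemma C1_inv f x : f x != 0 -> C1 f x -> C1 (fun y => (f y)^-1) x.
Proof.
move=> f0 Cf; apply: (@C1_comp1 f GRing.inv (fun y => - y ^- 2)) => //.
have : \forall y \near f x, y != 0.
  by apply: open_nbhs_nbhs; split => //; exact: open_neq.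
apply: filterS => y y0; split.
  by have h := @isd_inv; have := @is_deriveV R id y 1 1 y0 (is_derive_id _ _);
    move=> {}h; apply: is_derive_eq h _; rewrite -[_ *: 1]/(_ * 1) mulr1.
apply: cont_opp; apply: cont_inv; first by rewrite expf_neq0.
exact: exprn_continuous.
Qed.

Lemma C1_sum n (F : 'I_n -> V -> R) x : (forall i, C1 (F i) x) ->
  C1 (fun y => \sum_i F i y) x.
Proof.
elim: n F => [|n IH] F H.
  have -> : (fun y => \sum_i F i y) = (fun=> 0) by apply/funext => y; rewrite big_ord0.
  exact: C1_cst.
have -> : (fun y => \sum_i F i y) = (fun y => F ord0 y + \sum_i F (lift ord0 i) y).
  by apply/funext => y; rewrite big_ord_recl.
by apply: C1_add => //; exact: IH.
Qed.

Lemma pd_add f g x i : C1 f x -> C1 g x ->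
  pd i (fun y => f y + g y) x = pd i f x + pd i g x.
Proof. by move=> Cf Cg; apply/isd_pdE/isd_add; exact: isd_pd. Qed.

Lemma pd_mul f g x i : C1 f x -> C1 g x ->
  pd i (fun y => f y * g y) x = f x * pd i g x + g x * pd i f x.
Proof. by move=> Cf Cg; apply/isd_pdE/isd_mul; exact: isd_pd. Qed.

Lemma pd_cst (c : R) x i : pd i (fun=> c) x = 0.
Proof. by rewrite /pd; exact: derive_cst. Qed.

Lemma C1_coord (k : 'I_2) x : C1 (fun y : V => y 0 k) x.
Proof.
apply: (@C1_intro _ (fun i _ => (i == k)%:R)); apply: near_all => y i; last exact: cont_cst.
apply/isd_line.
have -> : (fun h : R => (h *: ee i + y) 0 k) = (fun h => (i == k)%:R * h + y 0 k).
  by apply/funext => h; rewrite mxE mxE ee_coord mulrC.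
apply: is_derive_eq; by rewrite -[_ *: 1]/(_ * 1) !addr0 mulr1.
Qed.

End PartialRules.
Global Opaque pd.

Section Chain.
Context {R : realType}.
Local Notation V := 'rV[R]_2.

Lemma cont_rV (T : topologicalType) (tau : T -> V) (x : T) :
  (forall k, {for x, continuous (fun y => tau y 0 k)}) -> {for x, continuous tau}.
Proof.
move=> H; apply/cvgrPdistC_lt => e e0.
have e2 : 0 < e / 2 by rewrite divr_gt0.
near=> y.
apply: (@le_lt_trans _ _ (e / 2)); last by rewrite ltr_pdivrMr// ltr_pMr// ltr1n.
apply: norm_le_coord => [|k]; first exact: ltW.
rewrite !mxE; apply: ltW; have [->|->] := ord2P k.
  by near: y; exact: cont_dist (H _) _ e2.
by near: y; exact: cont_dist (H _) _ e2.
Unshelve. all: by end_near. Qed.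

(** C1 germs are differentiable, and the differential of a composition is the
    composition of the differentials. *)
Lemma chain_rule (F : V -> R) (tau : V -> V) (x : V) i :
  C1 F (tau x) -> (forall k, C1 (fun y => tau y 0 k) x) ->
  is_derive x (ee i) (fun y => F (tau y))
    (\sum_k pd i (fun y => tau y 0 k) x * pd k F (tau x)).
Proof.
move=> CF Ct; apply/isd_line.
pose c := fun h : R => tau (h *: ee i + x).
have c0 : c 0 = tau x by rewrite /c scale0r add0r.
have dc k : is_derive (0 : R) 1 (fun h => c h 0 k) (pd i (fun y => tau y 0 k) x).
  exact: (iffLR (isd_line (fun y => tau y 0 k) x (ee i) _) (isd_pd i (Ct k))).
have dcv : derivable c 0 1.
  by apply/derivable_mxP => a k; rewrite (ord1 a); have [] := dc k.
have [dF EF] := C1_expansion CF.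
have dc0 : differentiable c 0 by apply/derivable1_diffP.
have dFc : differentiable F (c 0) by rewrite c0.
have dcomp : differentiable (F \o c) 0 by exact: differentiable_comp.
split; first exact/derivable1_diffP.
rewrite -[LHS]/('D_1 (F \o c) 0) deriveE // diff_comp // [LHS]/=.
rewrite c0 EF -deriveE // /lincomb; apply: eq_bigr => k _; congr (_ * _).
by rewrite derive_mx // mxE; have [] := dc k.
Qed.

Lemma C1_comp (F : V -> R) (tau : V -> V) (x : V) :
  C1 F (tau x) -> (forall k, C1 (fun y => tau y 0 k) x) -> C1 (fun y => F (tau y)) x.
Proof.
move=> CF Ct.
have ct : {for x, continuous tau} by apply: cont_rV => k; exact: (C1_cont (Ct k)).
have H : \forall y \near x, C1 F (tau y) /\ forall k, C1 (fun y => tau y 0 k) y.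
  have hF : \forall y \near x, C1 F (tau y) := ct _ (C1_near CF).
  have h0 := C1_near (Ct 0); have h1 := C1_near (Ct 1).
  apply: filterS (filterI hF (filterI h0 h1)) => y [h [h2 h3]].
  split; first exact: h.
  move=> k; have [->|->] := ord2P k; [exact: h2|exact: h3].
apply: (@C1_intro _ _ (fun i y => \sum_k pd i (fun y => tau y 0 k) y * pd k F (tau y)));
  apply: filterS H => y [CFy Cty] i; first exact: chain_rule.
have cy : {for y, continuous tau} by apply: cont_rV => k; exact: (C1_cont (Cty k)).
apply: cont_sum => k; apply: cont_mul; first by apply: C1_pd_cont; exact: Cty.
by apply: (@continuous_comp _ _ _ tau (pd k F) y cy); exact: (C1_pd_cont k CFy).
Qed.

End Chain.

Section MixedDerivatives.
Context {R : realType}.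
Local Notation V := 'rV[R]_2.

(** The left hand side is the increment over [0, h] of
    s |-> f (x + h v + s u) - f (x + s u).  The mean value theorem applies to this
    function, and then to the derivative Du in the direction v. *)
Lemma second_difference (f : V -> R) (x u v : V) (Du Dvu : V -> R) (h : R) :
  (forall a b : R, `|a| <= `|h| -> `|b| <= `|h| ->
     is_derive (x + a *: u + b *: v) u f (Du (x + a *: u + b *: v)) /\
     is_derive (x + a *: u + b *: v) v Du (Dvu (x + a *: u + b *: v))) ->
  exists a b : R, [/\ `|a| <= `|h|, `|b| <= `|h| &
    f (x + h *: u + h *: v) - f (x + h *: u) - f (x + h *: v) + f x =
      h * (h * Dvu (x + a *: u + b *: v))].
Proof.
move=> H.
pose g s := f (x + h *: v + s *: u) - f (x + s *: u).
have nh0 : `|0 : R| <= `|h| by rewrite normr0.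
have dg (c : R) : `|c| <= `|h| -> is_derive c 1 g (Du (x + c *: u + h *: v) - Du (x + c *: u)).
  move=> hc; rewrite /g.
  have [H1 _] := H c h hc (lexx _); have [H2 _] := H c 0 hc nh0.
  rewrite scale0r addr0 in H2.
  rewrite addrAC in H1.
  apply: is_deriveB.
    have := @is_derive_line _ f (x + h *: v) u c (@ex_derive _ _ _ _ _ _ _ H1).
    by rewrite (isd_val H1) [in X in _ -> is_derive _ _ _ X]addrAC.
  have := @is_derive_line _ f x u c (@ex_derive _ _ _ _ _ _ _ H2).
  by rewrite (isd_val H2).
have [a ha Ea] := mvt0 dg.
have [|b hb Eb] := @mvt_line _ Du (x + a *: u) v h.
  by move=> c hc; have [_ []] := H a c ha hc.
exists a, b; split => //.
have [_ H2] := H a b ha hb.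
rewrite (isd_val H2) in Eb; rewrite -Eb -Ea /g !scale0r !addr0.
rewrite [x + h *: v + _]addrAC; ring.
Qed.

(** On a small square the same second difference is h^2 times either of the two
    mixed derivatives at some point ([second_difference]), and both are close to
    their values at x. *)
Lemma schwarz (f : V -> R) (x : V) : C1 f x -> (forall i, C1 (pd i f) x) ->
  forall i j, pd i (pd j f) x = pd j (pd i f) x.
Proof.
move=> Cf Cp.
suff H : pd 0 (pd 1 f) x = pd 1 (pd 0 f) x.
  move=> i j; have [->|->] := ord2P i; have [->|->] := ord2P j; [exact: erefl|exact: H|exact: esym H|exact: erefl].
apply/eqP; rewrite -subr_eq0 -normr_le0; apply/ler_addgt0Pr => e e0; rewrite add0r.
have e2 : 0 < e / 2 by rewrite divr_gt0.
have [d d0 B] : exists2 d : R, 0 < d & forall y, `|y - x| < d ->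
  [/\ C1 f y, C1 (pd 0 f) y, C1 (pd 1 f) y, `|pd 0 (pd 1 f) y - pd 0 (pd 1 f) x| < e / 2
   & `|pd 1 (pd 0 f) y - pd 1 (pd 0 f) x| < e / 2].
  have Q0 := C1_near Cf; have Q1 := C1_near (Cp 0); have Q2 := C1_near (Cp 1).
  have Q3 := cont_dist (C1_pd_cont 0 (Cp 1)) e2.
  have Q4 := cont_dist (C1_pd_cont 1 (Cp 0)) e2.
  apply: near_norm.
  apply: filterS (filterI Q0 (filterI Q1 (filterI Q2 (filterI Q3 Q4)))).
  by move=> y [q0 [q1 [q2 [q3 q4]]]]; exact: And5 q0 q1 q2 q3 q4.
(* the square of side 2 h around x lies in the ball of radius d *)
pose h := d / 4.
have h0 : 0 < h by rewrite divr_gt0.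
have bd (i j : 'I_2) (a b : R) : `|a| <= `|h| -> `|b| <= `|h| ->
    `|x + a *: ee i + b *: ee j - x| < d.
  move=> ha hb; rewrite -[x + _ + _]addrA addrAC subrr add0r.
  rewrite (le_lt_trans (ler_normD _ _)) //.
  apply: (@le_lt_trans _ _ (`|h| + `|h|)).
    by apply: lerD; apply: le_trans (norm_ee_le _ _) _.
  rewrite gtr0_norm // /h; lra.
have [a [b [ha hb E1]]] := @second_difference f x (ee 0) (ee 1) (pd 0 f) (pd 1 (pd 0 f)) h
  (fun a b ha hb => let: And5 p q _ _ _ := B _ (bd 0 1 a b ha hb) in conj (isd_pd _ p) (isd_pd _ q)).
have [a' [b' [ha' hb' E2]]] := @second_difference f x (ee 1) (ee 0) (pd 1 f) (pd 0 (pd 1 f)) h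
  (fun a b ha hb => let: And5 p _ q _ _ := B _ (bd 1 0 a b ha hb) in conj (isd_pd _ p) (isd_pd _ q)).
have [_ _ _ _ B1] := B _ (bd 0 1 a b ha hb).
have [_ _ _ B2 _] := B _ (bd 1 0 a' b' ha' hb').
have E : pd 1 (pd 0 f) (x + a *: ee 0 + b *: ee 1) = pd 0 (pd 1 f) (x + a' *: ee 1 + b' *: ee 0).
  apply: (mulfI (lt0r_neq0 h0)); apply: (mulfI (lt0r_neq0 h0)).
  apply: (etrans (esym E1)); apply: (etrans _ E2).
  have -> : x + h *: ee 1 + h *: ee 0 = x + h *: ee 0 + h *: ee 1 by exact: addrAC.
  congr (_ + _); exact: addrAC.
rewrite E in B1.
set p := pd 0 _ x in B2 *; set q := pd 1 _ x in B1 *; set z := pd 0 _ _ in B1 B2.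
move: p q z B1 B2 => p q z B1 B2.
have -> : p - q = (z - q) - (z - p) by ring.
apply: (le_trans (ler_normB _ _)); rewrite [leRHS]splitr.
by apply: lerD; apply: ltW; [exact: B1|exact: B2].
Qed.
End MixedDerivatives.

(** * Limits along a filter and derivatives within a domain *)

Section Limits.
Context {R : realType} {T : Type} {F : set_system T} {FF : Filter F}.
Implicit Types (f g : T -> R) (a b : R).
Lemma flim_cst a : (fun=> a) @ F --> a.
Proof. exact: cvg_cst. Qed.
Lemma flim_add f g a b : f @ F --> a -> g @ F --> b -> (fun y => f y + g y) @ F --> a + b.
Proof. exact: cvgD. Qed.
Lemma flim_opp f a : f @ F --> a -> (fun y => - f y) @ F --> - a.
Proof. exact: cvgN. Qed.
Lemma flim_mul f g a b : f @ F --> a -> g @ F --> b -> (fun y => f y * g y) @ F --> a * b.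
Proof. exact: cvgM. Qed.
Lemma flim_inv f a : a != 0 -> f @ F --> a -> (fun y => (f y)^-1) @ F --> a^-1.
Proof. exact: cvgV. Qed.
Lemma flim_dist f a : f @ F --> a -> forall e, 0 < e -> \forall y \near F, `|f y - a| < e.
Proof. by move=> /cvgrPdistC_lt. Qed.
Lemma flim_of_dist f a : (forall e, 0 < e -> \forall y \near F, `|f y - a| < e) -> f @ F --> a.
Proof. by move=> H; apply/cvgrPdistC_lt. Qed.
Lemma flim_eq_near f g a : (\forall y \near F, f y = g y) -> f @ F --> a -> g @ F --> a.
Proof. by move=> fg; apply: cvg_trans; exact: near_eq_cvg. Qed.
End Limits.

Section Bridge.
Context {R : realType}.

(** At a point of an open domain every small increment is admissible. *)
Lemma hdw_isd (V : normedModType R) (D : set V) (f : V -> R) (x v : V) l :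
  open D -> D x -> has_deriv_within D f x v l -> is_derive x v f l.
Proof.
move=> oD Dx H.
have nD : \forall h \near (0 : R), D (x + h *: v).
  have c : {for (0 : R), continuous (fun h : R => x + h *: v)}.
    apply: (@cvgD _ _ _ _ _ (cst x) (fun h : R => h *: v)); first exact: cvg_cst.
    exact: scalel_continuous.
  apply: c; apply: open_nbhs_nbhs; split => //; by rewrite scale0r addr0.
have {}H : (fun h : R => h^-1 *: ((f \o shift x) (h *: v) - f x)) @ 0^' --> l.
  have E : (fun h : R => h^-1 *: ((f \o shift x) (h *: v) - f x)) =
           (fun h => h^-1 * (f (x + h *: v) - f x)).
    by apply/funext => h /=; rewrite [h *: v + x]addrC.
  rewrite E; apply: cvg_trans H; apply: cvg_app => A.
  rewrite /within /= => hA.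
  have nD' : \forall h \near (0 : R)^', D (x + h *: v) by exact: nbhs_dnbhs.
  have hA' : \forall h \near (0 : R)^', D (x + h *: v) -> A h := hA.
  have hA'' : \forall h \near (0 : R)^', A h by apply: filterS2 hA' nD' => h; apply.
  exact: hA''.
split; first exact: (cvgP _ H).
exact: (cvg_lim _ H).
Qed.

Lemma hdw_ext (V : normedModType R) (D : set V) (f g : V -> R) (x v : V) l :
  (forall y, D y -> f y = g y) -> D x ->
  has_deriv_within D f x v l -> has_deriv_within D g x v l.
Proof.
move=> fg Dx; apply: cvg_trans; apply: near_eq_cvg.
by near=> h; rewrite fg ?fg //; near: h; rewrite near_withinE; apply: nearW.
Unshelve. all: by end_near. Qed.

Lemma within_ext (T : topologicalType) (D : set T) (f g : T -> R) :
  (forall y, D y -> f y = g y) -> {within D, continuous f} -> {within D, continuous g}.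
Proof.
by move=> fg; apply: subspace_eq_continuous => y; rewrite inE => /fg.
Qed.

Lemma Ck_ext (V : normedModType R) k (D : set V) (f g : V -> R) :
  (forall y, D y -> f y = g y) -> Ck k D f -> Ck k D g.
Proof.
move=> fg; case: k => [|k] /= [cf H]; split; try exact: within_ext fg cf; first by [].
move=> v; have [f' [H1 H2]] := H v; exists f'; split => // x Dx.
by apply: hdw_ext (H1 _ Dx).
Qed.

Lemma Ck_within (V : normedModType R) k (D : set V) (f : V -> R) :
  Ck k D f -> {within D, continuous f}.
Proof. by case: k => [|k] []. Qed.

Lemma Ck_cont (V : normedModType R) k (D : set V) (f : V -> R) x :
  open D -> Ck k D f -> D x -> {for x, continuous f}.
Proof.
move=> oD /Ck_within cf Dx.
by move: cf; rewrite continuous_open_subspace // => /(_ x); apply; rewrite inE.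
Qed.

Lemma Ck_pred (V : normedModType R) k (D : set V) (f : V -> R) :
  Ck k.+1 D f -> Ck k D f.
Proof.
elim: k f => [|k IH] f [c H]; split => // v.
by have [f' [H1 H2]] := H v; exists f'; split => //; exact: IH.
Qed.

Lemma Ck_pd k (D : set 'rV[R]_2) (f : 'rV[R]_2 -> R) i :
  open D -> Ck k.+1 D f ->
  (forall x, D x -> derivable f x (ee i)) /\ Ck k D (pd i f).
Proof.
move=> oD [c H]; have [f' [H1 H2]] := H (ee i).
have E x : D x -> is_derive x (ee i) f (f' x) by move=> Dx; exact: hdw_isd (H1 _ Dx).
split; first by move=> x /E h; exact: (@ex_derive _ _ _ _ _ _ _ h).
by apply: Ck_ext H2 => y /E /isd_pdE ->.
Qed.

Lemma Ck_C1 k (D : set 'rV[R]_2) (f : 'rV[R]_2 -> R) x :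
  open D -> Ck k.+1 D f -> D x -> C1 f x.
Proof.
move=> oD Cf Dx.
have : \forall y \near x, D y by apply: open_nbhs_nbhs.
apply: filterS => y Dy i; have [d c] := Ck_pd i oD Cf; split; first exact: d.
exact: Ck_cont c Dy.
Qed.

Lemma Ck_slice k (V : normedModType R) (J : set R) (D : set V) (F : R * V -> R) t :
  J t -> Ck k (J `*` D) F -> Ck k D (fun x => F (t, x)).
Proof.
move=> Jt; elim: k F => [|k IH] F [c H].
  split => //; apply/subspace_continuousP => x Dx.
  move/subspace_continuousP : c => /(_ (t, x)) c.
  have {}c := c (conj Jt Dx).
  move=> A hA; have : nbhs (t, x) [set z | (J `*` D) z -> A (F z)] := c A hA.
  case=> -[U W] /= [Ut Wx] UW.
  suff : nbhs x [set y | D y -> A (F (t, y))] by [].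
  apply: filterS Wx => y Wy Dy; apply: (UW (t, y)) => //.
  by split => //; exact: nbhs_singleton Ut.
split.
  exact: (Ck_within (IH _ (Ck_pred (conj c H : Ck k.+1 _ F)))).
move=> v; have [f' [H1 H2]] := H (0, v); exists (fun x => f' (t, x)); split; last exact: IH.
move=> x Dx; have := H1 (t, x) (conj Jt Dx).
rewrite /has_deriv_within.
have E h : (t, x) + h *: ((0 : R), v) = (t, x + h *: v).
  have -> : (t, x) + h *: ((0 : R), v) = (t + h * 0, x + h *: v) by [].
  by rewrite mulr0 addr0.
under eq_fun do rewrite E.
have -> : [set h | (J `*` D) ((t, x) + h *: ((0 : R), v))] = [set h | D (x + h *: v)].
  by apply/seteqP; split => h; rewrite /mkset E; [case|split].
by [].
Qed.

End Bridge.

(** * Curvature and Laplacian as functions of the jet of the metric *)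

Lemma cont_gt0 (R : realType) (T : topologicalType) (f : T -> R) (x : T) :
  {for x, continuous f} -> 0 < f x -> \forall y \near x, 0 < f y.
Proof.
move=> cf f0; apply: filterS (cont_dist cf f0) => y.
by rewrite ltr_norml => /andP[]; rewrite ltrBrDr addNr.
Qed.

Section Jets.
Context {R : realType}.

Lemma sum2 (V : nmodType) (F : 'I_2 -> V) : \sum_i F i = F 0 + F 1.
Proof.
rewrite big_ord_recl big_ord1; congr (_ + F _); exact: val_inj.
Qed.

(** Determinant and inverse are given by cofactors on functions of two indices, so
    that identities between the quantities below are identities between rational
    functions of finitely many numbers. *)
Definition det2 (a : 'I_2 -> 'I_2 -> R) := a 0 0 * a 1 1 - a 0 1 * a 1 0.
Definition inv2 (a : 'I_2 -> 'I_2 -> R) (k l : 'I_2) : R :=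
  (if k == 0 then if l == 0 then a 1 1 else - a 0 1
   else if l == 0 then - a 1 0 else a 0 0) / det2 a.
(** The differentials of [det2] and [inv2] at a in the direction b are [ddet2] and
    [dinv2]. *)
Definition ddet2 (a b : 'I_2 -> 'I_2 -> R) :=
  a 0 0 * b 1 1 + a 1 1 * b 0 0 - (a 0 1 * b 1 0 + a 1 0 * b 0 1).
Definition dinv2 (a b : 'I_2 -> 'I_2 -> R) (k l : 'I_2) : R :=
  (if k == 0 then if l == 0 then b 1 1 else - b 0 1
   else if l == 0 then - b 1 0 else b 0 0) / det2 a
  - inv2 a k l * ddet2 a b / det2 a.

Variables (a : 'I_2 -> 'I_2 -> R) (d : 'I_2 -> 'I_2 -> 'I_2 -> R)
  (dd : 'I_2 -> 'I_2 -> 'I_2 -> 'I_2 -> R).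

(** In this section a, d k and dd k l stand for the metric, its first and its second
    derivatives at a point.  The Christoffel symbols, their derivatives, the Ricci
    tensor and the Laplacian become [chr], [dchr], [ricj] and [lapj]. *)
Definition chr (k i j : 'I_2) : R :=
  2^-1 * \sum_l inv2 a k l * (d i l j + d j l i - d l i j).
Definition dchr (m k i j : 'I_2) : R :=
  2^-1 * \sum_l (inv2 a k l * (dd m i l j + dd m j l i - dd m l i j)
    + (d i l j + d j l i - d l i j) * dinv2 a (d m) k l).
Definition ricj (i j : 'I_2) : R :=
  (\sum_k dchr k k i j) - (\sum_k dchr i k k j)
   + (\sum_k \sum_l chr k k l * chr l i j)
   - \sum_k \sum_l chr k i l * chr l k j.
Definition lapj (f1 : 'I_2 -> R) (f2 : 'I_2 -> 'I_2 -> R) : R :=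
  \sum_i \sum_j inv2 a i j * (f2 i j - \sum_k chr k i j * f1 k).
(** Brioschi's formula for the Gauss curvature. *)
Definition gaussj : R :=
  let D := det2 a in
  let E := a 0 0 in let F := a 0 1 in let H := a 1 1 in
  let p := - (dd 1 1 0 0) / 2 + dd 0 1 0 1 - dd 0 0 1 1 / 2 in
  let E0 := d 0 0 0 / 2 in let E1 := d 1 0 0 / 2 in
  let H0 := d 0 1 1 / 2 in let H1 := d 1 1 1 / 2 in
  let P := d 0 0 1 - E1 in let Q := d 1 0 1 - H0 in
  (p * D - E0 * (Q * H - F * H1) + P * (Q * F - E * H1)
   - (H0 * (E1 * F - E * H0) - E1 * (E1 * H - F * H0))) / D ^+ 2.

Definition sym_jet := [/\ a 1 0 = a 0 1, forall k, d k 1 0 = d k 0 1,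
  forall k l, dd k l 1 0 = dd k l 0 1 & forall k l i j, dd k l i j = dd l k i j].

(** On a surface the Ricci tensor is the Gauss curvature times the metric: once the
    sums are expanded, each component is an identity between rational functions of
    the jet. *)
Lemma ricj_gauss i j : sym_jet -> det2 a != 0 -> ricj i j = gaussj * a i j.
Proof.
case=> sa sd sdd sc; rewrite /ricj /gaussj /dchr /chr !sum2 /= /dinv2 /inv2 /= /ddet2 /det2.
have e10 : (1 : 'I_2) == 0 = false by [].
have s10 : forall i j, dd 1 0 i j = dd 0 1 i j by move=> *; exact: sc.
have [->|->] := ord2P i; have [->|->] := ord2P j; rewrite ?eqxx ?e10 !sa !sd !sdd !s10;
  move: (a 0 0) (a 0 1) (a 1 1) (d 0 0 0) (d 0 0 1) (d 0 1 1) (d 1 0 0) (d 1 0 1) (d 1 1 1)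
   (dd 0 0 0 0) (dd 0 0 0 1) (dd 0 0 1 1) (dd 0 1 0 0) (dd 0 1 0 1) (dd 0 1 1 1)
   (dd 1 1 0 0) (dd 1 1 0 1) (dd 1 1 1 1);
  move=> E F H E0 F0 H0 E1 F1 H1 E00 F00 H00 E01 F01 H01 E11 F11 H11 D0.
all: by field.
Qed.

End Jets.

Section ConformalJets.
Context {R : realType}.
Variables (a : 'I_2 -> 'I_2 -> R) (d : 'I_2 -> 'I_2 -> 'I_2 -> R)
  (dd : 'I_2 -> 'I_2 -> 'I_2 -> 'I_2 -> R).
Variables (rho : R) (w1 : 'I_2 -> R) (w2 : 'I_2 -> 'I_2 -> R).

(** The 2-jet of e^w times the metric, where rho, w1 and w2 are the values of e^w and
    of the first and second derivatives of w. *)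
Definition cfa i j := rho * a i j.
Definition cfd k i j := rho * (w1 k * a i j + d k i j).
Definition cfdd k l i j := rho * ((w2 k l + w1 k * w1 l) * a i j
   + w1 l * d k i j + w1 k * d l i j + dd k l i j).

(** The conformal change of curvature e^w K' = K - Delta w / 2. *)
Lemma gaussj_conformal : sym_jet a d dd -> det2 a != 0 -> rho != 0 -> w2 0 1 = w2 1 0 ->
  rho * gaussj cfa cfd cfdd = gaussj a d dd - lapj a d w1 w2 / 2.
Proof.
case=> sa sd sdd sc; rewrite /gaussj /lapj /chr !sum2 /= /inv2 /= /cfa /cfd /cfdd /det2.
have e10 : (1 : 'I_2) == 0 = false by [].
rewrite ?eqxx ?e10 !sa !sd.
move: (a 0 0) (a 0 1) (a 1 1) (d 0 0 0) (d 0 0 1) (d 0 1 1) (d 1 0 0) (d 1 0 1) (d 1 1 1)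
   (dd 0 0 1 1) (dd 0 1 0 1) (dd 1 1 0 0) (w1 0) (w1 1) (w2 0 0) (w2 0 1) (w2 1 0) (w2 1 1) rho.
move=> E F H E0 F0 H0 E1 F1 H1 H00 F01 E11 x0 x1 x00 x01 x10 x11 r D0 r0 <-.
have D1 : r * E * (r * H) - r * F * (r * F) != 0.
  have -> : r * E * (r * H) - r * F * (r * F) = r ^+ 2 * (E * H - F * F) by ring.
  by rewrite mulf_neq0 // expf_neq0.
by field; rewrite ?D0 ?D1.
Qed.

(** The first-order terms that the conformal factor adds to the Christoffel symbols
    have trace zero in dimension 2. *)
Lemma lapj_conformal (f1 : 'I_2 -> R) (f2 : 'I_2 -> 'I_2 -> R) :
  sym_jet a d dd -> det2 a != 0 -> rho != 0 ->
  rho * lapj cfa cfd f1 f2 = lapj a d f1 f2.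
Proof.
case=> sa sd _ _; rewrite /lapj /chr !sum2 /= /inv2 /= /cfa /cfd /det2.
have e10 : (1 : 'I_2) == 0 = false by [].
rewrite ?eqxx ?e10 !sa !sd.
move: (a 0 0) (a 0 1) (a 1 1) (d 0 0 0) (d 0 0 1) (d 0 1 1) (d 1 0 0) (d 1 0 1) (d 1 1 1)
   (w1 0) (w1 1) (f1 0) (f1 1) (f2 0 0) (f2 0 1) (f2 1 0) (f2 1 1) rho.
move=> E F H E0 F0 H0 E1 F1 H1 x0 x1 y0 y1 y00 y01 y10 y11 r D0 r0.
have D1 : r * E * (r * H) - r * F * (r * F) != 0.
  have -> : r * E * (r * H) - r * F * (r * F) = r ^+ 2 * (E * H - F * F) by ring.
  by rewrite mulf_neq0 // expf_neq0.
by field; rewrite ?D0 ?D1.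
Qed.

End ConformalJets.

Section MetricGerm.
Context {R : realType}.
Local Notation V := 'rV[R]_2.

Lemma det2E (A : 'M[R]_2) : \det A = det2 A.
Proof.
rewrite (expand_det_row _ ord0) sum2 /cofactor !det_mx11 !mxE /det2 /=.
have -> : lift ord0 0 = 1 :> 'I_2 by exact: val_inj.
have -> : lift 1 0 = 0 :> 'I_2 by exact: val_inj.
by rewrite /bump /= addn0 expr0 mul1r expr1 mulN1r mulrN.
Qed.

Lemma invmx2 (A : 'M[R]_2) k l : det2 A != 0 -> invmx A k l = inv2 A k l.
Proof.
move=> D0; have uA : A \in unitmx by rewrite unitmxE unitfE det2E.
have E : (\matrix_(i, j) inv2 A i j) *m A = 1%:M.
  apply/matrixP => i j; rewrite !mxE sum2 !mxE /inv2.
  move: D0; rewrite /det2.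
  have e10 : (1 : 'I_2) == 0 = false by [].
  have e01 : (0 : 'I_2) == 1 = false by [].
  have [->|->] := ord2P i; have [->|->] := ord2P j; rewrite ?eqxx ?e10 ?e01 /=;
  move: (A 0 0) (A 0 1) (A 1 0) (A 1 1) => p q r s D0; by field.
have -> : invmx A = \matrix_(i, j) inv2 A i j by rewrite -[RHS](mulmxK uA) E mul1mx.
by rewrite mxE.
Qed.

Variables (G : V -> 'M[R]_2) (x : V).

(** A metric of class C2 near x.  Positivity enters through the determinant only,
    since it is what the formulas divide by. *)
Record metric_germ : Prop := MetricGerm {
  mg_sym : \forall y \near x, forall i j, G y i j = G y j i;
  mg_det : 0 < det2 (G x);
  mg_C1 : forall i j, C1 (fun y => G y i j) x;
  mg_C2 : forall i j k, C1 (pd k (fun y => G y i j)) x }.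

Hypothesis HG : metric_germ.

Definition jet1 (k i j : 'I_2) : R := pd k (fun y => G y i j) x.
Definition jet2 (k l i j : 'I_2) : R := pd k (pd l (fun y => G y i j)) x.

(** The second derivatives commute by [schwarz]. *)
Lemma jet_sym : sym_jet (G x) jet1 jet2.
Proof.
have E : \forall y \near x, G y 1 0 = G y 0 1.
  by apply: filterS (mg_sym HG) => y ->.
split.
- exact: (nbhs_singleton E).
- by move=> k; apply: pd_eq_near.
- by move=> k l; apply: pd_eq_near; exact: pd_near_eq.
- by move=> k l i j; apply: schwarz => [|m]; [exact: mg_C1|exact: mg_C2].
Qed.

Lemma C1_det2 : C1 (fun y => det2 (G y)) x.
Proof.
by apply: C1_add; [|apply: C1_opp]; apply: C1_mul; exact: (mg_C1 HG).
Qed.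

Lemma det2_near : \forall y \near x, 0 < det2 (G y).
Proof. exact: cont_gt0 (C1_cont C1_det2) (mg_det HG). Qed.

Lemma invmx_near : \forall y \near x, forall k l, invmx (G y) k l = inv2 (G y) k l.
Proof. by apply: filterS det2_near => y D0 k l; apply: invmx2; rewrite gt_eqF. Qed.

Lemma isd_inv2 m k l :
  is_derive x (ee m) (fun y => inv2 (G y) k l) (dinv2 (G x) (jet1 m) k l).
Proof.
have D0 : det2 (G x) != 0 by rewrite gt_eqF // (mg_det HG).
have dD : is_derive x (ee m) (fun y => det2 (G y)) (ddet2 (G x) (jet1 m)).
  apply: isd_add; first by apply: isd_mul; apply: isd_pd; exact: (mg_C1 HG).
  by apply: isd_opp; apply: isd_mul; apply: isd_pd; exact: (mg_C1 HG).
have dV := isd_inv D0 dD.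
have H : forall (n : V -> R) (dn : R), is_derive x (ee m) n dn ->
    is_derive x (ee m) (fun y => n y / det2 (G y))
     (dn / det2 (G x) - (n x / det2 (G x)) * ddet2 (G x) (jet1 m) / det2 (G x)).
  move=> n dn hn; apply: isd_eq (isd_mul hn dV) _.
  by move: (det2 _) (ddet2 _ _) (n x) D0 => p q r p0; field.
rewrite /dinv2; rewrite /inv2; case: (k == 0); case: (l == 0); cbn iota.
- by apply: H; apply: isd_pd; exact: (mg_C1 HG).
- by apply: (H (fun y => - G y 0 1)); apply: isd_opp; apply: isd_pd; exact: (mg_C1 HG).
- by apply: (H (fun y => - G y 1 0)); apply: isd_opp; apply: isd_pd; exact: (mg_C1 HG).
- by apply: H; apply: isd_pd; exact: (mg_C1 HG).
Qed.

Lemma christoffelE k i j : christoffel G k i j x = chr (G x) jet1 k i j.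
Proof.
rewrite /christoffel /chr; congr (_ * _); apply: eq_bigr => l _.
by rewrite (nbhs_singleton invmx_near).
Qed.

Lemma pd_christoffel m k i j : pd m (christoffel G k i j) x = dchr (G x) jet1 jet2 m k i j.
Proof.
pose c := fun y : V => 2^-1 * \sum_l inv2 (G y) k l *
    (pd i (fun y => G y l j) y + pd j (fun y => G y l i) y - pd l (fun y => G y i j) y).
have E : \forall y \near x, christoffel G k i j y = c y.
  apply: filterS invmx_near => y H; rewrite /christoffel /c; congr (_ * _).
  by apply: eq_bigr => l _; rewrite H.
rewrite (pd_eq_near _ E); apply: isd_pdE; rewrite /c /dchr.
have T l : is_derive x (ee m) (fun y => inv2 (G y) k l *
   (pd i (fun y => G y l j) y + pd j (fun y => G y l i) y - pd l (fun y => G y i j) y))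
   (inv2 (G x) k l * (jet2 m i l j + jet2 m j l i - jet2 m l i j)
    + (jet1 i l j + jet1 j l i - jet1 l i j) * dinv2 (G x) (jet1 m) k l).
  apply: isd_mul; first exact: isd_inv2.
  apply: isd_add; last by apply: isd_opp; apply: isd_pd; exact: (mg_C2 HG).
  by apply: isd_add; apply: isd_pd; exact: (mg_C2 HG).
have T2 := isd_mul (is_derive_cst (2^-1 : R) x (ee m)) (isd_add (T 0) (T 1)).
suff -> : (fun y => 2^-1 * \sum_l inv2 (G y) k l * (pd i (fun y => G y l j) y +
    pd j (fun y => G y l i) y - pd l (fun y => G y i j) y)) =
  (fun y => cst 2^-1 y * (inv2 (G y) k 0 * (pd i (fun y => G y 0 j) y +
    pd j (fun y => G y 0 i) y - pd 0 (fun y => G y i j) y) +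
   inv2 (G y) k 1 * (pd i (fun y => G y 1 j) y +
    pd j (fun y => G y 1 i) y - pd 1 (fun y => G y i j) y))).
  by apply: isd_eq T2 _; rewrite mulr0 addr0 sum2.
by apply/funext => y; rewrite sum2.
Qed.

Lemma ricci_jet i j : ricci G x i j = ricj (G x) jet1 jet2 i j.
Proof.
rewrite /ricci mxE /ricj.
have cong4 (p p' q q' r r' t t' : R) : p = p' -> q = q' -> r = r' -> t = t' ->
  p - q + r - t = p' - q' + r' - t' by move=> -> -> -> ->.
apply: cong4; apply: eq_bigr => k _.
- exact: pd_christoffel.
- exact: pd_christoffel.
- by apply: eq_bigr => l _; rewrite !christoffelE.
- by apply: eq_bigr => l _; rewrite !christoffelE.
Qed.

Definition gauss : R := gaussj (G x) jet1 jet2.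

Lemma ricci_gauss : ricci G x = gauss *: G x.
Proof.
have D0 : det2 (G x) != 0 by rewrite gt_eqF // (mg_det HG).
apply/matrixP => i j; apply: (etrans (ricci_jet i j)).
apply: (etrans (ricj_gauss i j jet_sym D0)).
by rewrite mxE.
Qed.

Lemma gtrace_metric (k : R) : gtrace G (k *: G x) x = 2 * k.
Proof.
rewrite /gtrace !sum2 !(nbhs_singleton invmx_near) !mxE /inv2 /=.
have : det2 (G x) != 0 by rewrite gt_eqF // (mg_det HG).
rewrite (nbhs_singleton (mg_sym HG) 1 0) /det2 ?(nbhs_singleton (mg_sym HG) 1 0).
move: (G x 0 0) (G x 0 1) (G x 1 1) => p q r D0; by field.
Qed.

Lemma laplacianE (f : V -> R) :
  laplacian G f x = lapj (G x) jet1 (fun i => pd i f x) (fun i j => pd i (pd j f) x).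
Proof.
rewrite /laplacian /gtrace /lapj; apply: eq_bigr => i _; apply: eq_bigr => j _.
rewrite (nbhs_singleton invmx_near) mxE; congr (_ * (_ - _)).
by apply: eq_bigr => k _; rewrite christoffelE.
Qed.

End MetricGerm.

(** * Conformal metrics, and the Laplacian as a divergence *)

Section ConformalGerm.
Context {R : realType}.
Local Notation V := 'rV[R]_2.
Variables (G1 G2 : V -> 'M[R]_2) (W : V -> R) (x : V).
Hypotheses (HG1 : metric_germ G1 x) (HG2 : metric_germ G2 x).
Hypotheses (CW : C1 W x) (CCW : forall k, C1 (pd k W) x).
Hypothesis HW : \forall y \near x, forall i j, G2 y i j = expR (W y) * G1 y i j.

Let w1 i := pd i W x.
Let w2 i j := pd i (pd j W) x.

Lemma isd_expR y k : C1 W y ->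
  is_derive y (ee k) (fun z => expR (W z)) (expR (W y) * pd k W y).
Proof. by move=> CWy; exact: isd_comp1 (isd_pd k CWy) (is_derive_expR _). Qed.

Lemma conf_jet0 i j : G2 x i j = cfa (G1 x) (expR (W x)) i j.
Proof. exact: (nbhs_singleton HW i j). Qed.

(** The identity is needed in a neighbourhood in order to be differentiated again. *)
Lemma conf_jet1_near k i j : \forall y \near x, pd k (fun y => G2 y i j) y =
  expR (W y) * (pd k W y * G1 y i j + pd k (fun y => G1 y i j) y).
Proof.
have H : \forall y \near x, G2 y i j = expR (W y) * G1 y i j.
  by apply: filterS HW => y; exact.
apply: filterS (filterI (pd_near_eq k H) (filterI (C1_near CW) (C1_near (mg_C1 HG1 i j)))).
move=> y [-> [CWy Cy]]; apply: isd_pdE.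
apply: isd_eq (isd_mul (isd_expR k CWy) (isd_pd k Cy)) _.
by move: (expR _) (pd k W y) (G1 y i j) (pd k _ y) => *; ring.
Qed.

Lemma conf_jet1 k i j : jet1 G2 x k i j = cfd (G1 x) (jet1 G1 x) (expR (W x)) w1 k i j.
Proof. exact: (nbhs_singleton (conf_jet1_near k i j)). Qed.

Lemma conf_jet2 k l i j : jet2 G2 x k l i j =
  cfdd (G1 x) (jet1 G1 x) (jet2 G1 x) (expR (W x)) w1 w2 k l i j.
Proof.
rewrite /jet2 (pd_eq_near k (conf_jet1_near l i j)).
apply: isd_pdE; apply: isd_eq.
  apply: isd_mul; first exact: isd_expR.
  apply: isd_add; first by apply: isd_mul; apply: isd_pd; [exact: CCW|exact: (mg_C1 HG1)].
  apply: isd_pd; exact: (mg_C2 HG1).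
rewrite /cfdd /w2 /w1 /jet1 /jet2.
move: (expR _) (pd k (pd l W) x) (pd k W x) (pd l W x) (G1 x i j)
  (pd k (pd l _) x) (pd k _ x) (pd l _ x) => *; ring.
Qed.

Lemma gauss_conformal :
  expR (W x) * gauss G2 x = gauss G1 x - laplacian G1 W x / 2.
Proof.
rewrite laplacianE // /gauss.
have -> : (G2 x : 'I_2 -> 'I_2 -> R) = cfa (G1 x) (expR (W x)).
  by apply/funext => i; apply/funext => j; exact: conf_jet0.
have -> : jet1 G2 x = cfd (G1 x) (jet1 G1 x) (expR (W x)) w1.
  by do 3 apply/funext => ?; exact: conf_jet1.
have -> : jet2 G2 x = cfdd (G1 x) (jet1 G1 x) (jet2 G1 x) (expR (W x)) w1 w2.
  by do 4 apply/funext => ?; exact: conf_jet2.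
apply: (@gaussj_conformal _ (G1 x) (jet1 G1 x) (jet2 G1 x) (expR (W x)) w1 w2).
- exact: jet_sym.
- by rewrite gt_eqF // (mg_det HG1).
- by rewrite gt_eqF // expR_gt0.
- exact: schwarz.
Qed.

Lemma laplacian_conformal (f : V -> R) :
  expR (W x) * laplacian G2 f x = laplacian G1 f x.
Proof.
rewrite !laplacianE //.
have -> : (G2 x : 'I_2 -> 'I_2 -> R) = cfa (G1 x) (expR (W x)).
  by apply/funext => i; apply/funext => j; exact: conf_jet0.
have -> : jet1 G2 x = cfd (G1 x) (jet1 G1 x) (expR (W x)) w1.
  by do 3 apply/funext => ?; exact: conf_jet1.
apply: (@lapj_conformal _ (G1 x) (jet1 G1 x) (jet2 G1 x) (expR (W x)) w1).
- exact: jet_sym.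
- by rewrite gt_eqF // (mg_det HG1).
- by rewrite gt_eqF // expR_gt0.
Qed.
End ConformalGerm.

(** The left hand side is what the product rule gives for the divergence of
    sqrt(det g) u grad h, divided by sqrt(det g); here p is the gradient of u, while
    q and qq are the first and second derivatives of h.  The derivatives of
    sqrt(det g) and of the inverse metric add up to the Christoffel symbols of the
    Laplacian. *)
Lemma flux_jet (R : realType) (a : 'I_2 -> 'I_2 -> R) (d : 'I_2 -> 'I_2 -> 'I_2 -> R)
  (u : R) (p q : 'I_2 -> R) (qq : 'I_2 -> 'I_2 -> R) :
  a 1 0 = a 0 1 -> (forall k, d k 1 0 = d k 0 1) -> det2 a != 0 ->
  u * (\sum_j (inv2 a 0 j * qq 0 j + q j * dinv2 a (d 0) 0 j)) + (\sum_j inv2 a 0 j * q j) * p 0 +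
  u * (\sum_j inv2 a 0 j * q j) * (ddet2 a (d 0) / (2 * det2 a)) +
  (u * (\sum_j (inv2 a 1 j * qq 1 j + q j * dinv2 a (d 1) 1 j)) + (\sum_j inv2 a 1 j * q j) * p 1 +
  u * (\sum_j inv2 a 1 j * q j) * (ddet2 a (d 1) / (2 * det2 a))) =
  u * lapj a d q qq + \sum_i \sum_j inv2 a i j * (p i * q j).
Proof.
move=> sa sd; rewrite /lapj /chr !sum2 /dinv2 /ddet2; rewrite /inv2.
have e10 : (1 : 'I_2) == 0 = false by [].
rewrite ?eqxx ?e10; cbn iota; rewrite /det2 !sa !sd.
move: (a 0 0) (a 0 1) (a 1 1) (d 0 0 0) (d 0 0 1) (d 0 1 1) (d 1 0 0) (d 1 0 1) (d 1 1 1)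
  (p 0) (p 1) (q 0) (q 1) (qq 0 0) (qq 0 1) (qq 1 0) (qq 1 1).
by move=> E F H E0 F0 H0 E1 F1 H1 u0 u1 h0 h1 h00 h01 h10 h11 D0; field.
Qed.

Section Divergence.
Context {R : realType}.
Local Notation V := 'rV[R]_2.
Variables (G : V -> 'M[R]_2) (f h : V -> R).

(** The field f grad h is multiplied by the area density, so that its divergence in
    coordinates is the Riemannian one times the density. *)
Definition flux (i : 'I_2) (y : V) : R :=
  Num.sqrt (det2 (G y)) * (f y * \sum_j inv2 (G y) i j * pd j h y).

(** The pairing of the gradients of f and h. *)
Definition ginner (y : V) : R := \sum_i \sum_j inv2 (G y) i j * (pd i f y * pd j h y).

Variable x : V.
Hypotheses (HG : metric_germ G x) (Cf : C1 f x) (Ch : C1 h x) (CCh : forall k, C1 (pd k h) x).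

Lemma C1_inv2 k l : C1 (fun y => inv2 (G y) k l) x.
Proof.
have D0 : det2 (G x) != 0 by rewrite gt_eqF // (mg_det HG).
have CD := C1_inv D0 (C1_det2 HG).
have H n : C1 n x -> C1 (fun y => n y / det2 (G y)) x by move=> hn; exact: (C1_mul hn CD).
rewrite /inv2; case: (k == 0); case: (l == 0); cbn iota.
- exact: (H _ (mg_C1 HG 1 1)).
- exact: (H _ (C1_opp (mg_C1 HG 0 1))).
- exact: (H _ (C1_opp (mg_C1 HG 1 0))).
- exact: (H _ (mg_C1 HG 0 0)).
Qed.

Lemma is_derive_sqrt_det i : is_derive x (ee i) (fun y => Num.sqrt (det2 (G y)))
  (Num.sqrt (det2 (G x)) * (ddet2 (G x) (jet1 G x i) / (2 * det2 (G x)))).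
Proof.
have D0 := mg_det HG.
have dD : is_derive x (ee i) (fun y => det2 (G y)) (ddet2 (G x) (jet1 G x i)).
  apply: isd_add; first by apply: isd_mul; apply: isd_pd; exact: (mg_C1 HG).
  by apply: isd_opp; apply: isd_mul; apply: isd_pd; exact: (mg_C1 HG).
apply: isd_eq (isd_comp1 dD (is_derive1_sqrt D0)) _.
have : Num.sqrt (det2 (G x)) ^+ 2 = det2 (G x) by rewrite sqr_sqrtr // ltW.
have : Num.sqrt (det2 (G x)) != 0 by rewrite gt_eqF // sqrtr_gt0.
move: (Num.sqrt _) (ddet2 _ _) => q p q0 <-; by field.
Qed.

Lemma C1_sqrt_det : C1 (fun y => Num.sqrt (det2 (G y))) x.
Proof.
have D0 := mg_det HG.
apply: (@C1_comp1 _ _ Num.sqrt (fun y => (2 * Num.sqrt y)^-1)); first exact: C1_det2.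
have : \forall y \near det2 (G x), 0 < y.
  by apply: open_nbhs_nbhs; split => //; exact: open_gt.
apply: filterS => y y0; split; first exact: is_derive1_sqrt.
apply: cont_inv; first by rewrite mulf_neq0 // gt_eqF // sqrtr_gt0.
by apply: cont_mul; [exact: cont_cst|exact: sqrt_continuous].
Qed.

Lemma C1_flux i : C1 (flux i) x.
Proof.
apply: (C1_mul C1_sqrt_det); apply: (C1_mul Cf).
by apply: C1_sum => j; exact: (C1_mul (C1_inv2 i j) (CCh j)).
Qed.

Lemma divergence_flux : \sum_i pd i (flux i) x =
  Num.sqrt (det2 (G x)) * (f x * laplacian G h x + ginner x).
Proof.
have T i : pd i (flux i) x = Num.sqrt (det2 (G x)) *
   (f x * (\sum_j (inv2 (G x) i j * pd i (pd j h) x + pd j h x * dinv2 (G x) (jet1 G x i) i j))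
     + (\sum_j inv2 (G x) i j * pd j h x) * pd i f x
     + (f x * \sum_j inv2 (G x) i j * pd j h x) * (ddet2 (G x) (jet1 G x i) / (2 * det2 (G x)))).
  apply: isd_pdE; rewrite /flux.
  have S : is_derive x (ee i) (fun y => \sum_j inv2 (G y) i j * pd j h y)
    (\sum_j (inv2 (G x) i j * pd i (pd j h) x + pd j h x * dinv2 (G x) (jet1 G x i) i j)).
    have -> : (fun y => \sum_j inv2 (G y) i j * pd j h y) =
       (fun y => inv2 (G y) i 0 * pd 0 h y + inv2 (G y) i 1 * pd 1 h y).
      by apply/funext => y; rewrite sum2.
    rewrite sum2; apply: isd_add; apply: isd_mul; try exact: isd_inv2; apply: isd_pd; exact: CCh.
  apply: isd_eq (isd_mul (is_derive_sqrt_det i) (isd_mul (isd_pd i Cf) S)) _.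
  move: (\sum_j _) (\sum_j _) (Num.sqrt _) (f x) (pd i f x) (_ / _) => *; ring.
rewrite sum2 (T 0) (T 1) (laplacianE HG) /ginner /lapj -mulrDr; congr (_ * _).
have [sa sd _ _] := jet_sym HG.
have D0 : det2 (G x) != 0 by rewrite gt_eqF // (mg_det HG).
exact: (flux_jet (f x) (fun i => pd i f x) (fun i => pd i h x) (fun i j => pd i (pd j h) x) sa sd D0).
Qed.
End Divergence.

(** * Integration over a box of the plane *)

Section PlaneMeasure.
Context {R : realType}.
Local Notation mR := (measurableTypeR R).
Local Notation leb := (@lebesgue_measure R).

Lemma archi_inv (e : R) : 0 < e -> exists n : nat, n.+1%:R^-1 < e.
Proof.
move=> e0; have := truncnS_gt (e^-1); set n := Num.truncn _ => h.
exists n; rewrite invf_plt ?posrE //; exact: h.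
Qed.

Lemma rat_approx (x e : R) : 0 < e -> exists q : rat, `|x - ratr q| < e.
Proof.
move=> e0; have /rat_in_itvoo[q] : x - e < x + e by rewrite ltrBlDr -addrA ltrDl addr_gt0.
rewrite in_itv /= => /andP[h1 h2]; exists q; rewrite ltr_norml; apply/andP; split.
  by rewrite ltrBrDr addrC ltrBlDr.
by rewrite ltrBlDr addrC -ltrBlDr.
Qed.

(** An open set of the plane is a countable union of squares with rational centre
    and radius 1/n, which are products of intervals. *)
Lemma open_plane_measurable (U : set (R * R)) :
  open U -> measurable (U : set (mR * mR)).
Proof.
move=> oU.
pose B (i : rat * rat * nat) : set (mR * mR) :=
  [set x : mR | `|x - ratr i.1.1| < i.2.+1%:R^-1 :> R] `*`
  [set x : mR | `|x - ratr i.1.2| < i.2.+1%:R^-1 :> R].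
have mB i : measurable (B i).
  have mI (q : R) (e : R) : measurable [set x : mR | `|x - q| < e :> R].
    have -> : [set x : mR | `|x - q| < e :> R] = [set` `]q - e, q + e[].
      by apply/seteqP; split => x /=; rewrite in_itv /= ltr_distl.
    exact: measurable_itv.
  by apply: measurableX; exact: mI.
have -> : U = \bigcup_i (if `[< B i `<=` U >] then B i else set0).
  apply/seteqP; split => [z Uz|z [i _]]; last first.
    by case: ifPn => // /asboolP BU; exact: BU.
  have : nbhs z U by move: oU; rewrite openE => /(_ _ Uz).
  case: z Uz => z1 z2 Uz [[U1 U2] /= [/nbhs_ballP[e1 /= e10 h1] /nbhs_ballP[e2 /= e20 h2]] hU].
  (* the half leaves room for the triangle inequality through the rational centre *)
  have [n hn] : exists n : nat, n.+1%:R^-1 < Num.min e1 e2 / 2.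
    by apply: archi_inv; rewrite divr_gt0 // lt_min e10.
  have n0 : (0 : R) < n.+1%:R^-1 by rewrite invr_gt0.
  have [q1 hq1] := rat_approx z1 n0.
  have [q2 hq2] := rat_approx z2 n0.
  have Bz : B (q1, q2, n) (z1, z2) by split.
  exists (q1, q2, n) => //; case: asboolP => // nBU; case: nBU => -[w1 w2] [/= hw1 hw2].
  have key (z w q e : R) : `|z - q| < n.+1%:R^-1 -> `|w - q| < n.+1%:R^-1 ->
      Num.min e1 e2 <= e -> ball z e w.
    move=> hz hw he; rewrite /ball /=.
    have -> : z - w = (z - q) - (w - q) by ring.
    apply: (le_lt_trans (ler_normB _ _)); apply: (lt_le_trans _ he).
    by rewrite [ltRHS]splitr; apply: ltrD; apply: lt_trans hn.
  apply: (hU (w1, w2)); split => /=.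
    by apply: h1; apply: key hq1 hw1 _; rewrite ge_min lexx.
  by apply: h2; apply: key hq2 hw2 _; rewrite ge_min lexx orbT.
apply: countable_bigcupT_measurable => // i.
by case: ifPn.
Qed.

Definition box (a b : 'I_2 -> R) : set (R * R) := `[a 0, b 0] `*` `[a 1, b 1].

Lemma box_measurable a b : measurable (box a b : set (mR * mR)).
Proof. by apply: measurableX; exact: measurable_itv. Qed.

Lemma box_compact a b : compact (box a b).
Proof. by apply: compact_setX; exact: segment_compact. Qed.

Lemma box_finite a b : ((leb \x leb) (box a b : set (mR * mR)) < +oo)%E.
Proof.
have hf (c d : R) : (leb (`[c, d] : set mR) < +oo)%E.
  by rewrite lebesgue_measure_itv; case: ifP => _; rewrite /= -?EFinB ltry.
rewrite product_measure1E; try exact: measurable_itv.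
apply: lte_mul_pinfty; [exact: measure_ge0| |exact: hf].
by rewrite ge0_fin_numE; [exact: hf|exact: measure_ge0].
Qed.

Lemma within_plane_measurable (D : set (R * R)) (f : R * R -> R) :
  measurable (D : set (mR * mR)) -> {within D, continuous f} ->
  measurable_fun (D : set (mR * mR)) (f : mR * mR -> mR).
Proof.
move=> mD /continuousP cf; apply: (measurability _ (measurable_realfun.RGenOpens.measurableE R)).
move=> _ [_ [a [b ->] <-]].
have /open_subspaceP [V oV VD] : open (from_subspace D f @^-1` `]a, b[).
  by apply: cf; exact: interval_open.
by rewrite setIC -VD; apply: measurableI => //; exact: open_plane_measurable.
Qed.

Lemma within_box_bounded a b (f : R * R -> R) : {within box a b, continuous f} ->
  exists2 C : R, 0 <= C & forall z, box a b z -> `|f z| <= C.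
Proof.
move=> cf; have /compact_bounded[N [_ hN]] := continuous_compact cf (@box_compact a b).
exists (`|N| + 1); first by rewrite addr_ge0.
move=> z hz; apply: (hN (`|N| + 1)); last by exists z.
by rewrite ltr_pwDr // ler_norm.
Qed.

Lemma within_box_integrable a b (f : R * R -> R) : {within box a b, continuous f} ->
  (leb \x leb)%E.-integrable (box a b : set (mR * mR)) (EFin \o f).
Proof.
move=> cf; apply: measurable_bounded_integrable.
- exact: box_measurable.
- exact: box_finite.
- by apply: within_plane_measurable => //; exact: box_measurable.
- have [C C0 hC] := within_box_bounded cf.
  exists C; split; rewrite ?num_real // => y Cy z hz.
  exact: le_trans (hC z hz) (ltW Cy).
Qed.

Local Notation V := 'rV[R]_2.

Lemma cont_line (p v : V) (s : R) : {for s, continuous (fun s : R => p + s *: v)}.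
Proof.
apply: (@cvgD _ _ _ _ _ (cst p) (fun h : R => h *: v)); first exact: cvg_cst.
exact: scalel_continuous.
Qed.

Lemma FTC_line (X : V -> R) (p : V) i (a b : R) : a < b ->
  (forall s, s \in `[a, b] -> C1 X (p + s *: ee i)) ->
  (\int[leb]_(s in `[a, b]) (pd i X (p + s *: ee i))%:E =
    (X (p + b *: ee i))%:E - (X (p + a *: ee i))%:E)%E.
Proof.
move=> ab CX.
pose F s := X (p + s *: ee i).
have dF s : s \in `[a, b] -> is_derive s (1 : R) F (pd i X (p + s *: ee i)).
  by move=> hs; exact: isd_line_pd (CX s hs).
have cF s : s \in `[a, b] -> {for s, continuous F}.
  move=> hs; apply/differentiable_continuous/derivable1_diffP.
  exact: (@ex_derive _ _ _ _ _ _ _ (dF s hs)).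
have ain : a \in `[a, b] by rewrite in_itv /= lexx ltW.
have bin : b \in `[a, b] by rewrite in_itv /= lexx ltW.
have sub s : s \in `]a, b[ -> s \in `[a, b].
  by rewrite !in_itv /= => /andP[/ltW -> /ltW ->].
apply: (@continuous_FTC2 _ (fun s => pd i X (p + s *: ee i)) F a b ab).
- apply: continuous_in_subspaceT => s; rewrite inE /= => hs.
  apply: (@continuous_comp _ _ _ (fun s : R => p + s *: ee i) (pd i X)); first exact: cont_line.
  exact: (C1_pd_cont i (CX s hs)).
- split.
  + by move=> s /sub hs; exact: (@ex_derive _ _ _ _ _ _ _ (dF s hs)).
  + by apply: cvg_at_right_filter; exact: cF.
  + by apply: cvg_at_left_filter; exact: cF.
- by move=> s /sub hs; rewrite derive1E; exact: (@derive_val _ _ _ _ _ _ _ (dF s hs)).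
Qed.

Lemma plane_point_coord (z : R * R) i : plane_point z 0 i = if i == 0 then z.1 else z.2.
Proof. by rewrite mxE. Qed.

Lemma plane_point_line0 (x y : R) : plane_point (x, y) = plane_point (0, y) + x *: ee 0.
Proof.
apply/rowP => j; rewrite plane_point_coord [RHS]mxE plane_point_coord [(x *: ee 0) 0 j]mxE ee_coord.
by have [->|->] := ord2P j; rewrite /= ?mulr1 ?mulr0 ?add0r ?addr0.
Qed.

Lemma plane_point_line1 (x y : R) : plane_point (x, y) = plane_point (x, 0) + y *: ee 1.
Proof.
apply/rowP => j; rewrite plane_point_coord [RHS]mxE plane_point_coord [(y *: ee 1) 0 j]mxE ee_coord.
by have [->|->] := ord2P j; rewrite /= ?mulr1 ?mulr0 ?add0r ?addr0.
Qed.

Lemma plane_point_cont : continuous (plane_point : R * R -> V).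
Proof.
move=> z; apply: cont_rV => k.
have -> : (fun y : R * R => plane_point y 0 k) = (fun z => if k == 0 then z.1 else z.2).
  by apply/funext => y; exact: plane_point_coord.
by case: (k == 0); case: z => z1 z2; [exact: cvg_fst|exact: cvg_snd].
Qed.

Variables (a b : 'I_2 -> R).
Hypothesis ab : forall i, a i < b i.

Lemma box_coord z i : box a b z -> plane_point z 0 i \in `[a i, b i].
Proof.
by move=> [h0 h1]; rewrite plane_point_coord; have [->|->] := ord2P i.
Qed.

Variable X : 'I_2 -> V -> R.
Hypothesis CX : forall x : V, (forall i, x 0 i \in `[a i, b i]) -> forall i, C1 (X i) x.
Hypothesis X0 : forall (x : V) i, (forall j, x 0 j \in `[a j, b j]) ->
  x 0 i = a i \/ x 0 i = b i -> X i x = 0.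

Lemma within_box_pd i : {within box a b, continuous (fun z => pd i (X i) (plane_point z))}.
Proof.
apply: continuous_in_subspaceT => z; rewrite inE => hz.
apply: (@continuous_comp _ _ _ plane_point (pd i (X i))); first exact: plane_point_cont.
by apply: C1_pd_cont; apply: CX => j; exact: box_coord.
Qed.

(** By Fubini the integral is first taken along the variable of the derivative,
    where it is the difference of two boundary values, both 0. *)
Lemma box_integral_pd0 :
  (\int[leb \x leb]_(z in box a b) (pd 0 (X 0) (plane_point z))%:E = 0)%E.
Proof.
have I := within_box_integrable (@within_box_pd 0).
rewrite integral_mkcond -integral21_prod_meas1; last first.
  by apply: (iffLR (integrable_mkcond _ _)) I; exact: box_measurable.
apply: integral0_eq => y _; rewrite /fubini_G.
have [hy|hy] := boolP (y \in `[a 1, b 1]); last first.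
  apply: integral0_eq => x _; rewrite patchE ifF //.
  by apply/negbTE/negP; rewrite inE => -[_ /= h]; rewrite h in hy.
have := @FTC_line (X 0) (plane_point (0, y)) 0 (a 0) (b 0) (ab 0).
have bx x : x \in `[a 0, b 0] -> forall i, plane_point (x, y) 0 i \in `[a i, b i].
  by move=> hx i; apply: box_coord.
have ain : a 0 \in `[a 0, b 0] by rewrite in_itv /= lexx ltW.
have bin : b 0 \in `[a 0, b 0] by rewrite in_itv /= lexx ltW.
have Za : X 0 (plane_point (a 0, y)) = 0.
  by apply: X0; [exact: bx|left; rewrite plane_point_coord].
have Zb : X 0 (plane_point (b 0, y)) = 0.
  by apply: X0; [exact: bx|right; rewrite plane_point_coord].
rewrite -!plane_point_line0 Za Zb subee // => <-; last by move=> s hs; rewrite -plane_point_line0; exact: CX (bx s hs) _.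
rewrite [RHS]integral_mkcond; apply: eq_integral => x _.
rewrite !patchE -plane_point_line0; congr (if _ then _ else _).
by apply/idP/idP; rewrite !inE; [case|move=> h; split].
Qed.

Lemma box_integral_pd1 :
  (\int[leb \x leb]_(z in box a b) (pd 1 (X 1) (plane_point z))%:E = 0)%E.
Proof.
have I := within_box_integrable (@within_box_pd 1).
rewrite integral_mkcond -integral12_prod_meas1; last first.
  by apply: (iffLR (integrable_mkcond _ _)) I; exact: box_measurable.
apply: integral0_eq => x _; rewrite /fubini_F.
have [hx|hx] := boolP (x \in `[a 0, b 0]); last first.
  apply: integral0_eq => y _; rewrite patchE ifF //.
  by apply/negbTE/negP; rewrite inE => -[/= h _]; rewrite h in hx.
have := @FTC_line (X 1) (plane_point (x, 0)) 1 (a 1) (b 1) (ab 1).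
have bx y : y \in `[a 1, b 1] -> forall i, plane_point (x, y) 0 i \in `[a i, b i].
  by move=> hy i; apply: box_coord.
have ain : a 1 \in `[a 1, b 1] by rewrite in_itv /= lexx ltW.
have bin : b 1 \in `[a 1, b 1] by rewrite in_itv /= lexx ltW.
have Za : X 1 (plane_point (x, a 1)) = 0.
  by apply: X0; [exact: bx|left; rewrite plane_point_coord].
have Zb : X 1 (plane_point (x, b 1)) = 0.
  by apply: X0; [exact: bx|right; rewrite plane_point_coord].
rewrite -!plane_point_line1 Za Zb subee // => <-; last by move=> s hs; rewrite -plane_point_line1; exact: CX (bx s hs) _.
rewrite [RHS]integral_mkcond; apply: eq_integral => y _.
rewrite !patchE -plane_point_line1; congr (if _ then _ else _).
by apply/idP/idP; rewrite !inE; [case|move=> h; split].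
Qed.

Lemma box_divergence :
  (\int[leb \x leb]_(z in box a b) (\sum_i pd i (X i) (plane_point z))%:E = 0)%E.
Proof.
under eq_integral do rewrite sum2 EFinD.
rewrite integralD; [|exact: box_measurable| |]; last 2 first.
- exact: within_box_integrable (@within_box_pd 0).
- exact: within_box_integrable (@within_box_pd 1).
by rewrite box_integral_pd0 box_integral_pd1 adde0.
Qed.

End PlaneMeasure.

(** * Integration over a chart *)

Section Charts.
Context {R : realType} {M : ptopologicalType} (A : atlas2 R M).
Local Notation V := 'rV[R]_2.
Implicit Types (c d : chart A).

Lemma img_cmap c p : dom c p -> img c (cmap c p).
Proof. by move=> h; exists p. Qed.

Lemma cinv_dom c x : img c x -> dom c (cinv c x).
Proof. by move=> [p hp <-]; rewrite cmapK. Qed.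

Lemma cinvK c x : img c x -> cmap c (cinv c x) = x.
Proof. by move=> [p hp <-]; rewrite cmapK. Qed.

Lemma img_nbhs c x : img c x -> \forall y \near x, img c y.
Proof. by move=> h; apply: open_nbhs_nbhs; split => //; exact: img_open. Qed.

Lemma dom_nbhs c p : dom c p -> \forall q \near p, dom c q.
Proof. by move=> h; apply: open_nbhs_nbhs; split => //; exact: dom_open. Qed.

Lemma cmap_continuous c p : dom c p -> {for p, continuous (cmap c)}.
Proof.
move=> h; have := cmap_cont (c := c); rewrite continuous_open_subspace; last exact: dom_open.
by move=> /(_ p); apply; rewrite inE.
Qed.

Lemma cinv_continuous c x : img c x -> {for x, continuous (cinv c)}.
Proof.
move=> h; have := cinv_cont (c := c); rewrite continuous_open_subspace; last exact: img_open.
by move=> /(_ x); apply; rewrite inE.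
Qed.

End Charts.

Section ChartIntegral.
Context {R : realType} {M : ptopologicalType} (A : atlas2 R M).
Local Notation V := 'rV[R]_2.
Local Notation mR := (measurableTypeR R).
Local Notation leb := (@lebesgue_measure R).
Variables (hM : hausdorff_space M) (gm : metric_components A)
  (mu : {measure set (borel M) -> \bar R}) (c : chart A) (a b : 'I_2 -> R).
Hypothesis hmu : is_volume gm mu.
Hypothesis hbox : forall z, box a b z -> img c (plane_point z).
Let q (z : R * R) : R := Num.sqrt (\det (gm c (plane_point z))).
Hypothesis cq : {within box a b, continuous q}.

Definition chart_patch : set M := (fun z => cinv c (plane_point z)) @` box a b.

Lemma within_patch : {within box a b, continuous (fun z => cinv c (plane_point z))}.
Proof.
apply: continuous_in_subspaceT => z; rewrite inE => hz.
apply: (@continuous_comp _ _ _ plane_point (cinv c)); first exact: plane_point_cont.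
by apply: cinv_continuous; exact: hbox.
Qed.

Lemma patch_closed : closed chart_patch.
Proof.
apply: compact_closed => //; apply: continuous_compact; first exact: within_patch.
exact: box_compact.
Qed.

Lemma open_borel (U : set M) : open U -> measurable (U : set (borel M)).
Proof. by move=> oU; exact: sub_sigma_algebra. Qed.

Lemma closed_borel (U : set M) : closed U -> measurable (U : set (borel M)).
Proof.
by move=> /closed_openC/open_borel/measurableC; rewrite setCK.
Qed.

Lemma plane_point_inj (z z' : R * R) : plane_point z = plane_point z' :> V -> z = z'.
Proof.
move=> h; have h0 : plane_point z 0 0 = plane_point z' 0 0 :> R by rewrite h.
have h1 : plane_point z 0 1 = plane_point z' 0 1 :> R by rewrite h.
by move: h0 h1; rewrite !plane_point_coord /=; case: z {h} => ? ?; case: z' => ? ? /= -> ->.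
Qed.

Lemma measurable_patch :
  measurable_fun (box a b : set (mR * mR))
    ((fun z => cinv c (plane_point z)) : mR * mR -> borel M).
Proof.
apply: (@measurability _ _ (mR * mR)%type (borel M) (box a b) (fun z => cinv c (plane_point z)) (@open M) erefl).
move=> _ [U oU <-].
have /continuousP cf := within_patch.
have /open_subspaceP [W oW WD] := cf _ oU.
rewrite setIC -WD; apply: measurableI; last exact: box_measurable.
exact: open_plane_measurable.
Qed.

(** The formula that characterises the volume element, with the image of a set under
    the chart replaced by a preimage under its inverse. *)
Lemma measure_patch (B : set (borel M)) : measurable B ->
  mu (chart_patch `&` B) = (\int[leb \x leb]_(z in box a b `&`
    ((fun z => cinv c (plane_point z)) @^-1` B)) (q z)%:E)%E.
Proof.
move=> mB; rewrite (hmu (c := c)); last 2 first.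
- by apply: measurableI => //; exact: closed_borel patch_closed.
- by move=> _ [[z hz <-] _]; apply: cinv_dom; exact: hbox.
congr (integral _ _ _); apply/seteqP; split => z /=.
  move=> [p [[z' hz' <-] hB]]; rewrite cinvK; last exact: hbox.
  by move=> /plane_point_inj <-.
move=> [hz hB]; exists (cinv c (plane_point z)); last by rewrite cinvK //; exact: hbox.
by split => //; exists z.
Qed.

Let k (z : R * R) : M := cinv c (plane_point z).

Lemma q_ge0 z : 0 <= q z. Proof. exact: sqrtr_ge0. Qed.

Lemma measurable_q : measurable_fun (box a b : set (mR * mR)) (q : mR * mR -> mR).
Proof. by apply: within_plane_measurable => //; exact: box_measurable. Qed.

Import HBNNSimple.
Local Open Scope ereal_scope.

Lemma measurable_comp_patch (f : borel M -> \bar R) : measurable_fun setT f ->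
  measurable_fun (box a b : set (mR * mR)) (fun z => f (k z)).
Proof.
move=> mf; apply: (@measurable_comp _ _ _ _ _ _ setT f _ k) => //.
exact: measurable_patch.
Qed.

(** Simple functions are combinations of indicators, for which the formula is
    [measure_patch]. *)
Lemma nnsfun_chart_integral (h : {nnsfun (borel M) >-> R}) :
  \int[mu]_(p in chart_patch) (h p)%:E =
  \int[leb \x leb]_(z in box a b) ((h (k z))%:E * (q z)%:E).
Proof.
have mp : measurable (chart_patch : set (borel M)) by exact: closed_borel patch_closed.
have mb := @box_measurable R a b.
have mhr r : measurable (h @^-1` [set r]) by exact: measurable_sfunP.
transitivity (\sum_(y \in range h) (y%:E * mu (chart_patch `&` (h @^-1` [set y])))).
  transitivity (\int[mu]_(x in chart_patch)
    (\sum_(y \in range h) (y * \1_(h @^-1` [set y]) x)%:E)).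
    by apply: eq_integral => t _; rewrite fimfunE -fsumEFin.
  rewrite ge0_integral_fsum//; last 2 first.
  - move=> r; apply/measurable_EFinP; apply: measurable_funM => //.
  - by move=> r x _; exact: nnfun_muleindic_ge0.
  apply: eq_fsbigr => r rh.
  by rewrite integralZl_indic_nnsfun // integral_indic // setIC.
transitivity (\int[leb \x leb]_(z in box a b)
    (\sum_(y \in range h) (y * \1_(h @^-1` [set y]) (k z))%:E * (q z)%:E)); last first.
  apply: eq_integral => z _; rewrite [in RHS]fimfunE -fsumEFin //.
  by rewrite ge0_mule_fsuml // => y; exact: nnfun_muleindic_ge0.
have mind r : measurable_fun (box a b : set (mR * mR))
    (fun z => (r * \1_(h @^-1` [set r]) (k z))%:E).
  apply: (@measurable_comp_patch (fun p => (r * \1_(h @^-1` [set r]) p)%:E)).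
  by apply/measurable_EFinP; apply: measurable_funM.
rewrite ge0_integral_fsum//; last 2 first.
- move=> r; apply: emeasurable_funM; first exact: mind.
  by apply/measurable_EFinP; exact: measurable_q.
- by move=> r z _; rewrite mule_ge0 ?lee_fin ?q_ge0 // -lee_fin nnfun_muleindic_ge0.
apply: eq_fsbigr => r; rewrite inE => -[p _ hr].
have r0 : (0 <= r)%R by rewrite -hr.
rewrite measure_patch // integral_mkcondr.
under [RHS]eq_integral do rewrite EFinM -muleA.
rewrite ge0_integralZl // ?lee_fin //; last 2 first.
- apply: emeasurable_funM; last by apply/measurable_EFinP; exact: measurable_q.
  apply: (@measurable_comp_patch (fun p => (\1_(h @^-1` [set r]) p)%:E)).
  by apply/measurable_EFinP.
- by move=> z _; rewrite mule_ge0 // lee_fin ?q_ge0.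
congr (_ * _); apply: eq_integral => z _.
rewrite patchE indicE; case: ifPn => hz.
  by rewrite mem_set ?mul1e //; move: hz; rewrite inE.
by rewrite memNset ?mul0e //; move: hz; rewrite notin_setE.
Qed.

Lemma ge0_chart_integral (f : borel M -> \bar R) :
  (forall p, 0 <= f p) -> measurable_fun setT f ->
  \int[mu]_(p in chart_patch) f p = \int[leb \x leb]_(z in box a b) (f (k z) * (q z)%:E).
Proof.
move=> f0 mf.
have mp : measurable (chart_patch : set (borel M)) by exact: closed_borel patch_closed.
have mb := @box_measurable R a b.
pose h := nnsfun_approx measurableT mf.
have fE p : f p = lim ((EFin \o h n) p @[n --> \oo]).
  by apply/esym/cvg_lim => //; exact: cvg_nnsfun_approx.
have -> : \int[mu]_(p in chart_patch) f p = lim (\int[mu]_(p in chart_patch) (EFin \o h n) p @[n --> \oo]).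
  under eq_integral do rewrite fE.
  apply: monotone_convergence => //.
  - by move=> n; apply/measurable_EFinP; apply: (measurable_funS measurableT).
  - by move=> n x _ /=; rewrite lee_fin.
  - by move=> x _ m n mn; rewrite lee_fin; exact/lefP/nd_nnsfun_approx.
have -> : \int[leb \x leb]_(z in box a b) (f (k z) * (q z)%:E) =
    lim (\int[leb \x leb]_(z in box a b) ((h n (k z))%:E * (q z)%:E) @[n --> \oo]).
  have fq z : f (k z) * (q z)%:E = lim ((h n (k z))%:E * (q z)%:E @[n --> \oo]).
    by apply/esym/cvg_lim => //; apply: cvgeZr => //; exact: cvg_nnsfun_approx.
  under eq_integral do rewrite fq.
  apply: monotone_convergence => //.
  - move=> n; apply: emeasurable_funM; last by apply/measurable_EFinP; exact: measurable_q.
    apply: (@measurable_comp_patch (fun p => (h n p)%:E)); exact/measurable_EFinP.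
  - by move=> n z _; rewrite mule_ge0 // lee_fin ?q_ge0.
  - move=> z _ m n mn; apply: lee_wpmul2r; rewrite lee_fin; first exact: q_ge0.
    by have /lefP := nd_nnsfun_approx measurableT mf mn; exact.
by under eq_fun do rewrite nnsfun_chart_integral.
Qed.

Lemma chart_integral (f : M -> R) :
  measurable_fun setT (f : borel M -> mR) -> (forall p, ~ chart_patch p -> f p = 0%R) ->
  \int[mu]_p (f p)%:E = \int[leb \x leb]_(z in box a b) (f (k z) * q z)%:E.
Proof.
move=> mf f0.
have -> : \int[mu]_p (f p)%:E = \int[mu]_(p in chart_patch) (f p)%:E.
  rewrite [RHS]integral_mkcond; apply: eq_integral => p _.
  rewrite patchE; case: ifPn => // /negP; rewrite inE => /f0 ->.
  by [].
rewrite integralE [RHS]integralE.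
have mE : measurable_fun setT (EFin \o (f : borel M -> mR)) by exact/measurable_EFinP.
rewrite !ge0_chart_integral //; last 2 first.
- exact: measurable_funeneg.
- exact: measurable_funepos.
congr (_ - _); apply: eq_integral => z _.
- by rewrite !funeposE EFinM maxeMl ?mul0e ?lee_fin ?q_ge0.
- by rewrite !funenegE EFinM -mulNe maxeMl ?mul0e ?lee_fin ?q_ge0.
Qed.

End ChartIntegral.

(** * Bump functions and binary quadratic forms *)

Section Bump.
Context {R : realType}.
Local Notation V := 'rV[R]_2.

(** This form of the derivative treats both sides of a point at once, which suits a
    function defined by cases such as [pos2]. *)
Lemma is_derive_quadratic (f : R -> R) (x l : R) :
  (forall h, `|f (x + h) - f x - l * h| <= h ^+ 2) -> is_derive x (1 : R) f l.
Proof.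
move=> H.
have C : (fun h : R => h^-1 *: ((f \o shift x) (h *: 1) - f x)) @ 0^' --> l.
  apply/cvgrPdistC_le => e e0; near=> h.
  have h0 : h != 0 by near: h; exact: nbhs_dnbhs_neq.
  have -> : h^-1 *: ((f \o shift x) (h *: 1) - f x) - l = h^-1 * (f (x + h) - f x - l * h).
    rewrite /= -[h *: 1]/(h * 1) mulr1 [h + x]addrC -[_ *: _]/(_ * _).
    by move: (f (x + h)) (f x) => u v; field.
  rewrite normrM; apply: (@le_trans _ _ (`|h^-1| * h ^+ 2)); first by rewrite ler_wpM2l.
  rewrite normfV -[h ^+ 2]ger0_norm ?sqr_ge0 // normrX expr2 mulrA mulVf ?normr_eq0 // mul1r.
  by near: h; apply: dnbhs0_le.
split; first exact: (cvgP _ C).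
exact: (cvg_lim _ C).
Unshelve. all: by end_near. Qed.

(** The square of the positive part is C1 and vanishes on a half-line; one
    integration by parts asks for no more. *)
Definition pos2 (r : R) := Num.max 0 r ^+ 2.

Lemma is_derive_pos2 (r : R) : is_derive r (1 : R) pos2 (2 * Num.max 0 r).
Proof.
apply: is_derive_quadratic => h; rewrite /pos2.
have [h1|h1] := leP 0 (r + h); have [h2|h2] := leP 0 r; rewrite ler_norml; apply/andP; split; nra.
Qed.

Lemma C1_pos2 (f : V -> R) x : C1 f x -> C1 (fun y => pos2 (f y)) x.
Proof.
move=> Cf; apply: (C1_comp1 (dp := fun r => 2 * Num.max 0 r)) => //.
apply: near_all => y; split; first exact: is_derive_pos2.
apply: cont_mul; first exact: cont_cst.
apply: (@continuous_max _ _ (fun=> 0) id); [exact: cont_cst|exact: cvg_id].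
Qed.

(** The product form makes the support a square, that is, a box of the plane. *)
Definition sqbump (x0 : V) (r : R) (y : V) : R :=
  pos2 (r ^+ 2 - (y 0 0 - x0 0 0) ^+ 2) * pos2 (r ^+ 2 - (y 0 1 - x0 0 1) ^+ 2).

Lemma C1_bump x0 r y : C1 (sqbump x0 r) y.
Proof.
have C k : C1 (fun y => r ^+ 2 - (y 0 k - x0 0 k) ^+ 2) y.
  apply: (C1_add (C1_cst _ _)); apply: C1_opp.
  have Ck := C1_add (C1_coord k y) (C1_cst (- x0 0 k) y).
  exact: (C1_mul Ck Ck).
exact: (C1_mul (C1_pos2 (C 0)) (C1_pos2 (C 1))).
Qed.

Lemma pos2_ge0 r : 0 <= pos2 r. Proof. exact: sqr_ge0. Qed.

Lemma bump_ge0 x0 r y : 0 <= sqbump x0 r y.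
Proof. by rewrite mulr_ge0 // pos2_ge0. Qed.

Lemma pos2_sqr_gt0 (r t : R) : `|t| < r -> 0 < pos2 (r ^+ 2 - t ^+ 2).
Proof.
move=> tr; rewrite /pos2; have H : 0 < r ^+ 2 - t ^+ 2.
  have r0 : 0 <= r by apply: le_trans (ltW tr).
  by rewrite subr_gt0 -[t ^+ 2]real_normK ?num_real // ltr_pXn2r // ?nnegrE.
by rewrite (max_idPr (ltW H)) exprn_gt0.
Qed.

Lemma pos2_sqr_eq0 (r t : R) : 0 <= r -> r <= `|t| -> pos2 (r ^+ 2 - t ^+ 2) = 0.
Proof.
move=> r0 tr; rewrite /pos2; have H : r ^+ 2 - t ^+ 2 <= 0.
  by rewrite subr_le0 -[t ^+ 2]real_normK ?num_real // lerXn2r // nnegrE.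
by rewrite (max_idPl H) expr0n.
Qed.

Lemma bump_gt0 x0 r y : `|y - x0| < r -> 0 < sqbump x0 r y.
Proof.
move=> h; have H k : `|y 0 k - x0 0 k| < r.
  apply: le_lt_trans h; have := norm_coord_le (y - x0) k; by rewrite mxE [X in _ + X]mxE.
by rewrite mulr_gt0 //; exact: pos2_sqr_gt0.
Qed.

Lemma bump_eq0 (x0 : V) (r : R) (y : V) k : 0 <= r -> r <= `|y 0 k - x0 0 k| -> sqbump x0 r y = 0.
Proof.
move=> r0; have [->|->] := ord2P k => h; rewrite /sqbump.
  by rewrite (pos2_sqr_eq0 r0 h) mul0r.
by rewrite [X in _ * X](pos2_sqr_eq0 r0 h) mulr0.
Qed.

End Bump.

Section Metric.
Context {R : realType}.

Lemma qform2 (B : 'M[R]_2) (v : 'rV[R]_2) :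
  qform B v = v 0 0 * v 0 0 * B 0 0 + v 0 0 * v 0 1 * (B 0 1 + B 1 0) + v 0 1 * v 0 1 * B 1 1.
Proof.
rewrite /qform !mxE sum2 !mxE !sum2.
move: (v 0 0) (v 0 1) (B 0 0) (B 0 1) (B 1 0) (B 1 1) => *; ring.
Qed.

Lemma rV2_neq0 (p q : R) : p != 0 -> \row_(i < 2) (if i == 0 then p else q) != 0.
Proof.
apply: contra_neq => /rowP/(_ 0); by rewrite !mxE eqxx.
Qed.

Lemma pos_entry (B : 'M[R]_2) : (forall v : 'rV[R]_2, v != 0 -> 0 < qform B v) -> 0 < B 0 0.
Proof.
move=> H; have := H _ (rV2_neq0 0 (oner_neq0 R)); rewrite qform2 !mxE eqxx /=.
by rewrite !mulr0 !mul0r !mul1r !addr0.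
Qed.

Lemma pos_det (B : 'M[R]_2) : B^T = B ->
  (forall v : 'rV[R]_2, v != 0 -> 0 < qform B v) -> 0 < det2 B.
Proof.
move=> sB H.
have s10 : B 1 0 = B 0 1 by have /matrixP/(_ 0 1) := sB; rewrite mxE.
have e0 := pos_entry H.
(* at (- B01, B00) the quadratic form equals B00 times the determinant *)
have := H (\row_(i < 2) (if i == 0 then - B 0 1 else B 0 0)).
have nz : \row_(i < 2) (if i == 0 then - B 0 1 else B 0 0) != 0.
  apply: contraTneq e0 => /rowP/(_ 1); rewrite !mxE.
  have -> : (1 : 'I_2) == 0 = false by [].
  by move=> ->; rewrite ltxx.
move=> /(_ nz); rewrite qform2 !mxE eqxx.
have -> : (1 : 'I_2) == 0 = false by [].
rewrite s10 /det2 s10; move: (B 0 0) (B 0 1) (B 1 1) e0 => E F G E0.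
have -> : - F * - F * E + - F * E * (F + F) + E * E * G = E * (E * G - F * F) by ring.
by rewrite pmulr_rgt0.
Qed.

(** The metric changes by a = J b J^T and covectors change by J, so that the pairing
    of covectors by the inverse metric is invariant. *)
Lemma inv2_change (a b J : 'M[R]_2) (f h f' h' : 'I_2 -> R) :
  a = J *m b *m J^T -> det2 a != 0 -> b 1 0 = b 0 1 ->
  (forall i, f i = \sum_k J i k * f' k) -> (forall i, h i = \sum_k J i k * h' k) ->
  \sum_i \sum_j inv2 a i j * (f i * h j) = \sum_i \sum_j inv2 b i j * (f' i * h' j).
Proof.
move=> aE da sb fE hE.
have e i j : a i j = J i 0 * (b 0 0 * J j 0 + b 0 1 * J j 1) + J i 1 * (b 0 1 * J j 0 + b 1 1 * J j 1).
  rewrite aE !mxE sum2 !mxE !sum2 sb.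
  move: (J i 0) (J i 1) (J j 0) (J j 1) (b 0 0) (b 0 1) (b 1 1) => *; ring.
move: da; rewrite !sum2 !fE !hE !sum2 /inv2 /det2 !e sb.
have -> : (1 : 'I_2) == 0 = false by [].
rewrite eqxx; cbn iota.
move: (J 0 0) (J 0 1) (J 1 0) (J 1 1) (b 0 0) (b 0 1) (b 1 1) (f' 0) (f' 1) (h' 0) (h' 1).
move=> p q r s E F G f0 f1 h0 h1 D.
have D' : (p * s - q * r) ^+ 2 * (E * G - F * F) != 0.
  by apply: contra_neq D => D; rewrite -D; ring.
have Dj : p * s - q * r != 0 by apply: contra_neq D' => ->; rewrite expr0n mul0r.
have Db : E * G - F * F != 0 by apply: contra_neq D' => ->; rewrite mulr0.
have DE : (p * (E * p + F * q) + q * (F * p + G * q)) * (r * (E * r + F * s) + s * (F * r + G * s)) -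
  (p * (E * r + F * s) + q * (F * r + G * s)) * (r * (E * p + F * q) + s * (F * p + G * q)) =
   (p * s - q * r) ^+ 2 * (E * G - F * F) by ring.
rewrite !DE; field.
by rewrite Db Dj.
Qed.

End Metric.

(** * Change of chart and the pairing of gradients *)

Lemma ginner2 (R : realType) (G : 'rV[R]_2 -> 'M[R]_2) f h y : ginner G f h y =
  inv2 (G y) 0 0 * (pd 0 f y * pd 0 h y) + inv2 (G y) 0 1 * (pd 0 f y * pd 1 h y)
  + (inv2 (G y) 1 0 * (pd 1 f y * pd 0 h y) + inv2 (G y) 1 1 * (pd 1 f y * pd 1 h y)).
Proof. by rewrite /ginner sum2 (sum2 (fun j => inv2 _ 0 j * _)) (sum2 (fun j => inv2 _ 1 j * _)). Qed.

Section Transition.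
Context {R : realType} {M : ptopologicalType} (A : atlas2 R M).
Local Notation V := 'rV[R]_2.
Implicit Types (c d : chart A) (f h : M -> R).

(** The transition map from the chart c to the chart d. *)
Definition tau c d (x : V) : V := cmap d (cinv c x).
Definition overlap c d : set V := cmap c @` (dom c `&` dom d).

Lemma overlapE c d x : overlap c d x <-> img c x /\ dom d (cinv c x).
Proof.
split=> [[p [hc hd] <-]|[hx hd]]; first by rewrite cmapK //; split => //; exact: img_cmap.
rewrite /overlap /=; exists (cinv c x); last exact: cinvK.
by split => //; exact: cinv_dom.
Qed.

Lemma overlap_near c d x : overlap c d x -> \forall y \near x, overlap c d y.
Proof.
move=> /overlapE[hx hd].
have H : \forall y \near x, dom d (cinv c y) := cinv_continuous hx (dom_nbhs hd).
by apply: filterS2 (img_nbhs hx) H => y h1 h2; apply/overlapE.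
Qed.

Lemma overlap_open c d : open (overlap c d).
Proof. by rewrite openE => x /overlap_near. Qed.

Lemma tau_C1 c d x k : overlap c d x -> C1 (fun y => tau c d y 0 k) x.
Proof.
move=> ov; have S := @transition_smooth R M A c d k.
exact: (Ck_C1 (@overlap_open c d) (S 1%N) ov).
Qed.

Lemma local_change c d f x : overlap c d x ->
  \forall y \near x, local d f (tau c d y) = local c f y.
Proof.
move=> /overlap_near; apply: filterS => y /overlapE[_ hd].
by rewrite /local /= /tau cmapK.
Qed.

Lemma tau_overlap c d p : dom c p -> dom d p -> overlap c d (cmap c p).
Proof. by move=> hc hd; rewrite /overlap /=; exists p. Qed.

Lemma tau_cmap c d p : dom c p -> tau c d (cmap c p) = cmap d p.
Proof. by move=> hc; rewrite /tau cmapK. Qed.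

Lemma pd_change c d f x i : overlap c d x -> C1 (local d f) (tau c d x) ->
  pd i (local c f) x = \sum_k transition_jacobian c d x i k * pd k (local d f) (tau c d x).
Proof.
move=> ov Cf; rewrite -(pd_eq_near i (local_change f ov)).
apply: isd_pdE.
apply: isd_eq (chain_rule i Cf (fun k => tau_C1 k ov)) _.
by apply: eq_bigr => k _; rewrite mxE.
Qed.

Definition C1M f := forall c x, img c x -> C1 (local c f) x.

Lemma C1M_cont f : C1M f -> continuous f.
Proof.
move=> Cf p; pose c := chart_at A p; have hp : dom c p := dom_chart_at A p.
have E : \forall q \near p, local c f (cmap c q) = f q.
  by apply: filterS (dom_nbhs hp) => q hq; rewrite /local /= cmapK.
apply: near_eq_cont E _.
apply: (@continuous_comp _ _ _ (cmap c) (local c f)); first exact: cmap_continuous.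
by apply: C1_cont; apply: Cf; exact: img_cmap.
Qed.

Lemma C1M_cst (k : R) : C1M (fun=> k).
Proof. by move=> c x _; exact: C1_cst. Qed.
Lemma C1M_add f h : C1M f -> C1M h -> C1M (fun p => f p + h p).
Proof. by move=> Cf Ch c x hx; exact: C1_add (Cf c x hx) (Ch c x hx). Qed.
Lemma C1M_mul f h : C1M f -> C1M h -> C1M (fun p => f p * h p).
Proof. by move=> Cf Ch c x hx; exact: C1_mul (Cf c x hx) (Ch c x hx). Qed.
Lemma C1M_inv f : (forall p, f p != 0) -> C1M f -> C1M (fun p => (f p)^-1).
Proof. by move=> f0 Cf c x hx; apply: (C1_inv _ (Cf c x hx)); exact: f0. Qed.

Variable gm : metric_components A.

(** The function p |-> <grad f, grad h>(p), computed in the chart attached to p. *)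
Definition gip f h (p : M) : R :=
  let c := chart_at A p in ginner (gm c) (local c f) (local c h) (cmap c p).

Record smooth_metric : Prop := SmoothMetric {
  sm_metric : is_metric gm;
  sm_germ : forall c x, img c x -> metric_germ (gm c) x }.

Hypothesis Hg : smooth_metric.

(** The value may be computed in any chart, by [inv2_change] applied to the jacobian
    of the transition map. *)
Lemma gip_chart f h c p : C1M f -> C1M h -> dom c p ->
  gip f h p = ginner (gm c) (local c f) (local c h) (cmap c p).
Proof.
move=> Cf Ch hc; rewrite /gip; set d := chart_at A p.
have hd : dom d p := dom_chart_at A p.
have ov := tau_overlap hc hd; have tE := tau_cmap d hc.
have Cf' : C1 (local d f) (tau c d (cmap c p)) by rewrite tE; apply: Cf; exact: img_cmap.
have Ch' : C1 (local d h) (tau c d (cmap c p)) by rewrite tE; apply: Ch; exact: img_cmap.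
rewrite /ginner; apply: esym; rewrite -tE.
have ic := img_cmap hc; have id := img_cmap hd.
apply: (@inv2_change R _ _ (transition_jacobian c d (cmap c p))).
- exact: (metric_change (sm_metric Hg) ov).
- by rewrite gt_eqF //; exact: (mg_det (sm_germ Hg ic)).
- rewrite tE; exact: (nbhs_singleton (mg_sym (sm_germ Hg id))).
- by move=> i; exact: pd_change.
- by move=> i; exact: pd_change.
Qed.

Lemma gip_cont f h : C1M f -> C1M h -> continuous (gip f h).
Proof.
move=> Cf Ch p; pose c := chart_at A p; have hp : dom c p := dom_chart_at A p.
have ic := img_cmap hp.
have E : \forall q \near p, ginner (gm c) (local c f) (local c h) (cmap c q) = gip f h q.
  by apply: filterS (dom_nbhs hp) => q hq; rewrite (gip_chart Cf Ch hq).
apply: near_eq_cont E _.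
apply: (@continuous_comp _ _ _ (cmap c) (ginner (gm c) (local c f) (local c h))); first exact: cmap_continuous.
apply: cont_sum => i; apply: cont_sum => j; apply: cont_mul.
  exact: C1_cont (C1_inv2 (sm_germ Hg ic) i j).
by apply: cont_mul; apply: C1_pd_cont; [exact: Cf|exact: Ch].
Qed.

Lemma gip_add f1 f2 h p : C1M f1 -> C1M f2 ->
  gip (fun q => f1 q + f2 q) h p = gip f1 h p + gip f2 h p.
Proof.
move=> C1' C2'; rewrite /gip; set c := chart_at A p.
have ic := img_cmap (dom_chart_at A p).
rewrite !ginner2.
have E i : pd i (local c (fun q => f1 q + f2 q)) (cmap c p) =
  pd i (local c f1) (cmap c p) + pd i (local c f2) (cmap c p).
  exact: pd_add (C1' _ _ ic) (C2' _ _ ic).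
rewrite !E; move: (pd _ _ _) (pd _ _ _) (pd _ _ _) (pd _ _ _) (pd _ _ _) (pd _ _ _).
move: (inv2 _ _ _) (inv2 _ _ _) (inv2 _ _ _) (inv2 _ _ _) => *; ring.
Qed.

Lemma gip_mul f1 f2 h p : C1M f1 -> C1M f2 ->
  gip (fun q => f1 q * f2 q) h p = f1 p * gip f2 h p + f2 p * gip f1 h p.
Proof.
move=> C1' C2'; rewrite /gip; set c := chart_at A p.
have ic := img_cmap (dom_chart_at A p).
rewrite !ginner2.
have E i : pd i (local c (fun q => f1 q * f2 q)) (cmap c p) =
  f1 p * pd i (local c f2) (cmap c p) + f2 p * pd i (local c f1) (cmap c p).
  rewrite (pd_mul i (C1' _ _ ic) (C2' _ _ ic)) /local /= cmapK //; exact: dom_chart_at.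
rewrite !E; move: (pd _ _ _) (pd _ _ _) (pd _ _ _) (pd _ _ _) (pd _ _ _) (pd _ _ _).
move: (inv2 _ _ _) (inv2 _ _ _) (inv2 _ _ _) (inv2 _ _ _) (f1 p) (f2 p) => *; ring.
Qed.

Lemma gip_sym f h p : gip f h p = gip h f p.
Proof.
rewrite /gip; set c := chart_at A p.
have ic : img c (cmap c p) := img_cmap (dom_chart_at A p).
have s := nbhs_singleton (mg_sym (sm_germ Hg ic)) 0 1.
rewrite !ginner2 /inv2 s.
have -> : (1 : 'I_2) == 0 = false by [].
rewrite eqxx; cbn iota.
move: (pd _ _ _) (pd _ _ _) (pd _ _ _) (pd _ _ _) (gm _ _ _ _) (gm _ _ _ _) (gm _ _ _ _) (det2 _)^-1 => *; ring.
Qed.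

Lemma gip_local0 f h p : (\forall q \near p, f q = 0) -> gip f h p = 0.
Proof.
move=> f0; rewrite /gip; set c := chart_at A p.
have hc : dom c p := dom_chart_at A p.
have ic := img_cmap hc.
have E : \forall y \near cmap c p, local c f y = 0.
  have f0' : \forall q \near cinv c (cmap c p), f q = 0 by rewrite cmapK.
  exact: (cinv_continuous ic) f0'.
rewrite /ginner; apply: big1 => i _; apply: big1 => j _.
by rewrite (pd_eq_near i E) pd_cst mul0r mulr0.
Qed.

End Transition.

(** * Green's formula on a closed surface *)

Lemma coordB (R : realType) (x y : 'rV[R]_2) i : (x - y) 0 i = x 0 i - y 0 i.
Proof. by rewrite !mxE. Qed.

Section Green.
Context {R : realType} {M : ptopologicalType} (A : atlas2 R M).
Local Notation V := 'rV[R]_2.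
Local Notation mR := (measurableTypeR R).
Local Notation leb := (@lebesgue_measure R).
Hypotheses (hc : compact [set: M]) (hM : hausdorff_space M).
Variable gm : metric_components A.
Hypothesis Hg : smooth_metric gm.
Variable mu : {measure set (borel M) -> \bar R}.
Hypothesis hmu : is_volume gm mu.

Lemma radius_ex (p : M) : exists2 r : R, 0 < r &
  forall y, `|y - cmap (chart_at A p) p| <= r -> img (chart_at A p) y.
Proof.
have ic := img_cmap (dom_chart_at A p).
have [d d0 H] := near_norm (img_nbhs ic).
exists (d / 2); first by rewrite divr_gt0.
move=> y hy; apply: H; apply: le_lt_trans hy _.
by rewrite ltr_pdivrMr // ltr_pMr // ltr1n.
Qed.

Definition rad (p : M) : R := projT1 (cid2 (radius_ex p)).
Lemma rad_gt0 p : 0 < rad p.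
Proof. by rewrite /rad; case: cid2. Qed.
Lemma rad_img p y : `|y - cmap (chart_at A p) p| <= rad p -> img (chart_at A p) y.
Proof. by rewrite /rad; case: cid2 => r r0 /= H; exact: H. Qed.

Definition boxa (p : M) (i : 'I_2) : R := cmap (chart_at A p) p 0 i - rad p.
Definition boxb (p : M) (i : 'I_2) : R := cmap (chart_at A p) p 0 i + rad p.

Lemma boxab p i : boxa p i < boxb p i.
Proof. by rewrite /boxa /boxb ltrD2l gtrN // rad_gt0. Qed.

Lemma in_boxP p (x : V) : (forall i, x 0 i \in `[boxa p i, boxb p i]) <->
  `|x - cmap (chart_at A p) p| <= rad p.
Proof.
split=> [H|H i].
  apply: norm_le_coord => [|i]; first exact: ltW (rad_gt0 p).
  by have := H i; rewrite in_itv /= /boxa /boxb coordB ler_distl.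
rewrite in_itv /= /boxa /boxb -ler_distl.
by apply: le_trans H; have := norm_coord_le (x - cmap (chart_at A p) p) i; rewrite coordB.
Qed.

Lemma plane_pointK (x : V) : plane_point (x 0 0, x 0 1) = x.
Proof.
by apply/rowP => j; rewrite plane_point_coord; have [->|->] := ord2P j.
Qed.

Lemma box_img p z : box (boxa p) (boxb p) z -> img (chart_at A p) (plane_point z).
Proof. by move=> hz; apply: (@rad_img p); apply/in_boxP => i; exact: box_coord. Qed.

(** The compact square of half-side [rad p] around p in the chart attached to p. *)
Definition kpatch p := chart_patch (chart_at A p) (boxa p) (boxb p).

Lemma kpatchP p q : dom (chart_at A p) q ->
  `|cmap (chart_at A p) q - cmap (chart_at A p) p| <= rad p -> kpatch p q.
Proof.
move=> hq /in_boxP H; rewrite /kpatch /chart_patch /=.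
set x := cmap _ q in H *; exists (x 0 0, x 0 1); last by rewrite plane_pointK /x cmapK.
by split; exact: H.
Qed.

Lemma kpatch_closed p : closed (kpatch p).
Proof. by apply: patch_closed => //; exact: box_img. Qed.

Lemma kpatch_compl p q : ~ kpatch p q -> \forall q' \near q, ~ kpatch p q'.
Proof.
have o := closed_openC (@kpatch_closed p).
by move=> nk; apply: open_nbhs_nbhs; split; [exact: o|exact: nk].
Qed.

(** Extension by 0 outside of the chart is harmless, because the support lies in the
    compact square [kpatch p]. *)
Definition eta (p q : M) : R :=
  if `[< dom (chart_at A p) q >] then
    sqbump (cmap (chart_at A p) p) (rad p) (cmap (chart_at A p) q) else 0.

Lemma eta_ge0 p q : 0 <= eta p q.
Proof. by rewrite /eta; case: asboolP => // _; exact: bump_ge0. Qed.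

Lemma eta_chart p q : dom (chart_at A p) q ->
  eta p q = sqbump (cmap (chart_at A p) p) (rad p) (cmap (chart_at A p) q).
Proof. by move=> h; rewrite /eta; case: asboolP. Qed.

Lemma eta_supp p q : ~ kpatch p q -> eta p q = 0.
Proof.
move=> nk; rewrite /eta; case: asboolP => // hq.
suff [i hi] : exists i, rad p <= `|cmap (chart_at A p) q 0 i - cmap (chart_at A p) p 0 i|.
  by apply: bump_eq0 hi; exact: ltW (rad_gt0 p).
apply: contrapT => H; apply: nk; apply: kpatchP => //.
apply: norm_le_coord => [|i]; first exact: ltW (rad_gt0 p).
rewrite coordB leNgt; apply/negP => h; apply: H; exists i; exact: ltW.
Qed.

Lemma eta_gt0_near p : \forall q \near p, 0 < eta p q.
Proof.
have hp := dom_chart_at A p.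
have c := cmap_continuous hp.
have N : \forall q \near p, `|cmap (chart_at A p) q - cmap (chart_at A p) p| < rad p :=
  c _ (norm_near (cmap (chart_at A p) p) (rad_gt0 p)).
apply: filterS2 (dom_nbhs hp) N => q hq h; rewrite eta_chart //; exact: bump_gt0.
Qed.

(** The square [kpatch p] is compact, hence closed in a Hausdorff space.  Therefore
    eta p vanishes in a neighbourhood of every point that is outside of the chart. *)
Lemma C1M_eta p : C1M A (eta p).
Proof.
move=> d x hx; have [hq|hq] := pselect (dom (chart_at A p) (cinv d x)).
  have ov : overlap d (chart_at A p) x by apply/overlapE.
  pose F y := sqbump (cmap (chart_at A p) p) (rad p) (tau d (chart_at A p) y).
  have CF : C1 F x by apply: C1_comp => [|k]; [exact: C1_bump|exact: tau_C1].
  apply: C1_eq_near CF; apply: filterS (overlap_near ov) => y /overlapE[_ hy].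
  by rewrite /local /= eta_chart.
have nk : ~ kpatch p (cinv d x).
  by move=> [z hz E]; apply: hq; rewrite -E; apply: cinv_dom; exact: box_img.
have N : \forall q \near cinv d x, ~ kpatch p q.
  exact: kpatch_compl.
have N' : \forall y \near x, ~ kpatch p (cinv d y) := cinv_continuous hx N.
apply: C1_eq_near (C1_cst 0 x); apply: filterS N' => y hy.
by rewrite /local /= eta_supp.
Qed.

Lemma finite_cover : exists s : seq M, forall q, exists2 p, p \in s & 0 < eta p q.
Proof.
have := hc; rewrite compact_cover => /(_ M setT (fun p => [set q | 0 < eta p q])).
case=> [p _|q _|D _ cov].
- have -> : [set q | 0 < eta p q] = eta p @^-1` [set r | 0 < r] by [].
  apply: open_comp => [q _|]; first exact: C1M_cont (@C1M_eta p) q.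
  exact: open_gt.
- by exists q => //; exact: nbhs_singleton (eta_gt0_near q).
exists (finmap.enum_fset D) => q; have [p Dp hp] := cov q I.
by exists p.
Qed.

Lemma sqrt_det_cont p : {within box (boxa p) (boxb p),
  continuous (fun z => Num.sqrt (\det (gm (chart_at A p) (plane_point z))))}.
Proof.
apply: continuous_in_subspaceT => z; rewrite inE => hz.
have E : (fun z : R * R => Num.sqrt (\det (gm (chart_at A p) (plane_point z)))) =
   (fun z => (fun y : V => Num.sqrt (det2 (gm (chart_at A p) y))) (plane_point z)).
  by apply/funext => w; rewrite det2E.
rewrite E.
apply: (@continuous_comp _ _ _ plane_point (fun y : V => Num.sqrt (det2 (gm (chart_at A p) y)))).
  exact: plane_point_cont.
exact: C1_cont (C1_sqrt_det (sm_germ Hg (box_img hz))).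
Qed.

Lemma kpatch_measurable p : measurable (kpatch p : set (borel M)).
Proof. exact: closed_borel (@kpatch_closed p). Qed.

Lemma kpatch_finite p : (mu (kpatch p : set (borel M)) < +oo)%E.
Proof.
have := @measure_patch _ _ _ hM gm mu (chart_at A p) (boxa p) (boxb p) hmu (@box_img p) setT measurableT.
rewrite setIT preimage_setT setIT => ->.
have /integrableP[_] := within_box_integrable (@sqrt_det_cont p).
by under eq_integral do rewrite /= ger0_norm ?sqrtr_ge0 //.
Qed.

(** Finitely many squares cover the surface, and each has the finite area of a box
    for a continuous density. *)
Lemma mu_finite : (mu setT < +oo)%E.
Proof.
have [s hs] := finite_cover.
pose U (s : seq M) : set (borel M) := \big[setU/set0]_(p <- s) kpatch p.
have mU t : measurable (U t).
  by apply: bigsetU_measurable => p _; exact: kpatch_measurable.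
have fU t : (mu (U t) < +oo)%E.
  elim: t => [|p t IH]; first by rewrite /U big_nil measure0.
  rewrite /U big_cons; have H := @measureU2 _ _ _ mu _ _ (kpatch_measurable p) (mU t).
  by apply: (le_lt_trans H); apply: lte_add_pinfty; [exact: kpatch_finite|exact: IH].
apply: le_lt_trans (fU s); apply: le_measure; rewrite ?inE //.
move=> q _; have [p ps hp] := hs q.
rewrite /U -bigcup_seq; exists p => //=; apply: contrapT => /eta_supp E.
by rewrite E ltxx in hp.
Qed.

Lemma cont_measurable (f : M -> R) : continuous f ->
  measurable_fun setT (f : borel M -> mR).
Proof.
move=> /continuousP cf.
apply: (@measurability _ _ (borel M) mR setT f _ (measurable_realfun.RGenOpens.measurableE R)).
move=> _ [_ [a [b ->] <-]]; rewrite setTI; apply: open_borel.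
by apply: cf; exact: interval_open.
Qed.

Lemma cont_bounded (f : M -> R) : continuous f -> exists2 C : R, 0 <= C & forall p, `|f p| <= C.
Proof.
move=> cf; have /compact_bounded[N [_ hN]] := continuous_compact (continuous_subspaceT cf) hc.
exists (`|N| + 1); first by rewrite addr_ge0.
move=> p; apply: (hN (`|N| + 1)); last by exists p.
by rewrite ltr_pwDr // ler_norm.
Qed.

Lemma cont_integrable (f : M -> R) : continuous f ->
  mu.-integrable setT (EFin \o (f : borel M -> R)).
Proof.
move=> cf; apply: measurable_bounded_integrable => //.
- exact: mu_finite.
- exact: cont_measurable.
- have [C C0 hC] := cont_bounded cf.
  exists C; split; rewrite ?num_real // => y Cy z _.
  exact: le_trans (hC z) (ltW Cy).
Qed.

(* F is the Laplacian of h as a function on the surface; the equation satisfied by h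
   provides it in the applications *)
Variables (h F : M -> R).
Hypotheses (Ch : C1M A h)
  (CCh : forall (c : chart A) x k, img c x -> C1 (pd k (local c h)) x)
  (Fh : forall (c : chart A) x, img c x -> laplacian (gm c) (local c h) x = F (cinv c x))
  (cF : continuous F).

Definition green_fun (f : M -> R) (p : M) : R := f p * F p + gip gm f h p.

Lemma green_cont f : C1M A f -> continuous (green_fun f).
Proof.
move=> Cf p; have c1 := C1M_cont Cf (x := p); have c3 := gip_cont Hg Cf Ch (x := p).
exact: (cont_add (cont_mul c1 (cF (x := p))) c3).
Qed.

(** Within the chart the integrand times the density is the divergence of [flux],
    which vanishes on the boundary of the box. *)
Lemma green_local p k : C1M A k ->
  (\int[mu]_q (green_fun (fun q => eta p q * k q) q)%:E = 0)%E.
Proof.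
move=> Ck; pose f q := eta p q * k q; pose c := chart_at A p.
have Cf : C1M A f := C1M_mul (@C1M_eta p) Ck.
rewrite (@chart_integral _ _ _ hM gm mu c (boxa p) (boxb p) hmu (@box_img p)
  (@sqrt_det_cont p) (green_fun f)); last 2 first.
- exact: cont_measurable (green_cont Cf).
- move=> q nk; have N : \forall q' \near q, f q' = 0.
    have N' : \forall q' \near q, ~ kpatch p q'.
      exact: kpatch_compl.
    by apply: filterS N' => q' /eta_supp; rewrite /f => ->; rewrite mul0r.
  by rewrite /green_fun (gip_local0 _ _ N) (nbhs_singleton N) mul0r addr0.
have := @box_divergence R (boxa p) (boxb p) (boxab p) (flux (gm c) (local c f) (local c h)).
have boximg (x : V) : (forall i, x 0 i \in `[boxa p i, boxb p i]) -> img c x.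
  by move=> /in_boxP; exact: rad_img.
move=> D; rewrite -[RHS]D.
- apply: eq_integral => z; rewrite inE => hz; congr (_%:E).
  have ix := box_img hz.
  rewrite (divergence_flux (sm_germ Hg ix) (Cf _ _ ix) (fun k => @CCh c _ k ix)).
  rewrite (Fh ix) /green_fun (gip_chart Hg Cf Ch (cinv_dom ix)) cinvK // det2E.
  by rewrite mulrC.
- move=> x /boximg ix i.
  exact: (C1_flux (sm_germ Hg ix) (Cf _ _ ix) (fun k => @CCh c _ k ix)).
- move=> x i hx hxi; have ix := boximg _ hx.
  rewrite /flux {1}/local /= {1}/f eta_chart; last exact: cinv_dom.
  rewrite cinvK // (@bump_eq0 _ _ _ _ i); first by rewrite !mul0r mulr0.
    exact: ltW (rad_gt0 p).
  rewrite /boxa /boxb in hxi; case: hxi => ->; rewrite addrAC subrr add0r ?normrN;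
    by rewrite gtr0_norm ?rad_gt0.
Qed.

(** The function f is cut into pieces supported in charts by the partition of unity
    eta p / sum of the eta p. *)
Lemma green f : C1M A f -> (\int[mu]_q (f q * F q + gip gm f h q)%:E = 0)%E.
Proof.
move=> Cf; have [s hs] := finite_cover.
pose sig q := \sum_(p <- s) eta p q.
have sig0 q : sig q != 0.
  have [p ps hp] := hs q; rewrite /sig (big_rem p) //= gt_eqF //.
  by apply: ltr_pwDl => //; apply: sumr_ge0 => i _; exact: eta_ge0.
have Csum (t : seq M) : C1M A (fun q => \sum_(p <- t) eta p q).
  elim: t => [|p t IH].
    have -> : (fun q => \sum_(p <- [::]) eta p q) = (fun=> 0).
      by apply/funext => q; rewrite big_nil.
    exact: C1M_cst.
  have -> : (fun q => \sum_(i <- p :: t) eta i q) = (fun q => eta p q + \sum_(i <- t) eta i q).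
    by apply/funext => q; rewrite big_cons.
  exact: C1M_add (@C1M_eta p) IH.
pose k q := f q * (sig q)^-1.
have Ck : C1M A k := C1M_mul Cf (C1M_inv sig0 (Csum s)).
have fE : f = (fun q => (\sum_(p <- s) eta p q) * k q).
  by apply/funext => q; rewrite /k mulrCA -/(sig q) divff // mulr1.
have key (t : seq M) : (\int[mu]_q (green_fun (fun q => (\sum_(p <- t) eta p q) * k q) q)%:E = 0)%E.
  elim: t => [|p t IH].
    apply: integral0_eq => q _; rewrite /green_fun gip_local0 ?big_nil ?mul0r ?addr0 //.
    by apply: near_all => q'; rewrite big_nil mul0r.
  have Cp := C1M_mul (@C1M_eta p) Ck; have Ct := C1M_mul (Csum t) Ck.
  transitivity (\int[mu]_q ((green_fun (fun q => eta p q * k q) q)%:E +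
     (green_fun (fun q => (\sum_(p <- t) eta p q) * k q) q)%:E))%E.
    apply: eq_integral => q _; rewrite -EFinD; congr (_%:E).
    have -> : (fun q => (\sum_(i <- p :: t) eta i q) * k q) =
        (fun q => eta p q * k q + (\sum_(i <- t) eta i q) * k q).
      by apply/funext => q'; rewrite big_cons mulrDl.
    rewrite /green_fun (gip_add _ _ _ Cp Ct).
    move: (gip _ _ _ _) (gip _ _ _ _) (eta p q) (\sum_(p <- t) _) (k q) (F q) => *; ring.
  rewrite integralD //; last 2 first.
  - exact: cont_integrable (green_cont Cp).
  - exact: cont_integrable (green_cont Ct).
  by rewrite green_local // IH adde0.
by have := key s; rewrite -fE.
Qed.

End Green.

(** * Derivatives in time *)

Arguments flim_cst {R T F FF} a.

Section TimeInterval.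
Context {R : realType} (T : \bar R).
Local Notation J := (times T).

Lemma times_conv s t x : J s -> J t -> s <= x <= t -> J x.
Proof.
move=> [s0 _] [_ tT] /andP[sx xt]; split; first exact: le_trans s0 sx.
by apply: le_lt_trans tT; rewrite lee_fin.
Qed.

(** The times of the interval that are close to t and different from t. *)
Definition toward (t : R) : set_system R := within J t^'.

Lemma towardP t (P : R -> Prop) : toward t P <->
  exists2 d : R, 0 < d & forall s, J s -> s != t -> `|s - t| < d -> P s.
Proof.
split.
  rewrite /toward /within /= => -[d /= d0 H]; exists d => // s Js st hs.
  by apply: (H s) => //=; rewrite distrC.
move=> [d d0 H]; rewrite /toward /within /=.
exists d => //= s hs st Js; apply: H => //; by rewrite distrC.
Qed.

Lemma toward_near t (P : R -> Prop) : (\forall s \near toward t, P s) ->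
  exists2 d : R, 0 < d & forall s, J s -> s != t -> `|s - t| < d -> P s.
Proof. by move=> /towardP. Qed.

Global Instance toward_filter t : Filter (toward t).
Proof. exact: within_filter. Qed.

Lemma toward_proper t : J t -> ProperFilter (toward t).
Proof.
move=> [t0 tT]; have F1 := toward_filter t; apply: Build_ProperFilter_ex => P /towardP[d d0 H].
have [e e0 he] : exists2 e : R, 0 < e & ((t + e)%:E < T)%E.
  case: T tT => [r||] //= tr; last by exists 1; rewrite ?ltry.
  rewrite lte_fin in tr; exists ((r - t) / 2); first by rewrite divr_gt0 // subr_gt0.
  by rewrite lte_fin; lra.
pose s := t + Num.min (d / 2) e.
have m0 : 0 < Num.min (d / 2) e by rewrite lt_min divr_gt0.
exists s; apply: H.
- split; first by rewrite /s addr_ge0 // ltW.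
  by apply: le_lt_trans he; rewrite lee_fin lerD2l ge_min lexx orbT.
- by rewrite /s -subr_eq0 addrAC subrr add0r gt_eqF.
- rewrite /s addrAC subrr add0r gtr0_norm //.
  by apply: (@le_lt_trans _ _ (d / 2)); [rewrite ge_min lexx|lra].
Qed.

Lemma toward_within t (P : set R) : within J (nbhs t) P -> toward t P.
Proof.
move=> /nbhs_ballP[d /= d0 H]; apply/towardP; exists d => // s Js _ hs.
by apply: H => //; rewrite /ball /= distrC.
Qed.

(** Difference quotients, to which the algebra of limits applies at the initial time
    as well as at later times. *)
Definition tderiv (f : R -> R) (t l : R) : Prop :=
  (fun s => (f s - f t) / (s - t)) @ toward t --> l.

Lemma hdwP (f : R -> R) t l : has_deriv_within J f t 1 l <-> tderiv f t l.
Proof.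
have F1 := toward_filter t.
have F2 : Filter (within [set h : R | J (t + h *: 1)] 0^') by exact: within_filter.
split=> H; apply: flim_of_dist => e e0.
- have H1 : \forall h \near within [set h : R | J (t + h *: 1)] 0^',
    `|h^-1 * (f (t + h *: 1) - f t) - l| < e
    by exact: (flim_dist H e0).
  move: H1; rewrite near_withinE /= => -[d /= d0 Hd].
  apply/towardP; exists d => // s Js st hs.
  have := Hd (s - t); rewrite /= sub0r normrN subr_eq0 => /(_ hs st).
  rewrite -[_ *: 1]/(_ * 1) mulr1 addrC subrK => /(_ Js).
  by rewrite [_^-1 * _]mulrC.
- have H1 : \forall s \near toward t, `|(f s - f t) / (s - t) - l| < e
    by exact: (flim_dist H e0).
  have [d d0 Hd] := toward_near H1.
  rewrite near_withinE /=; exists d => // h; rewrite /ball_ /= sub0r normrN => hd h0 Jh.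
  have := Hd _ Jh; rewrite -[_ *: 1]/(_ * 1) mulr1.
  have -> : t + h - t = h by rewrite addrAC subrr add0r.
  rewrite -subr_eq0 [t + h - t]addrAC subrr add0r => /(_ h0 hd).
  by rewrite [_ / h]mulrC.
Qed.

Lemma tderiv_unique f t l1 l2 : J t -> tderiv f t l1 -> tderiv f t l2 -> l1 = l2.
Proof.
move=> Jt; have PF := toward_proper Jt.
by apply: cvg_unique.
Qed.

Lemma toward_sub t : (fun s => s - t) @ toward t --> 0.
Proof.
have F1 := toward_filter t.
by apply: flim_of_dist => e e0; apply/towardP; exists e => // s _ _; rewrite subr0.
Qed.

Lemma toward_neq t : \forall s \near toward t, s != t.
Proof. by apply/towardP; exists 1. Qed.

Lemma toward_in t : \forall s \near toward t, J s.
Proof. by apply/towardP; exists 1. Qed.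

Lemma tderiv_cont f t l : tderiv f t l -> f @ toward t --> f t.
Proof.
move=> H; have F1 := toward_filter t.
have : (fun s => (f s - f t) / (s - t) * (s - t) + f t) @ toward t --> l * 0 + f t.
  by exact: (flim_add (flim_mul H (@toward_sub t)) (flim_cst (f t))).
rewrite mulr0 add0r => X; apply: (flim_eq_near _ X).
have N := @toward_neq t.
near=> s.
rewrite divfK ?subrK // subr_eq0.
by near: s.
Unshelve. all: by end_near.
Qed.

Lemma tderiv_eq f g t l : (forall s, J s -> f s = g s) -> J t -> tderiv f t l -> tderiv g t l.
Proof.
move=> fg Jt; have F1 := toward_filter t => X; apply: (flim_eq_near _ X).
by apply: filterS (@toward_in t) => s Js; rewrite !fg.
Qed.

Lemma tderiv_add f g t l m : tderiv f t l -> tderiv g t m -> tderiv (fun s => f s + g s) t (l + m).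
Proof.
move=> hf hg; have F1 := toward_filter t; apply: (flim_eq_near _ (flim_add hf hg));
by apply: nearW => s; rewrite -mulrDl opprD addrACA.
Qed.

Lemma tderiv_cmul k f t l : tderiv f t l -> tderiv (fun s => k * f s) t (k * l).
Proof.
move=> hf; have F1 := toward_filter t; apply: (flim_eq_near _ (flim_mul (flim_cst k) hf));
by apply: nearW => s; rewrite mulrA mulrBr.
Qed.

Lemma tderiv_mul f g t l m : tderiv f t l -> tderiv g t m ->
  tderiv (fun s => f s * g s) t (l * g t + f t * m).
Proof.
move=> hf hg; have F1 := toward_filter t.
apply: (flim_eq_near _ (flim_add (flim_mul hf (tderiv_cont hg)) (flim_mul (flim_cst (f t)) hg))); apply: nearW => s.
by move: (f s) (f t) (g s) (g t) ((s - t)^-1) => *; ring.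
Qed.

Lemma tderiv_comp (p : R -> R) (dp : R) f t l : tderiv f t l -> is_derive (f t) (1 : R) p dp ->
  tderiv (fun s => p (f s)) t (dp * l).
Proof.
move=> hf /is_derive1_caratheodory[h [hE hC <-]]; have F1 := toward_filter t.
have hlim : (fun s => h (f s)) @ toward t --> h (f t).
  exact: (cvg_comp _ _ (tderiv_cont hf) hC).
apply: (flim_eq_near _ (flim_mul hlim hf)); apply: nearW => s.
by rewrite hE mulrA.
Qed.

Lemma tderiv_inv f t l : f t != 0 -> tderiv f t l ->
  tderiv (fun s => (f s)^-1) t (- (f t) ^- 2 * l).
Proof.
move=> f0 hf; apply: tderiv_comp => //.
have h := @is_deriveV R id (f t) 1 1 f0 (is_derive_id _ _).
by apply: is_derive_eq h _; rewrite -[_ *: 1]/(_ * 1) mulr1.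
Qed.

(** A time in an open subinterval is interior, where the one-sided notion is the
    ordinary derivative. *)
Lemma tderiv_isd f x y s l : J x -> J y -> s \in `]x, y[ -> tderiv f s l ->
  is_derive s (1 : R) f l.
Proof.
move=> Jx Jy sxy /hdwP hf.
have o : open (`]x, y[%classic : set R) by exact: interval_open.
apply: (@hdw_isd _ _ (`]x, y[%classic : set R) f s (1 : R) l o sxy).
apply: cvg_trans hf; apply: cvg_app => A hA.
have hA' : \forall h \near (0 : R)^', J (s + h *: 1) -> A h := hA.
have H : \forall h \near (0 : R)^', (`]x, y[%classic : set R) (s + h *: 1) -> A h.
  apply: filterS hA' => h H hh; apply: H; move: hh; rewrite /= in_itv /= => /andP[/ltW h1 /ltW h2].
  by apply: times_conv Jx Jy _; rewrite h1.
exact: H.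
Qed.

Lemma mvt_time f df x y : J x -> J y -> x < y ->
  (forall s, J s -> tderiv f s (df s)) ->
  exists2 c, x <= c <= y & f y - f x = df c * (y - x).
Proof.
move=> Jx Jy xy H.
have Jin s : s \in `[x, y] -> J s by rewrite in_itv /= => h; exact: times_conv Jx Jy h.
have sub s : s \in `]x, y[ -> s \in `[x, y].
  by rewrite !in_itv /= => /andP[/ltW -> /ltW ->].
have [||c cxy E] := @MVT R f df x y xy.
- by move=> s hs; apply: (tderiv_isd Jx Jy hs); apply: H; apply: Jin; apply: sub.
- apply/subspace_continuousP => s hs; have Js := Jin s hs.
  have F1 := toward_filter s; apply: flim_of_dist => e e0.
  have H1 : \forall z \near toward s, `|f z - f s| < e
    by exact: (flim_dist (tderiv_cont (H s Js)) e0).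
  have [d d0 Hd] := toward_near H1.
  rewrite /within /=; apply/nbhs_ballP; exists d => //= z hz hz'.
  have [->|zs] := eqVneq z s; first by rewrite subrr normr0.
  by apply: Hd => //; [exact: Jin|rewrite distrC].
by exists c => //; move: (sub _ cxy); rewrite in_itv.
Qed.

(** The bound on c - t makes the mean value theorem usable for limits at t. *)
Lemma mvt_time_sym f df s t : J s -> J t -> s != t ->
  (forall s, J s -> tderiv f s (df s)) ->
  exists c, [/\ J c, `|c - t| <= `|s - t| & (f s - f t) / (s - t) = df c].
Proof.
move=> Js Jt st H.
have [ts|ts|E] := ltgtP t s; last by rewrite E eqxx in st.
- have [c /andP[c1 c2] E] := mvt_time Jt Js ts H; exists c; split.
  + by apply: times_conv Jt Js _; rewrite c1.
  + by rewrite !ger0_norm ?subr_ge0 ?(ltW ts) // lerD2r.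
  + by rewrite E mulfK // subr_eq0.
- have [c /andP[c1 c2] E] := mvt_time Js Jt ts H; exists c; split.
  + by apply: times_conv Js Jt _; rewrite c1.
  + by rewrite !ler0_norm ?subr_le0 ?(ltW ts) // lerN2 lerD2r.
  + rewrite -[f s - f t]opprB E -mulrN opprB mulfK // subr_eq0 //.
Qed.

Lemma tderiv0_cst f s t : J s -> J t -> (forall x, J x -> tderiv f x 0) -> f s = f t.
Proof.
move=> Js Jt H; have [->//|st] := eqVneq s t.
have [c [_ _ E]] := mvt_time_sym Js Jt st H.
apply/eqP; rewrite -subr_eq0; move/eqP: E.
by rewrite mulf_eq0 invr_eq0 [s - t == 0]subr_eq0 (negbTE st) orbF.
Qed.

End TimeInterval.

(** * Joint limits in time and space *)

Section Joint.
Context {R : realType} (T : \bar R).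
Local Notation J := (times T).

(** Neighbourhoods of (t, x) within the space-time domain.  In [jt] the time t itself
    is excluded, as is required for difference quotients in time. *)
Definition jw (X : topologicalType) (t : R) (x : X) : set_system (R * X) :=
  filter_prod (within J (nbhs t)) (nbhs x).
Definition jt (X : topologicalType) (t : R) (x : X) : set_system (R * X) :=
  filter_prod (toward T t) (nbhs x).

Global Instance jw_filter (X : topologicalType) (t : R) (x : X) : Filter (jw t x).
Proof. exact: filter_prod_filter. Qed.
Global Instance jt_filter (X : topologicalType) (t : R) (x : X) : Filter (jt t x).
Proof. exact: filter_prod_filter. Qed.

Lemma jw_near (X : topologicalType) (t : R) (x : X) (P : R -> Prop) (Q : X -> Prop) :
  (\forall s \near within J (nbhs t), P s) -> (\forall y \near x, Q y) ->
  \forall z \near jw t x, P z.1 /\ Q z.2.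
Proof. by move=> hP hQ; exists ([set s | P s], [set y | Q y]) => //. Qed.

Lemma jt_near (X : topologicalType) (t : R) (x : X) (P : R -> Prop) (Q : X -> Prop) :
  (\forall s \near toward T t, P s) -> (\forall y \near x, Q y) ->
  \forall z \near jt t x, P z.1 /\ Q z.2.
Proof. by move=> hP hQ; exists ([set s | P s], [set y | Q y]) => //. Qed.

Lemma jw_jt (X : topologicalType) (t : R) (x : X) (f : R * X -> R) (l : R) :
  f @ jw t x --> l -> f @ jt t x --> l.
Proof.
apply: cvg_trans; apply: cvg_app => A [[P Q] /= [hP hQ] PQ].
by exists (P, Q) => //; split => //; exact: toward_within.
Qed.

Lemma jw_dist (X : topologicalType) (t : R) (x : X) (f : R * X -> R) (l e : R) :
  f @ jw t x --> l -> 0 < e -> exists d, exists Q : X -> Prop,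
  [/\ 0 < d, \forall y \near x, Q y &
   forall s y, J s -> `|s - t| < d -> Q y -> `|f (s, y) - l| < e].
Proof.
move=> H e0; have [[P Q] /= [hP hQ] PQ] : \forall z \near jw t x, `|f z - l| < e.
  by exact: (flim_dist H e0).
have {}hP : nbhs t [set s | J s -> P s] := hP.
have /nbhs_ballP[d /= d0 Hd] := hP.
exists d, Q; split => // s y Js hs Qy; apply: (PQ (s, y)); split => //=.
by apply: Hd => //; rewrite /ball /= distrC.
Qed.

Lemma jw_slice (X : topologicalType) (t : R) (x : X) (f : R * X -> R) : J t ->
  f @ jw t x --> f (t, x) -> {for x, continuous (fun y => f (t, y))}.
Proof.
move=> Jt H; apply: cont_of_dist => e e0.
have [d [Q [d0 hQ HQ]]] := jw_dist H e0.
by apply: filterS hQ => y Qy; apply: HQ => //; rewrite subrr normr0.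
Qed.

Lemma jw_time (X : topologicalType) (t : R) (x : X) (f : R * X -> R) (l : R) :
  f @ jw t x --> l -> (fun s => f (s, x)) @ toward T t --> l.
Proof.
move=> H; apply: flim_of_dist => e e0.
have [d [Q [d0 hQ HQ]]] := jw_dist H e0.
apply/towardP; exists d => // s Js _ hs.
by apply: HQ => //; exact: nbhs_singleton hQ.
Qed.

Lemma jt_space (X : topologicalType) (t : R) (x : X) (f : X -> R) : {for x, continuous f} ->
  (fun z => f z.2) @ jt t x --> f x.
Proof.
move=> H; apply: flim_of_dist => e e0.
have N := cont_dist H e0.
have N2 : \forall s \near toward T t, True by exact: nearW.
by apply: filterS (jt_near N2 N) => z [].
Qed.

Lemma jt_timefun (X : topologicalType) (t : R) (x : X) (f : R -> R) (l : R) :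
  f @ toward T t --> l -> (fun z => f z.1) @ jt t x --> l.
Proof.
move=> H; apply: flim_of_dist => e e0.
have N : \forall s \near toward T t, `|f s - l| < e by exact: (flim_dist H e0).
have N2 : \forall y \near x, True by exact: near_all.
by apply: filterS (jt_near N N2) => z [].
Qed.

Lemma jt_comp (X Y : topologicalType) (t : R) (p : X) (k : X -> Y) (f : R * Y -> R) (l : R) :
  {for p, continuous k} -> f @ jt t (k p) --> l -> (fun z => f (z.1, k z.2)) @ jt t p --> l.
Proof.
move=> ck H A hA; have [[P Q] /= [hP hQ] PQ] := H A hA.
exists (P, [set q | Q (k q)]); first by split => //; exact: ck.
by move=> [s q] /= [Ps Qq]; exact: (PQ (s, k q)).
Qed.

Lemma jw_comp (X Y : topologicalType) (t : R) (p : X) (k : X -> Y) (f : R * Y -> R) (l : R) :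
  {for p, continuous k} -> f @ jw t (k p) --> l -> (fun z => f (z.1, k z.2)) @ jw t p --> l.
Proof.
move=> ck H A hA; have [[P Q] /= [hP hQ] PQ] := H A hA.
exists (P, [set q | Q (k q)]); first by split => //; exact: ck.
by move=> [s q] /= [Ps Qq]; exact: (PQ (s, k q)).
Qed.

Lemma Ck_joint k (D : set 'rV[R]_2) (F : R * 'rV[R]_2 -> R) t x :
  open D -> Ck k (J `*` D) F -> J t -> D x -> F @ jw t x --> F (t, x).
Proof.
move=> oD /Ck_within/subspace_continuousP c Jt Dx A hA.
have : nbhs (t, x) [set z | (J `*` D) z -> A (F z)] := c (t, x) (conj Jt Dx) A hA.
case=> -[U W] /= [Ut Wx] UW.
have nD : \forall y \near x, D y by apply: open_nbhs_nbhs.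
exists ([set s | U s /\ J s], [set y | W y /\ D y]).
  split => /=; last exact: filterI.
  by rewrite /within /=; apply: filterS Ut.
by move=> [s y] /= [[Us Js] [Wy Dy]]; apply: (UW (s, y)).
Qed.

Lemma hdw_slice (D : set 'rV[R]_2) (F : R * 'rV[R]_2 -> R) s x v l : J s ->
  has_deriv_within (J `*` D) F (s, x) (0, v) l ->
  has_deriv_within D (fun y => F (s, y)) x v l.
Proof.
move=> Js; rewrite /has_deriv_within.
have E h : (s, x) + h *: ((0 : R), v) = (s, x + h *: v).
  have -> : (s, x) + h *: ((0 : R), v) = (s + h * 0, x + h *: v) by [].
  by rewrite mulr0 addr0.
under eq_fun do rewrite E.
have -> : [set h | (J `*` D) ((s, x) + h *: ((0 : R), v))] = [set h | D (x + h *: v)].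
  by apply/seteqP; split => h; rewrite /mkset E; [case|split].
by [].
Qed.

Lemma hdw_time (D : set 'rV[R]_2) (F : R * 'rV[R]_2 -> R) s x l : D x ->
  has_deriv_within (J `*` D) F (s, x) (1, 0) l ->
  has_deriv_within J (fun s => F (s, x)) s 1 l.
Proof.
move=> Dx; rewrite /has_deriv_within.
have E h : (s, x) + h *: ((1 : R), (0 : 'rV[R]_2)) = (s + h *: 1, x).
  have -> : (s, x) + h *: ((1 : R), (0 : 'rV[R]_2)) = (s + h *: 1, x + h *: 0) by [].
  by rewrite scaler0 addr0.
under eq_fun do rewrite E.
have -> : [set h | (J `*` D) ((s, x) + h *: ((1 : R), (0 : 'rV[R]_2)))] = [set h : R | J (s + h *: 1)].
  by apply/seteqP; split => h; rewrite /mkset E; [case|split].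
by [].
Qed.

(** The partial derivative in space is the derivative in the direction (0, ee i) of
    space-time. *)
Lemma Ck_family_pd k (D : set 'rV[R]_2) (F : R * 'rV[R]_2 -> R) i : open D ->
  Ck k.+1 (J `*` D) F -> Ck k (J `*` D) (fun z => pd i (fun y => F (z.1, y)) z.2).
Proof.
move=> oD [c H]; have [f' [H1 H2]] := H (0, ee i).
apply: Ck_ext H2 => -[s x] [Js Dx] /=; apply/esym/isd_pdE.
by apply: (hdw_isd oD Dx); apply: (hdw_slice Js); exact: (H1 (s, x) (conj Js Dx)).
Qed.

Lemma Ck_family_time k (D : set 'rV[R]_2) (F : R * 'rV[R]_2 -> R) : open D ->
  Ck k.+1 (J `*` D) F -> exists2 Ft : R * 'rV[R]_2 -> R, Ck k (J `*` D) Ft &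
    forall s x, J s -> D x -> tderiv T (fun s => F (s, x)) s (Ft (s, x)).
Proof.
move=> oD [c H]; have [f' [H1 H2]] := H (1, 0); exists f' => // s x Js Dx.
by apply/hdwP; apply: (hdw_time Dx); exact: (H1 (s, x) (conj Js Dx)).
Qed.

(** By the mean value theorem in time the difference quotient is the time derivative
    at an intermediate time, and that derivative is continuous in space-time. *)
Lemma jt_quotient (D : set 'rV[R]_2) (F Ft : R * 'rV[R]_2 -> R) t x : open D -> J t -> D x ->
  (forall s y, J s -> D y -> tderiv T (fun s => F (s, y)) s (Ft (s, y))) ->
  Ft @ jw t x --> Ft (t, x) ->
  (fun z => (F z - F (t, z.2)) / (z.1 - t)) @ jt t x --> Ft (t, x).
Proof.
move=> oD Jt Dx HF cF; apply: flim_of_dist => e e0.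
have [d [Q [d0 hQ HQ]]] := jw_dist cF e0.
have nD : \forall y \near x, D y by apply: open_nbhs_nbhs.
have N1 : \forall s \near toward T t, [/\ J s, s != t & `|s - t| < d].
  by apply/towardP; exists d.
apply: filterS (jt_near N1 (filterI hQ nD)) => -[s y] /= [[Js st hs] [Qy Dy]].
have [c [Jc hc ->]] := @mvt_time_sym R T (fun s => F (s, y)) (fun s => Ft (s, y)) s t Js Jt st
  (fun s Js => HF s y Js Dy).
by apply: HQ => //; exact: le_lt_trans hc hs.
Qed.

End Joint.

(** * The primitive of r, and limits of integrals over the surface *)

Section ExpInt.
Context {R : realType} (T : \bar R).
Local Notation J := (times T).
Local Notation leb := (@lebesgue_measure R).
Variable r : R -> R.
Hypothesis cr : forall s, J s -> r @ toward T s --> r s.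

Lemma isd_tderiv f t l : is_derive t (1 : R) f l -> tderiv T f t l.
Proof.
case=> /[swap] <- df.
have H : (fun h => h^-1 *: ((f \o shift t) (h *: 1) - f t)) @ 0^' --> 'D_1 f t by exact: df.
apply: flim_of_dist => e e0.
have : \forall h \near (0 : R)^', `|h^-1 *: ((f \o shift t) (h *: 1) - f t) - 'D_1 f t| < e.
  by exact: (flim_dist H e0).
move=> [d /= d0 Hd]; apply/towardP; exists d => // s _ st hs.
have := Hd (s - t); rewrite /= sub0r normrN subr_eq0 => /(_ hs st).
by rewrite -[_ *: 1]/(_ * 1) mulr1 subrK -[_ *: _]/(_ * _) [_^-1 * _]mulrC.
Qed.

(** The interval of times is open on the right. *)
Lemma times_succ t : J t -> exists2 t1, t < t1 & J t1.
Proof.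
move=> [t0 tT]; case: T tT => [v||] //= tv.
  rewrite lte_fin in tv; exists ((t + v) / 2); first lra.
  by split; [lra|rewrite lte_fin; lra].
by exists (t + 1); [rewrite ltrDl|split; [rewrite addr_ge0|rewrite ltry]].
Qed.

(** The function r is given on the time interval only.  Its composition with the
    projection onto [0, t1] is continuous on the line, so that the fundamental theorem
    of calculus applies, at t = 0 too. *)
Lemma tderiv_integral t : J t ->
  tderiv T (fun s => \int[leb]_(x in `[0, s]) r x) t (r t).
Proof.
move=> Jt; have [t1 tt1 Jt1] := times_succ Jt.
have [t0 _] := Jt; have [t10 _] := Jt1.
(* the projection onto [0, t1] *)
pose clamp x : R := Num.max 0 (Num.min x t1).
have clampJ x : J (clamp x).
  split; first by rewrite le_max lexx.
  have [_ h] := Jt1; apply: le_lt_trans h; rewrite lee_fin ge_max t10 ge_min lexx orbT //.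
have clampE x : 0 <= x <= t1 -> clamp x = x.
  by move=> /andP[h1 h2]; rewrite /clamp (min_idPl h2) (max_idPr h1).
have cclamp x : {for x, continuous clamp}.
  apply: (@continuous_max _ _ (fun=> 0) (fun x => Num.min x t1)); first exact: cont_cst.
  by apply: (@continuous_min _ _ id (fun=> t1)); [exact: cvg_id|exact: cont_cst].
pose rr x := r (clamp x).
have crr : continuous rr.
  move=> x; apply: cont_of_dist => e e0.
  have H1 : \forall s \near toward T (clamp x), `|r s - r (clamp x)| < e.
    by exact: (flim_dist (cr (clampJ x)) e0).
  have [d d0 Hd] := toward_near H1.
  apply: filterS (cont_dist (cclamp x) d0) => y hy; rewrite /rr.
  have [->|ne] := eqVneq (clamp y) (clamp x); first by rewrite subrr normr0.
  exact: Hd.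
have irr u : leb.-integrable `[-1, u] (EFin \o rr).
  apply: continuous_compact_integrable; first exact: segment_compact.
  exact: continuous_subspaceT.
(* the primitive starts before 0, so that the time 0 is interior *)
pose F x := \int[leb]_(z in `[-1, x]) rr z.
have dF : is_derive t (1 : R) F (r t).
  have [||d1 d2] := @continuous_FTC1_closed R rr (-1) t t1 tt1 (irr t1).
  - by apply: lt_le_trans t0; rewrite ltrN10.
  - exact: crr.
  split; first exact: d1.
  by rewrite -derive1E d2 /rr clampE // t0 ltW.
have E s : 0 <= s <= t1 -> \int[leb]_(x in `[0, s]) r x = F s - F 0.
  move=> /andP[s0 s1].
  have -> : \int[leb]_(x in `[0, s]) r x = \int[leb]_(x in `[0, s]) rr x.
    apply: eq_Rintegral => x; rewrite inE /= in_itv /= => /andP[x0 xs].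
    by rewrite /rr clampE // x0 (le_trans xs).
  have h1 : (BLeft (-1) <= BRight (0 : R))%O by rewrite bnd_simp lerN10.
  have h2 : (BRight 0 <= BRight s)%O by rewrite bnd_simp.
  rewrite /F (Rintegral_itvB (irr s) h1 h2).
  rewrite Rintegral_itv_obnd_cbnd //.
  apply: integrableS (irr s) => //.
  by apply: subset_itvr; rewrite bnd_simp lerN10.
apply: (flim_eq_near _ (isd_tderiv dF)).
apply/towardP; exists (t1 - t); first by rewrite subr_gt0.
move=> s [s0 _] _ hs; rewrite !E ?t0 ?(ltW tt1) //.
  by congr (_ / _); ring.
rewrite s0 /=; move: hs; rewrite ltr_norml => /andP[_ h]; lra.
Qed.

Lemma tderiv_exp_int t : J t -> tderiv T (exp_int r) t (exp_int r t * r t).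
Proof.
by move=> Jt; apply: (@tderiv_comp _ T expR _ _ t _ (tderiv_integral Jt)).
Qed.
End ExpInt.

Section UniformLimit.
Context {R : realType} {M : ptopologicalType} (A : atlas2 R M) (T : \bar R).
Local Notation J := (times T).
Hypotheses (hc : compact [set: M]) (hM : hausdorff_space M).
Variable gm : metric_components A.
Hypothesis Hg : smooth_metric gm.
Variable mu : {measure set (borel M) -> \bar R}.
Hypothesis hmu : is_volume gm mu.

(** Joint limits at all points of a compact space give a uniform limit. *)
Lemma uniform_near t (Fs : R -> M -> R) (F0 : M -> R) e : continuous F0 ->
  (forall p, (fun z => Fs z.1 z.2) @ jt T t p --> F0 p) -> 0 < e ->
  \forall s \near toward T t, forall p, `|Fs s p - F0 p| < e.
Proof.
move=> cF0 H e0; have e2 : 0 < e / 2 by rewrite divr_gt0.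
have /compact_near_coveringP cov := hc.
have loc p : [set: M] p -> \forall q \near p & s \near toward T t, `|Fs s q - F0 q| < e.
  move=> _.
  have N1 : \forall z \near jt T t p, `|Fs z.1 z.2 - F0 p| < e / 2 by exact: (flim_dist (H p) e2).
  have N2 := cont_dist (cF0 p) e2.
  have [[P Q] /= [hP hQ] PQ] := N1.
  exists ([set q | Q q /\ `|F0 q - F0 p| < e / 2], P); first by split => //; exact: filterI.
  move=> [q s] /= [[Qq hq] Ps]; have := PQ (s, q) (conj Ps Qq) => /= h.
  have -> : Fs s q - F0 q = (Fs s q - F0 p) - (F0 q - F0 p) by ring.
  by rewrite (le_lt_trans (ler_normB _ _)) // [ltRHS]splitr ltrD.
have N := cov R (toward T t) (fun s p => `|Fs s p - F0 p| < e) (@toward_filter _ T t) loc.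
by apply: filterS N => s h p; exact: h.
Qed.

Lemma integral_fin (f : M -> R) : continuous f ->
  (\int[mu]_p (f p)%:E = (fine (\int[mu]_p (f p)%:E))%:E)%E.
Proof.
move=> cf; rewrite fineK //; apply: integrable_fin_num => //.
exact: (cont_integrable hc hM Hg hmu cf).
Qed.

(** The convergence is uniform and the total mass finite. *)
Lemma integral_limit0 t (Fs : R -> M -> R) (F0 : M -> R) : J t ->
  (forall s, J s -> s != t -> continuous (Fs s)) -> continuous F0 ->
  (forall p, (fun z => Fs z.1 z.2) @ jt T t p --> F0 p) ->
  (forall s, J s -> s != t -> \int[mu]_p (Fs s p)%:E = 0)%E ->
  (\int[mu]_p (F0 p)%:E = 0)%E.
Proof.
move=> Jt cFs cF0 H H0.
have fm := mu_finite hc hM Hg hmu.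
pose m := fine (mu setT).
have mE : mu setT = m%:E by rewrite /m fineK // ge0_fin_numE.
have m0 : 0 <= m by rewrite /m fine_ge0.
rewrite integral_fin //; congr (_%:E); apply/eqP; rewrite -normr_le0.
apply/ler_addgt0Pr => e e0; rewrite add0r.
have e1 : 0 < e / (m + 1) by rewrite divr_gt0 // ltr_wpDl.
have PF := toward_proper Jt.
have N := uniform_near cF0 H e1.
have N' : \forall s \near toward T t, [/\ J s, s != t & forall p, `|Fs s p - F0 p| < e / (m + 1)].
  by apply: filterS3 (@toward_in _ T t) (@toward_neq _ T t) N => s h1 h2 h3; split.
have [s [Js st hs]] : exists s, [/\ J s, s != t & forall p, `|Fs s p - F0 p| < e / (m + 1)].
  exact: (filter_ex N').
have cF := cFs s Js st.
have I1 := cont_integrable hc hM Hg hmu cF0.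
have I2 := cont_integrable hc hM Hg hmu cF.
have D : (\int[mu]_p (F0 p - Fs s p)%:E = \int[mu]_p (F0 p)%:E)%E.
  under eq_integral do rewrite EFinB.
  by rewrite integralB // H0 // sube0.
rewrite -lee_fin -abse_EFin -integral_fin // -D.
have cD : continuous (fun p => F0 p - Fs s p).
  by move=> p; exact: (cont_add (cF0 p) (cont_opp (cF p))).
have I3 := cont_integrable hc hM Hg hmu cD.
apply: le_trans (le_abse_integral _ _ _) _ => //; first by case/integrableP: I3.
apply: (@le_trans _ _ (\int[mu]_(p in setT) (e / (m + 1))%:E)%E).
  apply: ge0_le_integral => //.
  - by apply: measurableT_comp => //; case/integrableP: I3.
  - by move=> p _; rewrite /= lee_fin -normrN opprB; apply: ltW; exact: hs.
rewrite integral_cst // mE -EFinM lee_fin mulrAC ler_pdivrMr ?ltr_wpDl //.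
by apply: ler_wpM2l; [exact: ltW|rewrite lerDl].
Qed.

End UniformLimit.

(** * The flow is conformal *)

Arguments tderiv_cmul {R T} k {f t l} _.

Section C2Germs.
Context {R : realType}.
Local Notation V := 'rV[R]_2.
Definition C2 (f : V -> R) (x : V) : Prop := C1 f x /\ forall k, C1 (pd k f) x.

Lemma C2_eq_near (f h : V -> R) (x : V) : (\forall y \near x, f y = h y) -> C2 f x -> C2 h x.
Proof.
move=> fh [Cf Cp]; split; first exact: C1_eq_near Cf.
by move=> k; apply: C1_eq_near (Cp k); exact: pd_near_eq.
Qed.

Lemma C2_add f h x : C2 f x -> C2 h x -> C2 (fun y => f y + h y) x.
Proof.
move=> [Cf Cpf] [Ch Cph]; split; first exact: C1_add.
move=> k; apply: C1_eq_near (C1_add (Cpf k) (Cph k)).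
by apply: filterS2 (C1_near Cf) (C1_near Ch) => y h1 h2; rewrite pd_add.
Qed.

Lemma C2_opp f x : C2 f x -> C2 (fun y => - f y) x.
Proof.
move=> [Cf Cpf]; split; first exact: C1_opp.
move=> k; apply: C1_eq_near (C1_opp (Cpf k)).
by apply: filterS (C1_near Cf) => y h1; apply/esym/isd_pdE/isd_opp; exact: isd_pd.
Qed.

Lemma C2_ln f x : 0 < f x -> C2 f x -> C2 (fun y => ln (f y)) x.
Proof.
move=> f0 [Cf Cpf]; split.
  apply: (C1_comp1 (dp := fun r => r^-1)) => //.
  have : \forall y \near f x, 0 < y by apply: open_nbhs_nbhs; split => //; exact: open_gt.
  apply: filterS => y y0; split; first exact: is_derive1_ln.
  by apply: cont_inv; [rewrite gt_eqF|exact: cvg_id].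
have fV : f x != 0 by rewrite gt_eqF.
move=> k; apply: C1_eq_near (C1_mul (C1_inv fV Cf) (Cpf k)).
apply: filterS2 (C1_near Cf) (cont_gt0 (C1_cont Cf) f0) => y h1 y0.
by apply/esym/isd_pdE/isd_comp1; [exact: isd_pd|exact: is_derive1_ln].
Qed.
End C2Germs.

Section GaussLimit.
Context {R : realType} {Z : Type} {F : set_system Z} {FF : Filter F}.
Variables (a_ : Z -> 'I_2 -> 'I_2 -> R) (d_ : Z -> 'I_2 -> 'I_2 -> 'I_2 -> R)
  (dd_ : Z -> 'I_2 -> 'I_2 -> 'I_2 -> 'I_2 -> R).
Variables (a : 'I_2 -> 'I_2 -> R) (d : 'I_2 -> 'I_2 -> 'I_2 -> R)
  (dd : 'I_2 -> 'I_2 -> 'I_2 -> 'I_2 -> R).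
Hypotheses (ha : forall i j, (fun z => a_ z i j) @ F --> a i j)
  (hd : forall k i j, (fun z => d_ z k i j) @ F --> d k i j)
  (hdd : forall k l i j, (fun z => dd_ z k l i j) @ F --> dd k l i j).

(** Brioschi's formula is a rational function of the jet with denominator det^2. *)
Lemma gaussj_lim : det2 a != 0 ->
  (fun z => gaussj (a_ z) (d_ z) (dd_ z)) @ F --> gaussj a d dd.
Proof.
move=> D0.
have hD : (fun z => det2 (a_ z)) @ F --> det2 a.
  by apply: flim_add; [|apply: flim_opp]; apply: flim_mul; exact: ha.
have h2 : (fun _ : Z => 2^-1 : R) @ F --> (2^-1 : R) by exact: flim_cst.
apply: flim_mul; last first.
  apply: flim_inv; first by rewrite expf_neq0.
  exact: (flim_mul hD hD).
have hP : (fun z => d_ z 0 0 1 - d_ z 1 0 0 / 2) @ F --> d 0 0 1 - d 1 0 0 / 2.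
  exact: (flim_add (@hd 0 0 1) (flim_opp (flim_mul (@hd 1 0 0) h2))).
have hQ : (fun z => d_ z 1 0 1 - d_ z 0 1 1 / 2) @ F --> d 1 0 1 - d 0 1 1 / 2.
  exact: (flim_add (@hd 1 0 1) (flim_opp (flim_mul (@hd 0 1 1) h2))).
have hE0 (k : 'I_2) : (fun z => d_ z k 0 0 / 2) @ F --> d k 0 0 / 2 by exact: (flim_mul (@hd k 0 0) h2).
have hH0 (k : 'I_2) : (fun z => d_ z k 1 1 / 2) @ F --> d k 1 1 / 2 by exact: (flim_mul (@hd k 1 1) h2).
have hp : (fun z => - (dd_ z 1 1 0 0) / 2 + dd_ z 0 1 0 1 - dd_ z 0 0 1 1 / 2) @ F -->
   - (dd 1 1 0 0) / 2 + dd 0 1 0 1 - dd 0 0 1 1 / 2.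
  exact: (flim_add (flim_add (flim_mul (flim_opp (@hdd 1 1 0 0)) h2) (@hdd 0 1 0 1))
    (flim_opp (flim_mul (@hdd 0 0 1 1) h2))).
apply: flim_add; last apply: flim_opp.
  apply: flim_add.
    apply: flim_add; first exact: (flim_mul hp hD).
    apply: flim_opp; apply: flim_mul; first exact: hE0.
    exact: (flim_add (flim_mul hQ (@ha 1 1)) (flim_opp (flim_mul (@ha 0 1) (@hH0 1)))).
  apply: flim_mul; first exact: hP.
  exact: (flim_add (flim_mul hQ (@ha 0 1)) (flim_opp (flim_mul (@ha 0 0) (@hH0 1)))).
apply: flim_add; last apply: flim_opp.
  apply: flim_mul; first exact: hH0.
  exact: (flim_add (flim_mul (@hE0 1) (@ha 0 1)) (flim_opp (flim_mul (@ha 0 0) (@hH0 0)))).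
apply: flim_mul; first exact: hE0.
exact: (flim_add (flim_mul (@hE0 1) (@ha 1 1)) (flim_opp (flim_mul (@ha 0 1) (@hH0 0)))).
Qed.
End GaussLimit.

Section FlatPotential.
Context {R : realType}.

(** Let Q be det B times the squared norm of the covector (p, q).  For the vector
    v = det B * B^-1 (p, q) the inequality reads 2 Q^2 <= Q^2, so that Q = 0. *)
Lemma flat_covector (B : 'M[R]_2) (p q : R) : B 1 0 = B 0 1 -> 0 < B 0 0 -> 0 < det2 B ->
  (forall v : 'rV[R]_2, 2 * (p * v 0 0 + q * v 0 1) ^+ 2 <=
     (inv2 B 0 0 * (p * p) + inv2 B 0 1 * (p * q) + (inv2 B 1 0 * (q * p) + inv2 B 1 1 * (q * q)))
     * qform B v) -> p = 0 /\ q = 0.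
Proof.
move=> s B0 D0 H.
pose v : 'rV[R]_2 := \row_(i < 2) (if i == 0 then B 1 1 * p - B 0 1 * q else B 0 0 * q - B 0 1 * p).
have := H v; rewrite qform2 !mxE eqxx.
have e10 : (1 : 'I_2) == 0 = false by [].
rewrite /inv2 eqxx e10 s; cbn iota; move: D0 B0; rewrite /det2 s.
move: (B 0 0) (B 0 1) (B 1 1) => E F G D0 E0.
pose Q := G * p ^+ 2 - 2 * F * p * q + E * q ^+ 2.
have D0' : E * G - F * F != 0 by rewrite gt_eqF.
have -> : (p * (G * p - F * q) + q * (E * q - F * p)) = Q by rewrite /Q; ring.
have -> : (G / (E * G - F * F) * (p * p) + - F / (E * G - F * F) * (p * q) +
  (- F / (E * G - F * F) * (q * p) + E / (E * G - F * F) * (q * q))) *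
 ((G * p - F * q) * (G * p - F * q) * E + (G * p - F * q) * (E * q - F * p) * (F + F) +
  (E * q - F * p) * (E * q - F * p) * G) = Q ^+ 2 by rewrite /Q; field.
move=> hQ; have Q0 : Q = 0.
  apply/eqP; rewrite -sqrf_eq0 -[_ == _]andbT; apply/eqP.
  by apply/eqP; rewrite andbT eq_le sqr_ge0 andbT; lra.
have EQ : (E * q - F * p) ^+ 2 + (E * G - F * F) * p ^+ 2 = E * Q by rewrite /Q; ring.
rewrite Q0 mulr0 in EQ.
have p2 : (E * G - F * F) * p ^+ 2 = 0.
  have h1 : 0 <= (E * q - F * p) ^+ 2 by exact: sqr_ge0.
  have h2 : 0 <= (E * G - F * F) * p ^+ 2 by rewrite mulr_ge0 ?sqr_ge0 // ltW.
  lra.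
have p0 : p = 0.
  by apply/eqP; move/eqP: p2; rewrite mulf_eq0 (negbTE D0') sqrf_eq0.
split => //; move: EQ; rewrite p0 mulr0 subr0 expr0n mulr0 addr0 => /eqP.
by rewrite sqrf_eq0 mulf_eq0 gt_eqF //= => /eqP.
Qed.
End FlatPotential.

Section Flow.
Context {R : realType} {M : ptopologicalType} (A : atlas2 R M).
Local Notation V := 'rV[R]_2.
Variables (alpha : R) (T : \bar R) (g : R -> metric_components A) (phi : R -> M -> R) (r : R -> R).
Local Notation J := (times T).
Hypothesis hflow : rescaled_list_flow alpha J g phi r.
Hypothesis hphi : forall t (c : chart A) x, J t -> img c x ->
     le_tensor (2 *: dtensor (local c (phi t)) x)
               (grad2 (g t c) (local c (phi t)) x *: g t c x).

Lemma open_img (c : chart A) : open (img c).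
Proof. exact: img_open. Qed.

Lemma g_Ck (c : chart A) i j k : Ck k (J `*` img c) (fun p : R * V => g p.1 c p.2 i j).
Proof. by have [_ h] := flow_metric hflow; exact: h. Qed.

Lemma g_slice t (c : chart A) i j k : J t -> Ck k (img c) (fun x => g t c x i j).
Proof. by move=> Jt; exact: (Ck_slice Jt (@g_Ck c i j k)). Qed.

Lemma g_C2 t (c : chart A) x i j : J t -> img c x -> C2 (fun y => g t c y i j) x.
Proof.
move=> Jt ic; split; first exact: (Ck_C1 (@open_img c) (g_slice c i j 1 Jt) ic).
move=> k; have [_ h] := Ck_pd k (@open_img c) (g_slice c i j 2 Jt).
exact: (Ck_C1 (@open_img c) h ic).
Qed.

Lemma g_metric t : J t -> is_metric (g t).
Proof. by move=> Jt; have [h _] := flow_metric hflow; exact: h. Qed.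

Lemma g_sym t (c : chart A) x i j : J t -> img c x -> g t c x i j = g t c x j i.
Proof.
by move=> Jt ic; have /matrixP/(_ i j) := Defs.metric_sym (g_metric Jt) ic; rewrite mxE => ->.
Qed.

Lemma g00_gt0 t (c : chart A) x : J t -> img c x -> 0 < g t c x 0 0.
Proof. by move=> Jt ic; apply: pos_entry => v; exact: (metric_pos (g_metric Jt) ic). Qed.

Lemma g_germ t (c : chart A) x : J t -> img c x -> metric_germ (g t c) x.
Proof.
move=> Jt ic; split.
- by apply: filterS (img_nbhs ic) => y iy i j; exact: g_sym.
- by apply: pos_det (Defs.metric_sym (g_metric Jt) ic) _ => v; exact: (metric_pos (g_metric Jt) ic).
- by move=> i j; have [] := g_C2 i j Jt ic.
- by move=> i j k; have [_ h] := g_C2 i j Jt ic; exact: h.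
Qed.

Lemma g_smooth t : J t -> smooth_metric (g t).
Proof. by move=> Jt; split; [exact: g_metric|move=> c x ic; exact: g_germ]. Qed.

(** The hypothesis on phi, evaluated on the gradient of phi, gives
    2 |grad phi|^4 <= |grad phi|^4. *)
Lemma pd_phi t (c : chart A) x i : J t -> img c x -> pd i (local c (phi t)) x = 0.
Proof.
move=> Jt ic; have Hg := g_germ Jt ic.
suff [p0 q0] : pd 0 (local c (phi t)) x = 0 /\ pd 1 (local c (phi t)) x = 0.
  by have [->|->] := ord2P i.
apply: (@flat_covector _ (g t c x)).
- exact: g_sym.
- exact: g00_gt0.
- exact: mg_det Hg.
move=> v; have := hphi Jt ic v.
rewrite !qform2 !mxE /grad2 /gtrace sum2 !(sum2 (fun j => invmx _ _ j * _)) !(nbhs_singleton (invmx_near Hg)) !mxE.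
move: (pd 0 _ x) (pd 1 _ x) (inv2 _ 0 0) (inv2 _ 0 1) (inv2 _ 1 0) (inv2 _ 1 1)
  (v 0 0) (v 0 1) (g t c x 0 0) (g t c x 0 1) (g t c x 1 0) (g t c x 1 1).
move=> p q a1 a2 a3 a4 v0 v1 e f f' h; lra.
Qed.

Lemma dtensor_phi t (c : chart A) x : J t -> img c x -> dtensor (local c (phi t)) x = 0.
Proof. by move=> Jt ic; apply/matrixP => i j; rewrite !mxE !pd_phi // mulr0. Qed.

Lemma S_tensor_gauss t (c : chart A) x : J t -> img c x ->
  S_tensor (g t c) alpha (local c (phi t)) x = gauss (g t c) x *: g t c x.
Proof.
move=> Jt ic; rewrite /S_tensor dtensor_phi // scaler0 subr0.
exact: ricci_gauss (g_germ Jt ic).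
Qed.

Lemma S_scalar_gauss t (c : chart A) x : J t -> img c x ->
  S_scalar (g t c) alpha (local c (phi t)) x = 2 * gauss (g t c) x.
Proof.
move=> Jt ic; rewrite /S_scalar S_tensor_gauss //.
exact: gtrace_metric (g_germ Jt ic) _.
Qed.

(** Since Ric = K g and the gradient of phi vanishes, the right hand side of the
    flow is (r - 2 K) g. *)
Lemma g_tderiv t (c : chart A) x i j : J t -> img c x ->
  tderiv T (fun s => g s c x i j) t ((r t - 2 * gauss (g t c) x) * g t c x i j).
Proof.
move=> Jt ic; apply/hdwP; have := @flow_eq_g _ _ _ _ _ _ _ _ hflow t c x i j Jt ic.
rewrite S_tensor_gauss // mxE.
have -> : - 2 * (gauss (g t c) x * g t c x i j - r t / 2 * g t c x i j) =
  (r t - 2 * gauss (g t c) x) * g t c x i j; last by [].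
by move: (gauss _ _) (g t c x i j) (r t) => *; field.
Qed.

Arguments g_tderiv [t c x] i j _ _.

Definition Scal t (p : M) : R := M_S (g t) alpha (phi t) p.

(** Twice the curvature can be read off from the flow as r - (d/dt g_00) / g_00, and
    the change of chart of the metric does not depend on time.  Hence 2 K is the same
    in all charts. *)
Lemma Scal_chart t (c : chart A) p : J t -> dom c p -> 2 * gauss (g t c) (cmap c p) = Scal t p.
Proof.
move=> Jt hc; rewrite /Scal /M_S; set d := chart_at A p; have hd : dom d p := dom_chart_at A p.
have ic := img_cmap hc; have id := img_cmap hd.
rewrite S_scalar_gauss //.
have ov := tau_overlap hc hd; have tE := tau_cmap d hc.
pose P := transition_jacobian c d (cmap c p).
have E s : J s -> g s c (cmap c p) 0 0 = P 0 0 * (P 0 0 * g s d (cmap d p) 0 0) +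
    P 0 0 * (P 0 1 * g s d (cmap d p) 0 1) + P 0 1 * (P 0 0 * g s d (cmap d p) 1 0) +
    P 0 1 * (P 0 1 * g s d (cmap d p) 1 1).
  move=> Js; have := metric_change (g_metric Js) ov; rewrite /= -/(tau c d _) tE -/P => ->.
  rewrite !mxE sum2 !mxE !sum2 !mxE.
  move: (P 0 0) (P 0 1) (g s d _ 0 0) (g s d _ 0 1) (g s d _ 1 0) (g s d _ 1 1) => *; ring.
have D1 := g_tderiv 0 0 Jt ic.
have D2 : tderiv T (fun s => g s c (cmap c p) 0 0) t
   ((r t - 2 * gauss (g t d) (cmap d p)) * g t c (cmap c p) 0 0).
  have DD i j := g_tderiv i j Jt id.
  have X := tderiv_add (tderiv_add (tderiv_add
     (tderiv_cmul (P 0 0) (tderiv_cmul (P 0 0) (DD 0 0)))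
     (tderiv_cmul (P 0 0) (tderiv_cmul (P 0 1) (DD 0 1))))
     (tderiv_cmul (P 0 1) (tderiv_cmul (P 0 0) (DD 1 0))))
     (tderiv_cmul (P 0 1) (tderiv_cmul (P 0 1) (DD 1 1))).
  have X' := tderiv_eq (fun s Js => esym (E s Js)) Jt X.
  have -> : (r t - 2 * gauss (g t d) (cmap d p)) * g t c (cmap c p) 0 0 =
    P 0 0 * (P 0 0 * ((r t - 2 * gauss (g t d) (cmap d p)) * g t d (cmap d p) 0 0)) +
    P 0 0 * (P 0 1 * ((r t - 2 * gauss (g t d) (cmap d p)) * g t d (cmap d p) 0 1)) +
    P 0 1 * (P 0 0 * ((r t - 2 * gauss (g t d) (cmap d p)) * g t d (cmap d p) 1 0)) +
    P 0 1 * (P 0 1 * ((r t - 2 * gauss (g t d) (cmap d p)) * g t d (cmap d p) 1 1)); last exact: X'.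
  rewrite E //.
  move: (P 0 0) (P 0 1) (g t d _ 0 0) (g t d _ 0 1) (g t d _ 1 0) (g t d _ 1 1) (r t) (gauss _ _) => *; ring.
have := tderiv_unique Jt D1 D2.
have g0 : g t c (cmap c p) 0 0 != 0 by rewrite gt_eqF // g00_gt0.
move=> /(mulIf g0); lra.
Qed.

(** All entries of the metric satisfy the same linear equation in time, so that the
    quotients g_ij / g_00 are constant. *)
Lemma g_conformal s t (c : chart A) x i j : J s -> J t -> img c x ->
  g s c x i j = g s c x 0 0 / g t c x 0 0 * g t c x i j.
Proof.
move=> Js Jt ic.
have g0 u : J u -> g u c x 0 0 != 0 by move=> Ju; rewrite gt_eqF // g00_gt0.
have D u : J u -> tderiv T (fun u => g u c x i j * (g u c x 0 0)^-1) u 0.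
  move=> Ju; have X := tderiv_mul (g_tderiv i j Ju ic) (tderiv_inv (g0 u Ju) (g_tderiv 0 0 Ju ic)).
  have -> : 0 = (r u - 2 * gauss (g u c) x) * g u c x i j * (g u c x 0 0)^-1 +
     g u c x i j * (- (g u c x 0 0) ^- 2 * ((r u - 2 * gauss (g u c) x) * g u c x 0 0)).
    by move: (gauss _ _) (g u c x i j) (g u c x 0 0) (g0 u Ju) (r u) => k a e e0 r'; field.
  exact: X.
have := tderiv0_cst Js Jt D.
move: (g s c x i j) (g t c x i j) (g s c x 0 0) (g t c x 0 0) (g0 s Js) (g0 t Jt).
move=> a b e f e0 f0 H.
have -> : a = a / e * e by field.
by rewrite H; field.
Qed.


(** * The curvature in space-time *)

(** The curvature is a rational function of the 2-jet of the metric, which is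
    continuous in space-time. *)
Lemma gauss_jw t (c : chart A) x : J t -> img c x ->
  (fun z : R * V => gauss (g z.1 c) z.2) @ jw T t x --> gauss (g t c) x.
Proof.
move=> Jt ic; have oI := @open_img c.
apply: (@gaussj_lim _ _ _ _ (fun z => g z.1 c z.2) (fun z => jet1 (g z.1 c) z.2)
  (fun z => jet2 (g z.1 c) z.2)).
- by move=> i j; exact: (Ck_joint oI (@g_Ck c i j 0) Jt ic).
- by move=> k i j; exact: (Ck_joint oI (Ck_family_pd k oI (@g_Ck c i j 1)) Jt ic).
- move=> k l i j.
  exact: (Ck_joint oI (Ck_family_pd k oI (Ck_family_pd l oI (@g_Ck c i j 2))) Jt ic).
- by rewrite gt_eqF //; exact: (mg_det (g_germ Jt ic)).
Qed.

(** The time derivative of g_00 is jointly continuous by smoothness of the family,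
    and the flow identifies it. *)
Lemma g00_time (c : chart A) : exists2 Ft : R * V -> R, Ck 0 (J `*` img c) Ft &
  forall s x, J s -> img c x -> tderiv T (fun s => g s c x 0 0) s (Ft (s, x)) /\
    Ft (s, x) = (r s - 2 * gauss (g s c) x) * g s c x 0 0.
Proof.
have [Ft CFt H] := Ck_family_time (@open_img c) (@g_Ck c 0 0 1).
exists Ft => // s x Js ic; split; first exact: H.
exact: (tderiv_unique Js (H s x Js ic) (g_tderiv 0 0 Js ic)).
Qed.

(** At one fixed point of the surface the flow expresses r by continuous functions
    of time. *)
Lemma r_cont t : J t -> r @ toward T t --> r t.
Proof.
move=> Jt; pose p : M := point; pose c := chart_at A p; pose x := cmap c p.
have ic : img c x := img_cmap (dom_chart_at A p).
have oI := @open_img c.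
have [Ft CFt H] := g00_time c.
have g0 s : J s -> g s c x 0 0 != 0 by move=> Js; rewrite gt_eqF // g00_gt0.
have rE s : J s -> Ft (s, x) * (g s c x 0 0)^-1 + 2 * gauss (g s c) x = r s.
  move=> Js; have [_ ->] := H s x Js ic.
  by rewrite mulfK ?g0 // subrK.
have L1 := jw_time (Ck_joint oI CFt Jt ic).
have L2 := jw_time (Ck_joint oI (@g_Ck c 0 0 0) Jt ic).
have L3 := jw_time (gauss_jw Jt ic).
have X : (fun s => Ft (s, x) * (g s c x 0 0)^-1 + 2 * gauss (g s c) x) @ toward T t -->
    Ft (t, x) * (g t c x 0 0)^-1 + 2 * gauss (g t c) x.
  by exact: (flim_add (flim_mul L1 (flim_inv (g0 t Jt) L2)) (flim_mul (flim_cst 2) L3)).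
rewrite rE // in X; apply: (flim_eq_near _ X).
by apply: filterS (@toward_in _ T t) => s Js; rewrite rE.
Qed.

Lemma jw_chart t (c : chart A) p : dom c p -> \forall z \near jw T t p, J z.1 /\ dom c z.2.
Proof.
move=> hc; apply: jw_near; last exact: dom_nbhs.
by rewrite near_withinE; apply: nearW.
Qed.

Lemma jt_chart t (c : chart A) p : dom c p ->
  \forall z \near jt T t p, [/\ J z.1, z.1 != t & dom c z.2].
Proof.
move=> hc; have N1 : \forall s \near toward T t, J s /\ s != t by apply/towardP; exists 1.
by apply: filterS (jt_near N1 (dom_nbhs hc)) => z [[]].
Qed.

Lemma Scal_jw t p : J t -> (fun z : R * M => Scal z.1 z.2) @ jw T t p --> Scal t p.
Proof.
move=> Jt; pose c := chart_at A p; have hp : dom c p := dom_chart_at A p.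
have L := jw_comp (cmap_continuous hp) (gauss_jw Jt (img_cmap hp)).
have X : (fun z : R * M => 2 * gauss (g z.1 c) (cmap c z.2)) @ jw T t p --> Scal t p.
  by rewrite -(Scal_chart Jt hp); exact: (flim_mul (flim_cst 2) L).
apply: (flim_eq_near _ X); apply: filterS (jw_chart t hp) => -[s q] /= [Js hq].
exact: Scal_chart.
Qed.

Lemma Scal_cont t : J t -> continuous (Scal t).
Proof. by move=> Jt p; exact: (jw_slice (f := fun z => Scal z.1 z.2) Jt (Scal_jw Jt)). Qed.


(** * The conformal factor between two times *)

(** By [g_conformal] the entry (0, 0) computes the factor between the two metrics; it
    is chosen because it is positive. *)
Definition rho s t (p : M) : R :=
  let c := chart_at A p in g s c (cmap c p) 0 0 / g t c (cmap c p) 0 0.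

Lemma rho_chart s t (c : chart A) p : J s -> J t -> dom c p ->
  rho s t p = g s c (cmap c p) 0 0 / g t c (cmap c p) 0 0.
Proof.
move=> Js Jt hc; set d := chart_at A p; have hd : dom d p := dom_chart_at A p.
have ic := img_cmap hc; have id := img_cmap hd.
have ov := tau_overlap hc hd; have tE := tau_cmap d hc.
pose P := transition_jacobian c d (cmap c p).
have E u : J u -> g u c (cmap c p) 0 0 = P 0 0 * (P 0 0 * g u d (cmap d p) 0 0) +
    P 0 0 * (P 0 1 * g u d (cmap d p) 0 1) + P 0 1 * (P 0 0 * g u d (cmap d p) 1 0) +
    P 0 1 * (P 0 1 * g u d (cmap d p) 1 1).
  move=> Ju; have := metric_change (g_metric Ju) ov; rewrite /= -/(tau c d _) tE -/P => ->.
  rewrite !mxE sum2 !mxE !sum2 !mxE.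
  move: (P 0 0) (P 0 1) (g u d _ 0 0) (g u d _ 0 1) (g u d _ 1 0) (g u d _ 1 1) => *; ring.
have C i j := @g_conformal s t d (cmap d p) i j Js Jt id.
have F : g s c (cmap c p) 0 0 = rho s t p * g t c (cmap c p) 0 0.
  rewrite !E // (C 0 1) (C 1 0) (C 1 1) {1}(C 0 0) -/(rho s t p).
  move: (rho s t p) (P 0 0) (P 0 1) (g t d _ 0 0) (g t d _ 0 1) (g t d _ 1 0) (g t d _ 1 1) => *; ring.
by rewrite F mulfK // gt_eqF // g00_gt0.
Qed.

Lemma rho_gt0 s t p : J s -> J t -> 0 < rho s t p.
Proof.
by move=> Js Jt; have ic := img_cmap (dom_chart_at A p); rewrite divr_gt0 // g00_gt0.
Qed.

Lemma rho_quotient t p : J t ->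
  (fun z : R * M => (rho z.1 t z.2 - 1) / (z.1 - t)) @ jt T t p --> r t - Scal t p.
Proof.
move=> Jt; pose c := chart_at A p; have hp : dom c p := dom_chart_at A p.
have ic := img_cmap hp; have oI := @open_img c.
have [Ft CFt H] := g00_time c.
have Q := jt_quotient (F := fun z => g z.1 c z.2 0 0) oI Jt ic (fun s y Js iy => (H s y Js iy).1) (Ck_joint oI CFt Jt ic).
have g0 y : img c y -> g t c y 0 0 != 0 by move=> iy; rewrite gt_eqF // g00_gt0.
have cg : {for cmap c p, continuous (fun y => g t c y 0 0)}.
  by have [h _] := g_C2 0 0 Jt ic; exact: C1_cont.
have X : (fun z : R * V => (g z.1 c z.2 0 0 - g t c z.2 0 0) / (z.1 - t) * (g t c z.2 0 0)^-1)
    @ jt T t (cmap c p) --> Ft (t, cmap c p) * (g t c (cmap c p) 0 0)^-1.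
  by apply: flim_mul; [exact: Q|apply: flim_inv; [exact: g0|exact: jt_space cg]].
have [_ FE] := H t (cmap c p) Jt ic.
rewrite FE mulfK ?g0 // (Scal_chart Jt hp) in X.
apply: (flim_eq_near _ (jt_comp (cmap_continuous hp) X)).
apply: filterS (jt_chart t hp) => -[s q] /= [Js st hq].
rewrite (rho_chart Js Jt hq).
have s0 : s - t != 0 by rewrite subr_eq0.
move: (g s c _ 0 0) (g t c _ 0 0) (g0 _ (img_cmap hq)) (s - t) s0 => a b b0 u u0.
by field; rewrite b0 u0.
Qed.

Lemma rho_lim t p : J t -> (fun z : R * M => rho z.1 t z.2) @ jt T t p --> (1 : R).
Proof.
move=> Jt; have hp := dom_chart_at A p.
have X : (fun z : R * M => (rho z.1 t z.2 - 1) / (z.1 - t) * (z.1 - t) + 1) @ jt T t p -->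
    (r t - Scal t p) * 0 + 1.
  apply: flim_add; last exact: flim_cst.
  by apply: flim_mul; [exact: rho_quotient|exact: jt_timefun (@toward_sub _ T t)].
rewrite mulr0 add0r in X; apply: (flim_eq_near _ X).
apply: filterS (jt_chart t hp) => -[s q] /= [Js st _].
by rewrite divfK ?subrK // subr_eq0.
Qed.

Definition lnrho s t (p : M) : R := ln (rho s t p).

(** The slope of ln at 1 is a continuous function, equal to 1 at the point 1, so that
    ln rho and rho - 1 are equivalent. *)
Lemma lnrho_quotient t p : J t ->
  (fun z : R * M => lnrho z.1 t z.2 / (z.1 - t)) @ jt T t p --> r t - Scal t p.
Proof.
move=> Jt.
have [k [kE kC k1]] := (is_derive1_caratheodory _ _ _).1 (is_derive1_ln (@ltr01 R)).
have kl : (fun z : R * M => k (rho z.1 t z.2)) @ jt T t p --> k 1.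
  exact: (cvg_comp _ _ (rho_lim p Jt) kC).
have X : (fun z : R * M => k (rho z.1 t z.2) * ((rho z.1 t z.2 - 1) / (z.1 - t))) @ jt T t p -->
    k 1 * (r t - Scal t p).
  by exact: (flim_mul kl (rho_quotient Jt)).
rewrite k1 invr1 mul1r in X; apply: (flim_eq_near _ X).
apply: nearW => -[s q] /=; rewrite mulrA; congr (_ / _).
by rewrite -[RHS]subr0 -(@ln1 R) kE.
Qed.

Lemma local_lnrho s t (c : chart A) y : J s -> J t -> img c y ->
  local c (lnrho s t) y = ln (g s c y 0 0) - ln (g t c y 0 0).
Proof.
move=> Js Jt iy; rewrite /local /= /lnrho (rho_chart Js Jt (cinv_dom iy)) cinvK //.
by rewrite ln_div // posrE g00_gt0.
Qed.

Lemma lnrho_C2 s t (c : chart A) x : J s -> J t -> img c x -> C2 (local c (lnrho s t)) x.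
Proof.
move=> Js Jt ic.
have X : C2 (fun y => ln (g s c y 0 0) - ln (g t c y 0 0)) x.
  apply: C2_add; last apply: C2_opp.
    by apply: (C2_ln (f := fun y => g s c y 0 0)); [exact: g00_gt0|exact: g_C2].
  by apply: (C2_ln (f := fun y => g t c y 0 0)); [exact: g00_gt0|exact: g_C2].
apply: C2_eq_near X; apply: filterS (img_nbhs ic) => y iy.
by rewrite local_lnrho.
Qed.

Lemma g_exp s t (c : chart A) x : J s -> J t -> img c x -> \forall y \near x,
  forall i j, g s c y i j = expR (local c (lnrho s t) y) * g t c y i j.
Proof.
move=> Js Jt ic; apply: filterS (img_nbhs ic) => y iy i j.
rewrite /local /= /lnrho lnK ?posrE ?rho_gt0 // (rho_chart Js Jt (cinv_dom iy)) cinvK //.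
exact: g_conformal.
Qed.

Lemma expR_local_lnrho s t (c : chart A) x : J s -> J t ->
  expR (local c (lnrho s t) x) = rho s t (cinv c x).
Proof. by move=> Js Jt; rewrite /local /= /lnrho lnK // posrE rho_gt0. Qed.

(** The conformal change of curvature, with S = 2 K at both times. *)
Lemma laplacian_lnrho s t (c : chart A) x : J s -> J t -> img c x ->
  laplacian (g t c) (local c (lnrho s t)) x =
  Scal t (cinv c x) - rho s t (cinv c x) * Scal s (cinv c x).
Proof.
move=> Js Jt ic; have [C C'] := lnrho_C2 Js Jt ic.
have := gauss_conformal (g_germ Jt ic) C C' (g_exp Js Jt ic).
rewrite expR_local_lnrho //.
have hd := cinv_dom ic.
have S1 := Scal_chart Jt hd; have S2 := Scal_chart Js hd; rewrite cinvK // in S1 S2.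
rewrite -S1 -S2; move: (gauss _ _) (gauss _ _) (rho _ _ _) (laplacian _ _ _) => a b e l H.
have -> : l = 2 * (a - (a - l / 2)) by field.
by rewrite -H; ring.
Qed.

(** The two metrics are conformal, and the Laplacian is conformally covariant in
    dimension 2. *)
Lemma laplacian_rescale s t (c : chart A) x f : J s -> J t -> img c x ->
  laplacian (g t c) f x = rho s t (cinv c x) * laplacian (g s c) f x.
Proof.
move=> Js Jt ic; have [C C'] := lnrho_C2 Js Jt ic.
have := laplacian_conformal (g_germ Jt ic) (g_germ Js ic) C (g_exp Js Jt ic) f.
by rewrite expR_local_lnrho.
Qed.

End Flow.

(** * Real-valued integrals, and the eigenfunctions at two times *)

Section RealIntegral.
Context {R : realType} {M : ptopologicalType} (A : atlas2 R M).
Hypotheses (hc : compact [set: M]) (hM : hausdorff_space M).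
Variable gm : metric_components A.
Hypothesis Hg : smooth_metric gm.
Variable mu : {measure set (borel M) -> \bar R}.
Hypothesis hmu : is_volume gm mu.

Definition realint (f : M -> R) : R := fine (\int[mu]_p (f p)%:E)%E.

Lemma realint_add (f h : M -> R) : continuous f -> continuous h -> realint (fun p => f p + h p) = realint f + realint h.
Proof.
move=> cf ch; apply: EFin_inj; rewrite EFinD /realint -!(integral_fin hc hM Hg hmu) //; last first.
  by move=> p; exact: (cont_add (cf p) (ch p)).
under eq_integral do rewrite EFinD.
by rewrite integralD //; exact: (cont_integrable hc hM Hg hmu).
Qed.

Lemma realint_cmul (k : R) (f : M -> R) : continuous f -> realint (fun p => k * f p) = k * realint f.
Proof.
move=> cf; apply: EFin_inj; rewrite EFinM /realint -!(integral_fin hc hM Hg hmu) //; last first.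
  by move=> p; by apply: cont_mul; [exact: cont_cst|exact: cf].
under eq_integral do rewrite EFinM.
by rewrite integralZl //; exact: (cont_integrable hc hM Hg hmu).
Qed.

Lemma continuous_cmul (k : R) (f : M -> R) : continuous f -> continuous (fun p => k * f p).
Proof. by move=> cf p; apply: cont_mul; [exact: cont_cst|exact: cf]. Qed.

(** Continuity is included so that linear combinations can be formed without a
    separate integrability argument. *)
Definition null (f : M -> R) : Prop := continuous f /\ realint f = 0.

Lemma null_addmul (k : R) (f h : M -> R) : null f -> null h -> null (fun p => f p + k * h p).
Proof.
move=> [cf If] [ch Ih].
have ckh := @continuous_cmul k h ch.
split; first by move=> p; exact: (cont_add (cf p) (ckh p)).
by rewrite (realint_add cf ckh) (realint_cmul k ch) If Ih mulr0 addr0.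
Qed.

Lemma realint_ge0 (f : M -> R) : (forall p, 0 <= f p) -> 0 <= realint f.
Proof.
by move=> f0; rewrite /realint fine_ge0 // integral_ge0 // => p _; rewrite lee_fin.
Qed.

Lemma gip_ge0 f p : 0 <= gip gm f f p.
Proof.
rewrite /gip; set c := chart_at A p.
have ic : img c (cmap c p) := img_cmap (dom_chart_at A p).
have HG := sm_germ Hg ic; have D0 := mg_det HG.
have E0 : 0 < gm c (cmap c p) 0 0.
  by apply: pos_entry => v; exact: (metric_pos (sm_metric Hg) ic).
have s := nbhs_singleton (mg_sym HG) 0 1.
rewrite !ginner2 /inv2; have -> : (1 : 'I_2) == 0 = false by [].
rewrite eqxx; cbn iota; move: D0; rewrite /det2 -s.
move: (pd 0 _ _) (pd 1 _ _) (gm c _ 0 0) E0 (gm c _ 0 1) (gm c _ 1 1) => P Q E E0 F G D0.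
have -> : G / (E * G - F * F) * (P * P) + - F / (E * G - F * F) * (P * Q) +
  (- F / (E * G - F * F) * (Q * P) + E / (E * G - F * F) * (Q * Q)) =
  ((E * Q - F * P) ^+ 2 + (E * G - F * F) * P ^+ 2) / (E * (E * G - F * F)).
  by field; rewrite !gt_eqF.
by rewrite divr_ge0 ?addr_ge0 ?sqr_ge0 // mulr_ge0 ?sqr_ge0 // ltW.
Qed.
End RealIntegral.

Section Variation.
Context {R : realType} {M : ptopologicalType} (A : atlas2 R M).
Local Notation V := 'rV[R]_2.
Hypotheses (hc : compact [set: M]) (hM : hausdorff_space M).
Variables (alpha : R) (T : \bar R) (g : R -> metric_components A) (phi : R -> M -> R) (r : R -> R).
Local Notation J := (times T).
Hypothesis hflow : rescaled_list_flow alpha J g phi r.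
Hypothesis hphi : forall t (c : chart A) x, J t -> img c x ->
     le_tensor (2 *: dtensor (local c (phi t)) x)
               (grad2 (g t c) (local c (phi t)) x *: g t c x).
Variable dv : R -> {measure set (borel M) -> \bar R}.
Hypothesis hdv : forall t, J t -> is_volume (g t) (dv t).
Variables (b : R) (lambda : R -> R) (u : R -> M -> R).
Hypothesis heigen : forall t, J t -> eigenpair (g t) (dv t) alpha b (phi t) (lambda t) (u t).
Hypothesis hu : Ck_family A 1 J u.
Local Notation Sc := (Scal alpha g phi).
Local Notation rh := (rho g).
Local Notation W := (lnrho g).

Lemma u_C2 s (c : chart A) x : J s -> img c x -> C2 (local c (u s)) x.
Proof.
move=> Js ic; have sm k := @eigen_smooth _ _ _ _ _ _ _ _ _ _ (heigen Js) c k.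
have oI := @img_open _ _ A c; split; first exact: (Ck_C1 oI (sm 1%N) ic).
by move=> k; have [_ h] := Ck_pd k oI (sm 2%N); exact: (Ck_C1 oI h ic).
Qed.

Lemma u_C1M s : J s -> C1M A (u s).
Proof. by move=> Js c x ic; have [] := u_C2 Js ic. Qed.

(** The eigenvalue equation at time s, rescaled to the metric of time t. *)
Lemma laplacian_u s t (c : chart A) x : J s -> J t -> img c x ->
  laplacian (g t c) (local c (u s)) x =
  rh s t (cinv c x) * ((b * Sc s (cinv c x) - lambda s) * u s (cinv c x)).
Proof.
move=> Js Jt ic; rewrite (laplacian_rescale hflow hphi _ Js Jt ic); congr (_ * _).
have := @eigen_eq _ _ _ _ _ _ _ _ _ _ (heigen Js) c x ic.
rewrite (S_scalar_gauss hflow hphi Js ic).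
have := Scal_chart hflow hphi Js (cinv_dom ic); rewrite cinvK // => ->.
rewrite {2 3}/local /=.
move: (laplacian _ _ _) (Sc _ _) (u _ _) (lambda s) => L S' v l H.
have -> : L = b * S' * v - (- L + b * S' * v) by ring.
by rewrite H; ring.
Qed.

Lemma rho_self t p : J t -> rh t t p = 1.
Proof.
move=> Jt; rewrite /rho divff // gt_eqF //.
exact: (g00_gt0 hflow Jt (img_cmap (dom_chart_at A p))).
Qed.

Lemma lnrho_C1M s t : J s -> J t -> C1M A (W s t).
Proof. by move=> Js Jt c x ic; have [] := lnrho_C2 hflow hphi Js Jt ic. Qed.

Lemma rho_cont s t : J s -> J t -> continuous (rh s t).
Proof.
move=> Js Jt p; have H := C1M_cont (lnrho_C1M Js Jt) (x := p).
have E : rh s t = fun q => expR (W s t q).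
  by apply/funext => q; rewrite /lnrho lnK // posrE (rho_gt0 hflow).
rewrite E; apply: (@continuous_comp _ _ _ (W s t) expR) => //; exact: continuous_expR.
Qed.

Lemma u_lim t p : J t -> (fun z : R * M => u z.1 z.2) @ jt T t p --> u t p.
Proof.
move=> Jt; pose c := chart_at A p; have hp : dom c p := dom_chart_at A p.
have ic := img_cmap hp.
have X := jt_comp (cmap_continuous hp) (jw_jt (Ck_joint (@img_open _ _ A c) (hu c) Jt ic)).
rewrite /= cmapK // in X; apply: (flim_eq_near _ X).
by apply: filterS (jt_chart T t hp) => -[s q] /= [_ _ hq]; rewrite cmapK.
Qed.

Lemma gip_lim t p : J t ->
  (fun z : R * M => gip (g t) (u t) (u z.1) z.2) @ jt T t p --> gip (g t) (u t) (u t) p.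
Proof.
move=> Jt; pose c := chart_at A p; have hp : dom c p := dom_chart_at A p.
have ic := img_cmap hp; have oI := @img_open _ _ A c.
have Hg := g_smooth hflow Jt.
have L k := jw_jt (Ck_joint oI (Ck_family_pd k oI (hu c)) Jt ic).
have C1 k l : (fun z : R * V => inv2 (g t c z.2) k l) @ jt T t (cmap c p) --> inv2 (g t c (cmap c p)) k l.
  by apply: (@jt_space R T _ t (cmap c p) (fun y => inv2 (g t c y) k l)); apply: C1_cont; exact: C1_inv2 (sm_germ Hg ic) k l.
have C2 k : (fun z : R * V => pd k (local c (u t)) z.2) @ jt T t (cmap c p) --> pd k (local c (u t)) (cmap c p).
  by apply: jt_space; apply: C1_pd_cont; exact: (u_C1M Jt ic).
have X : (fun z : R * V => ginner (g t c) (local c (u t)) (local c (u z.1)) z.2)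
   @ jt T t (cmap c p) --> ginner (g t c) (local c (u t)) (local c (u t)) (cmap c p).
  rewrite ginner2; under eq_fun do rewrite ginner2.
  have LL k l : (fun z : R * V => inv2 (g t c z.2) k l *
      (pd k (local c (u t)) z.2 * pd l (local c (u z.1)) z.2)) @ jt T t (cmap c p) -->
      inv2 (g t c (cmap c p)) k l *
      (pd k (local c (u t)) (cmap c p) * pd l (local c (u t)) (cmap c p)).
    by exact: (flim_mul (@C1 k l) (flim_mul (C2 k) (L l))).
  exact: (flim_add (flim_add (LL 0 0) (LL 0 1)) (flim_add (LL 1 0) (LL 1 1))).
apply: (flim_eq_near _ (jt_comp (cmap_continuous hp) X)).
apply: filterS (jt_chart T t hp) => -[s q] /= [Js _ hq].
by rewrite (gip_chart Hg (u_C1M Jt) (u_C1M Js) hq).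
Qed.

(** * First variation of the eigenvalue *)

(** What remains of the five instances of Green's formula in [defectE].  It contains
    no derivative of W, and it is of order s - t because rho - 1, W and
    lambda s - lambda t are. *)
Definition defect s t p : R :=
  u t p * u s p * (lambda s * rh s t p - lambda t) +
  b * (W s t p * (u t p * u s p * (b * Sc t p - lambda t) +
    u t p * u s p * rh s t p * (b * Sc s p - lambda s) + 2 * gip (g t) (u t) (u s) p)).

(** The Laplacians at time t of u s and of W s t are [lap_u] and [lap_W]. *)
Definition lap_u s t p : R := rh s t p * ((b * Sc s p - lambda s) * u s p).
Definition lap_W s t p : R := Sc t p - rh s t p * Sc s p.

Lemma lap_u_cont s t : J s -> J t -> continuous (lap_u s t).
Proof.
move=> Js Jt p; have c1 := rho_cont Js Jt (x := p); have c2 := Scal_cont hflow hphi Js (x := p).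
have c3 := C1M_cont (u_C1M Js) (x := p).
apply: cont_mul; first exact: c1.
apply: cont_mul; last exact: c3.
by apply: cont_add; [apply: cont_mul; [exact: cont_cst|exact: c2]|exact: cont_cst].
Qed.

Lemma lap_W_cont s t : J s -> J t -> continuous (lap_W s t).
Proof.
move=> Js Jt p; have c1 := rho_cont Js Jt (x := p); have c2 := Scal_cont hflow hphi Js (x := p).
have c3 := Scal_cont hflow hphi Jt (x := p).
apply: cont_add; first exact: c3.
by apply: cont_opp; apply: cont_mul; [exact: c1|exact: c2].
Qed.

Definition green_u s t (f : M -> R) p : R := f p * lap_u s t p + gip (g t) f (u s) p.
Definition green_W s t (f : M -> R) p : R := f p * lap_W s t p + gip (g t) f (W s t) p.

Lemma green_uP s t f : J s -> J t -> C1M A f ->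
  null (dv t) (green_u s t f).
Proof.
move=> Js Jt Cf; have Hg := g_smooth hflow Jt; have Cu := u_C1M Js.
split; first by exact: (green_cont Hg Cu (lap_u_cont Js Jt) Cf).
rewrite /realint (green hc hM Hg (hdv Jt) Cu _ _ (lap_u_cont Js Jt) Cf) //.
- by move=> c x k ic; have [_ h] := u_C2 Js ic; exact: h.
- by move=> c x ic; exact: (laplacian_u Js Jt ic).
Qed.

Lemma green_WP s t f : J s -> J t -> C1M A f ->
  null (dv t) (green_W s t f).
Proof.
move=> Js Jt Cf; have Hg := g_smooth hflow Jt; have Cu := lnrho_C1M Js Jt.
split; first by exact: (green_cont Hg Cu (lap_W_cont Js Jt) Cf).
rewrite /realint (green hc hM Hg (hdv Jt) Cu _ _ (lap_W_cont Js Jt) Cf) //.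
- by move=> c x k ic; have [_ h] := lnrho_C2 hflow hphi Js Jt ic; exact: h.
- by move=> c x ic; exact: (laplacian_lnrho hflow hphi Js Jt ic).
Qed.

(** The third term removes S(t) - rho S(s) from the difference of the first two.  The
    gradient of W that it brings in is removed by the last two, through the Leibniz
    rule. *)
Lemma defectE s t p : J s -> J t -> defect s t p =
  green_u t t (u s) p + (-1) * green_u s t (u t) p +
  (- b) * green_W s t (fun q => u t q * u s q) p +
  b * green_u t t (fun q => W s t q * u s q) p +
  b * green_u s t (fun q => W s t q * u t q) p.
Proof.
move=> Js Jt; rewrite /defect /green_u /green_W /lap_u /lap_W.
have Hg := g_smooth hflow Jt.
have Ws := lnrho_C1M Js Jt; have Us := u_C1M Js; have Ut := u_C1M Jt.
rewrite (gip_mul _ _ p Ut Us) (gip_mul _ _ p Ws Us) (gip_mul _ _ p Ws Ut).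
rewrite (gip_sym Hg (u s) (u t)) (gip_sym Hg (u s) (W s t)) (gip_sym Hg (u t) (W s t)).
rewrite (rho_self p Jt).
move: (gip _ _ _ _) (gip _ _ _ _) (gip _ _ _ _) (u t p) (u s p) (rh s t p) (W s t p) (Sc s p) (Sc t p) (lambda s) (lambda t).
move=> *; ring.
Qed.

Lemma defect_null s t : J s -> J t -> null (dv t) (defect s t).
Proof.
move=> Js Jt; have Hg := g_smooth hflow Jt.
have Ws := lnrho_C1M Js Jt; have Us := u_C1M Js; have Ut := u_C1M Jt.
have n1 := green_uP Jt Jt Us; have n2 := green_uP Js Jt Ut.
have n3 := green_WP Js Jt (C1M_mul Ut Us).
have n4 := green_uP Jt Jt (C1M_mul Ws Us); have n5 := green_uP Js Jt (C1M_mul Ws Ut).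
have add := null_addmul hc hM Hg (hdv Jt).
have N := add b _ _ (add b _ _ (add (- b) _ _ (add (-1) _ _ n1 n2) n3) n4) n5.
have -> : defect s t = fun p => green_u t t (u s) p + (-1) * green_u s t (u t) p +
  (- b) * green_W s t (fun q => u t q * u s q) p +
  b * green_u t t (fun q => W s t q * u s q) p +
  b * green_u s t (fun q => W s t q * u t q) p by apply/funext => p; exact: defectE.
exact: N.
Qed.

(** The limit of [defect s t] / (s - t) as s tends to t, where l is the derivative of
    the eigenvalue. *)
Definition defect0 t l p : R :=
  u t p ^+ 2 * (lambda t * (r t - Sc t p) + l) +
  b * ((r t - Sc t p) * (2 * u t p ^+ 2 * (b * Sc t p - lambda t) + 2 * gip (g t) (u t) (u t) p)).

(** Both (rho - 1) / (s - t) and W / (s - t) tend to r - S, while u s and its gradient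
    tend to u t and its gradient. *)
Lemma defect_quotient t l p : J t -> tderiv T lambda t l ->
  (fun z : R * M => defect z.1 t z.2 / (z.1 - t)) @ jt T t p --> defect0 t l p.
Proof.
move=> Jt hl; have F1 := jt_filter T t p.
have Lu : (fun z : R * M => u z.1 z.2) @ jt T t p --> u t p by exact: (u_lim Jt).
have Lg : (fun z : R * M => gip (g t) (u t) (u z.1) z.2) @ jt T t p --> gip (g t) (u t) (u t) p.
  exact: (gip_lim Jt).
have Lu0 : (fun z : R * M => u t z.2) @ jt T t p --> u t p.
  by apply: (@jt_space R T M t p (u t)); exact: (C1M_cont (u_C1M Jt) (x := p)).
have LS0 : (fun z : R * M => Sc t z.2) @ jt T t p --> Sc t p.
  by apply: (@jt_space R T M t p (Sc t)); exact: (Scal_cont hflow hphi Jt (x := p)).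
have LS : (fun z : R * M => Sc z.1 z.2) @ jt T t p --> Sc t p.
  exact: (jw_jt (Scal_jw hflow hphi Jt)).
have Ll : (fun z : R * M => lambda z.1) @ jt T t p --> lambda t.
  exact: (@jt_timefun R T M t p lambda _ (tderiv_cont hl)).
have Ld : (fun z : R * M => (lambda z.1 - lambda t) / (z.1 - t)) @ jt T t p --> l.
  exact: (@jt_timefun R T M t p (fun s => (lambda s - lambda t) / (s - t)) _ hl).
have Lr : (fun z : R * M => rh z.1 t z.2) @ jt T t p --> (1 : R).
  exact: (rho_lim hflow hphi p Jt).
have Lrq : (fun z : R * M => (rh z.1 t z.2 - 1) / (z.1 - t)) @ jt T t p --> r t - Sc t p.
  exact: (rho_quotient hflow hphi Jt).
have LW : (fun z : R * M => W z.1 t z.2 / (z.1 - t)) @ jt T t p --> r t - Sc t p.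
  exact: (lnrho_quotient hflow hphi Jt).
have cst (k : R) : (fun _ : R * M => k) @ jt T t p --> k by exact: flim_cst.
have E : defect0 t l p = u t p * u t p * (lambda t * (r t - Sc t p) + l) +
   b * ((r t - Sc t p) * (u t p * u t p * (b * Sc t p - lambda t) +
     u t p * u t p * 1 * (b * Sc t p - lambda t) + 2 * gip (g t) (u t) (u t) p)).
  by rewrite /defect0; move: (u t p) (Sc t p) (gip _ _ _ _) (lambda t) (r t) => *; ring.
rewrite E; apply: (flim_eq_near _ (flim_add
  (flim_mul (flim_mul Lu0 Lu) (flim_add (flim_mul Ll Lrq) Ld))
  (flim_mul (cst b) (flim_mul LW (flim_add (flim_add
    (flim_mul (flim_mul Lu0 Lu) (flim_add (flim_mul (cst b) LS0) (cst (- lambda t))))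
    (flim_mul (flim_mul (flim_mul Lu0 Lu) Lr) (flim_add (flim_mul (cst b) LS) (flim_opp Ll))))
    (flim_mul (cst 2) Lg)))))).
apply: nearW => -[s q] /=; rewrite /defect.
move: (u t q) (u s q) (Sc t q) (Sc s q) (rh s t q) (W s t q) (gip _ _ _ _) (lambda s) (lambda t) ((s - t)^-1) => *.
ring.
Qed.

Lemma defect0_cont t l : J t -> continuous (defect0 t l).
Proof.
move=> Jt p; have c2 := Scal_cont hflow hphi Jt (x := p); have c3 := C1M_cont (u_C1M Jt) (x := p).
have c4 := gip_cont (g_smooth hflow Jt) (u_C1M Jt) (u_C1M Jt) (x := p).
have cu2 : {for p, continuous (fun q => u t q ^+ 2)} by exact: (cont_mul c3 c3).
have cst (k : R) : {for p, continuous (fun _ : M => k)} by exact: cont_cst.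
have crS : {for p, continuous (fun q => r t - Sc t q)}.
  by apply: cont_add; [exact: cst|exact: cont_opp].
have cB : {for p, continuous (fun q => b * Sc t q - lambda t)}.
  exact: (cont_add (cont_mul (cst b) c2) (cst (- lambda t))).
have cA : {for p, continuous (fun q => lambda t * (r t - Sc t q) + l)}.
  exact: (cont_add (cont_mul (cst (lambda t)) crS) (cst l)).
exact: (cont_add (cont_mul cu2 cA) (cont_mul (cst b) (cont_mul crS
  (cont_add (cont_mul (cont_mul (cst 2) cu2) cB) (cont_mul (cst 2) c4))))).
Qed.

Lemma defect0_null t l : J t -> tderiv T lambda t l -> null (dv t) (defect0 t l).
Proof.
move=> Jt hl; have Hg := g_smooth hflow Jt; split; first exact: defect0_cont.
have dn s : J s -> null (dv t) (fun p => defect s t p / (s - t)).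
  move=> Js; have n := defect_null Js Jt.
  have X := null_addmul hc hM Hg (hdv Jt) ((s - t)^-1 - 1) n n.
  have -> : (fun p => defect s t p / (s - t)) =
    (fun p => defect s t p + ((s - t)^-1 - 1) * defect s t p); last exact: X.
  by apply/funext => p; move: (defect s t p) ((s - t)^-1) => *; ring.
rewrite /realint (integral_limit0 hc hM Hg (hdv Jt) Jt (Fs := fun s p => defect s t p / (s - t))) //.
- by move=> s Js _; have [] := dn s Js.
- exact: defect0_cont.
- by move=> p; exact: defect_quotient.
- move=> s Js _; have [c0 i0] := dn s Js.
  by rewrite (integral_fin hc hM Hg (hdv Jt) c0) -/(realint (dv t) _) i0.
Qed.

(** The integrand of the evolution inequality without the terms in phi, which
    vanish. *)
Definition rate t p : R :=
  2 * b ^+ 2 * Sc t p ^+ 2 * u t p ^+ 2 + (1 - 2 * b) * lambda t * Sc t p * u t p ^+ 2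
  + 2 * b * Sc t p * gip (g t) (u t) (u t) p.

Lemma u2_cont t : J t -> continuous (fun p => u t p ^+ 2).
Proof.
by move=> Jt p; have c3 := C1M_cont (u_C1M Jt) (x := p); exact: (cont_mul c3 c3).
Qed.

Lemma realint_u2 t : J t -> realint (dv t) (fun p => u t p ^+ 2) = 1.
Proof. by move=> Jt; rewrite /realint (eigen_normalized (heigen Jt)). Qed.

(** The function (l + lambda r) u^2 - rate is defect0 minus 2 b r times the integrand
    of Green's formula for the pair (u, u), and the integral of u^2 is 1. *)
Lemma eigenvalue_variation t l : J t -> tderiv T lambda t l ->
  continuous (rate t) /\ realint (dv t) (rate t) = l + lambda t * r t.
Proof.
move=> Jt hl; have Hg := g_smooth hflow Jt.
have add := null_addmul hc hM Hg (hdv Jt).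
have n1 := green_uP Jt Jt (u_C1M Jt); have n0 := defect0_null Jt hl.
have [cN iN] := add (- (2 * b * r t)) _ _ n0 n1.
set N := (fun p => _) in cN iN.
have c2 := u2_cont Jt.
have c3 : continuous (fun p => (l + lambda t * r t) * u t p ^+ 2).
  exact: continuous_cmul c2.
have c4 : continuous (fun p => -1 * N p).
  exact: continuous_cmul cN.
have E : rate t = fun p => (l + lambda t * r t) * u t p ^+ 2 + -1 * N p.
  apply/funext => p; rewrite /rate /N /defect0 /green_u /lap_u (rho_self p Jt).
  move: (u t p) (Sc t p) (gip _ _ _ _) (lambda t) (r t) => *; ring.
split; first by rewrite E => p; exact: (cont_add (c3 p) (c4 p)).
rewrite E (realint_add hc hM Hg (hdv Jt) c3 c4) (realint_cmul hc hM Hg (hdv Jt) _ c2) realint_u2 //.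
by rewrite (realint_cmul hc hM Hg (hdv Jt) _ cN) iN mulr0 addr0 mulr1.
Qed.

(** Green's formula for the pair (u, u) expresses lambda as the integral of
    |grad u|^2 + b S u^2. *)
Lemma eigenvalue_ge0 t : J t -> 0 <= b -> (forall p, 0 <= Sc t p) -> 0 <= lambda t.
Proof.
move=> Jt b0 S0; have Hg := g_smooth hflow Jt.
have [c1 i1] := green_uP Jt Jt (u_C1M Jt); have c2 := u2_cont Jt.
have cl : continuous (fun p => lambda t * u t p ^+ 2).
  exact: continuous_cmul c2.
have : 0 <= realint (dv t) (fun p => lambda t * u t p ^+ 2 + green_u t t (u t) p).
  apply: realint_ge0 => p; rewrite /green_u /lap_u (rho_self p Jt).
  have := gip_ge0 Hg (u t) p; have := S0 p; have := sqr_ge0 (u t p).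
  move: (u t p) (Sc t p) (gip _ _ _ _) (lambda t) => v k G m v0 k0 G0.
  have -> : m * v ^+ 2 + (v * (1 * ((b * k - m) * v)) + G) = b * k * v ^+ 2 + G by ring.
  by rewrite addr_ge0 // mulr_ge0 // mulr_ge0.
by rewrite (realint_add hc hM Hg (hdv Jt) cl c1) (realint_cmul hc hM Hg (hdv Jt) _ c2) realint_u2 // i1 mulr1 addr0.
Qed.

Lemma M_grad2_gip t f p : J t -> M_grad2 (g t) f p = gip (g t) f f p.
Proof.
move=> Jt; rewrite /M_grad2 /gip; set c := chart_at A p.
have ic : img c (cmap c p) := img_cmap (dom_chart_at A p).
have HG := g_germ hflow Jt ic; rewrite /grad2 /gtrace /ginner.
apply: eq_bigr => i _; apply: eq_bigr => j _.
by rewrite (nbhs_singleton (invmx_near HG)) mxE.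
Qed.

Lemma M_grad2_phi t p : J t -> M_grad2 (g t) (phi t) p = 0.
Proof.
move=> Jt; rewrite /M_grad2; set c := chart_at A p.
have ic : img c (cmap c p) := img_cmap (dom_chart_at A p).
rewrite /grad2 (dtensor_phi hflow hphi Jt ic) /gtrace.
by apply: big1 => i _; apply: big1 => j _; rewrite mxE mulr0.
Qed.

(** The first derivatives of phi vanish on a neighbourhood of each point. *)
Lemma M_laplacian_phi t p : J t -> M_laplacian (g t) (phi t) p = 0.
Proof.
move=> Jt; rewrite /M_laplacian; set c := chart_at A p.
have ic : img c (cmap c p) := img_cmap (dom_chart_at A p).
have pd0 j y : img c y -> pd j (local c (phi t)) y = 0 by move=> iy; exact: (pd_phi hflow hphi).
have N j : \forall y \near cmap c p, pd j (local c (phi t)) y = 0.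
  by apply: filterS (img_nbhs ic) => y; exact: pd0.
rewrite /laplacian /gtrace; apply: big1 => i _; apply: big1 => j _.
rewrite mxE (pd_eq_near i (N j)) pd_cst big1 ?subr0 ?mulr0 // => k _.
by rewrite pd0 // mulr0.
Qed.
End Variation.

(** * The evolution inequality *)

Theorem theorem1p6 (R : realType) (M : ptopologicalType)
  (hcompact : compact [set: M]) (hhausdorff : hausdorff_space M)
  (A : atlas2 R M)
  (alpha : R) (halpha : 0 < alpha)
  (T : \bar R) (hT : (0 < T)%E)
  (g : R -> metric_components A) (phi : R -> M -> R) (r : R -> R)
  (hflow : rescaled_list_flow alpha (times T) g phi r)
  (dv : R -> {measure set (borel M) -> \bar R})
  (hdv : forall t, times T t -> is_volume (g t) (dv t))
  (hS : forall t (c : chart A) x, times T t -> img c x ->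
     0 <= S_scalar (g t c) alpha (local c (phi t)) x)
  (b : R) (lambda : R -> R) (u : R -> M -> R)
  (heigen : forall t, times T t ->
     eigenpair (g t) (dv t) alpha b (phi t) (lambda t) (u t))
  (hlambda : forall t, times T t ->
     exists l, has_deriv_within (times T) lambda t 1 l)
  (hu : Ck_family A 1 (times T) u)
  (hphi : forall t (c : chart A) x, times T t -> img c x ->
     le_tensor (2 *: dtensor (local c (phi t)) x)
               (grad2 (g t c) (local c (phi t)) x *: g t c x))
  (hb0 : 0 < b) (hb1 : b <= 1 / 2) :
  forall t, times T t ->
    let S := M_S (g t) alpha (phi t) in
    let rhs := ((exp_int r t)%:E * \int[dv t]_p
      (2 * b ^+ 2 * S p ^+ 2 * u t p ^+ 2
       + (1 - 2 * b) * lambda t * S p * u t p ^+ 2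
       + 2 * b * S p * M_grad2 (g t) (u t) p
       + b * alpha ^+ 2 * M_grad2 (g t) (phi t) p ^+ 2 * u t p ^+ 2
       + 2 * b * alpha * M_laplacian (g t) (phi t) p ^+ 2 * u t p ^+ 2)%:E)%E in
    exists l : R,
      [/\ has_deriv_within (times T) (fun s => lambda s * exp_int r s) t 1 l,
          (rhs <= l%:E)%E
        & (0 <= rhs)%E].
Proof.
move=> t Jt S rhs.
have [l /hdwP hl] := hlambda t Jt.
have Hg := g_smooth hflow Jt.
have S0 p : 0 <= Scal alpha g phi t p by exact: (hS _ _ _ Jt (img_cmap (dom_chart_at A p))).
have [crate irate] := eigenvalue_variation hcompact hhausdorff hflow hphi hdv heigen hu Jt hl.
have l0 : 0 <= lambda t.
  by apply: (eigenvalue_ge0 hcompact hhausdorff hflow hphi hdv heigen Jt _ S0); exact: ltW.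
have rhsE : rhs = ((exp_int r t) * (l + lambda t * r t))%:E.
  rewrite /rhs EFinM -irate /realint -(integral_fin hcompact hhausdorff Hg (hdv t Jt) crate).
  congr (_ * _)%E; apply: eq_integral => p _; congr EFin.
  rewrite (M_grad2_phi hflow hphi p Jt) (M_laplacian_phi hflow hphi p Jt).
  rewrite (M_grad2_gip hflow _ _ Jt) /rate /S -/(Scal alpha g phi t p).
  by rewrite !expr0n /= !mulr0 !mul0r !addr0.
have e0 : 0 <= exp_int r t by exact: expR_ge0.
exists (exp_int r t * (l + lambda t * r t)); split.
- apply/hdwP.
  have X := tderiv_mul hl (tderiv_exp_int (fun s Js => r_cont hflow hphi Js) Jt).
  have -> : exp_int r t * (l + lambda t * r t) =
    l * exp_int r t + lambda t * (exp_int r t * r t) by ring.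
  exact: X.
- by rewrite rhsE.
- rewrite rhsE lee_fin -irate mulr_ge0 // realint_ge0 // => p.
  have := gip_ge0 Hg (u t) p; have := S0 p; rewrite /rate.
  move: (Scal _ _ _ _ _) (gip _ _ _ _) (u t p) => k G v k0 G0.
  have b2 : 0 <= 1 - 2 * b by lra.
  have b0 := ltW hb0.
  have := sqr_ge0 v; have := sqr_ge0 k; have := sqr_ge0 b.
  move: (v ^+ 2) (k ^+ 2) (b ^+ 2) => v2 k2 b2' *; by rewrite !addr_ge0 ?mulr_ge0.
Qed.
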